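(* Let $K\subset\mathbb{R}^d$ be compact, $\mathbf p$ a Borel probability measure on $\mathcal P(K)$, $\lambda\ge0$, $n,N\in\mathbb{N}$, $\mathcal V_n$ an $n$-dimensional space of cylinder functions on $\mathcal P(K)$, $\{\ell_1,\dots,\ell_n\}$ a basis of $\mathcal V_n$ orthonormal in $L^2(\mathcal P(K),\mathbf p)$ with $\mathrm{pCE}_{2,\mathbf p}(\ell_i,\ell_j)=0$ for $i\ne j$, $\mu_1,\dots,\mu_N$ i.i.d. with law $\mathbf p$ and $\mathbf p_N:=\frac1N\sum_j\delta_{\mu_j}$. Let $M>0$, $F:\mathcal P(K)\to[-M,M]$ measurable, let $(\eta_j)_{j=1}^N$ be i.i.d. random variables with variance bounded by $\sigma^2>0$, set $\widetilde F(\mu_j):=F(\mu_j)+\eta_j$, and $\widetilde F^\star:=-M\vee S_N^{\lambda,n}(\widetilde F)\wedge M$. Let $r>0$ and suppose $N\ge2$ and $\frac{N}{\log N}\ge\frac{(1+r)K_\lambda(n)}{\sigma^\lambda_{\min,n}c_{1/(2\sigma^\lambda_{\max,n})}}$. Then \[\mathbb E\big[\|F-\widetilde F^\star\|^2_{L^2(\mathcal P(K),\mathbf p)}\big]\le 2e(F,n)\Big(1+\frac{c_{1/2}}{\log(N)(1+r)(1/2+\lambda\mu_{\min,n})^2}\Big)+8\lambda\,\mathrm{pCE}_{2,\mathbf p}(P_nF)+4\frac{\sigma^2}{(1+\lambda\mu_{\min,n})^2}\frac nN+2M^2N^{-r},\] with $P_nF$ the $L^2(\mathcal P(K),\mathbf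 p)$-orthogonal projection of $F$ onto $\mathcal V_n$, $e(F,n):=\|P_nF-F\|^2_{L^2(\mathcal P(K),\mathbf p)}$, $\mu_{\min,n}:=\min_i\mathrm{pCE}_{2,\mathbf p}(\ell_i)$.
   Context: $\mathcal P(K)$: Borel probability measures on $K$ with the 2-Wasserstein distance. Cylinder function: $G=\psi\circ L_{\boldsymbol\phi}$, $L_{\boldsymbol\phi}(\mu)=(\int\phi_1d\mu,\dots,\int\phi_md\mu)$, $\psi\in C_b^1(\mathbb{R}^m)$, $\phi_i\in C^1_b$; ${\rm D}G(\mu,x)=\sum_i\partial_i\psi(L_{\boldsymbol\phi}(\mu))\nabla\phi_i(x)$. $\mathrm{pCE}_{2,\mathbf n}(G,H):=\int\int_K{\rm D}G\cdot{\rm D}H\,d\mu\,d\mathbf n(\mu)$, $\mathrm{pCE}_{2,\mathbf n}(G)=\mathrm{pCE}_{2,\mathbf n}(G,G)$. For a function $\Psi$ defined on $\{\mu_1,\dots,\mu_N\}$, $S_N^{\lambda,n}(\Psi)$ is the minimizer over $G\in\mathcal V_n$ of $\|\Psi-G\|^2_{L^2(\mathcal P(K),\mathbf p_N)}+\lambda\mathrm{pCE}_{2,\mathbf p_N}(G)$. $K_\lambda(n):=\sup_{\mu\in\mathcal P(K)}\sum_{i}(|\ell_i(\mu)|^2+\lambda\int_K|{\rm D}\ell_i(\mu,x)|^2d\mu(x))$; $\sigma^\lambda_{\min,n}:=1+\lambda\min_i\mathrm{pCE}_{2,\mathbf p}(\ell_i)$; $\sigma^\lambda_{\max,n}:=1+\lambda\max_i\mathrm{pCE}_{2,\mathbf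 p}(\ell_i)$; $c_\delta:=(1+\delta)\log(1+\delta)-\delta$.
   Formalization: The noise variables η_j are additionally assumed to have mean zero and to be independent of the samples μ_1,…,μ_N; without either assumption the bound fails (e.g. constant noise M/2 with F=0, λ=0 and V_n the constants, N large). *)

(* Defs.v *)
From HB Require Import structures.
From mathcomp Require Import all_boot all_order all_algebra.
From mathcomp Require Import all_classical all_reals all_analysis.
Set Implicit Arguments. Unset Strict Implicit. Unset Printing Implicit Defensive.
Import Order.TTheory GRing.Theory Num.Theory.
Import numFieldNormedType.Exports.
Local Open Scope classical_set_scope.
Local Open Scope ring_scope.

Section Defs.
Variable R : realType.

Definition Rd (d : nat) := g_sigma_algebraType (@open 'rV[R]_d).

Definition dotv d (x y : 'rV[R]_d) : R := \sum_(l < d) x ord0 l * y ord0 l.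
Definition sqnorm d (x : 'rV[R]_d) : R := dotv x x.
Definition sqdist d (x y : 'rV[R]_d) : R := \sum_(l < d) (x ord0 l - y ord0 l) ^+ 2.

Definition unitv m (k : 'I_m) : 'rV[R]_m := delta_mx 0 k.
Definition pderiv m (f : 'rV[R]_m -> R) (k : 'I_m) (x : 'rV[R]_m) : R :=
  derive f x (unitv k).
Definition grad m (f : 'rV[R]_m -> R) (x : 'rV[R]_m) : 'rV[R]_m :=
  \row_(l < m) pderiv f l x.
Definition C1b m (f : 'rV[R]_m -> R) : Prop :=
  (exists B : R, forall x, `|f x| <= B) /\
  (forall x, differentiable f x) /\
  (forall k, continuous (pderiv f k)) /\
  (forall k, exists B : R, forall x, `|pderiv f k x| <= B).

(** P(K): Borel probability measures on R^d concentrated on K.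
    A point k0 of K is used only to equip the type with a default element. *)
Definition PK (d : nat) (K : set (Rd d)) (k0 : Rd d) (hk0 : K k0) : Type :=
  {mu : probability (Rd d) R | mu (~` K) = 0%E}.

Section PK.
Variables (d : nat) (K : set (Rd d)) (k0 : Rd d) (hk0 : K k0).

Lemma dirac_PK : (dirac k0 : probability (Rd d) R) (~` K) = 0%E.
Proof. rewrite /= /dirac /= indicE memNset //. Qed.

HB.instance Definition _ := gen_eqMixin (PK hk0).
HB.instance Definition _ := gen_choiceMixin (PK hk0).
HB.instance Definition _ := isPointed.Build (PK hk0)
  (exist _ (dirac k0 : probability (Rd d) R) dirac_PK).

Definition coupling (mu nu : probability (Rd d) R)
  (pi : probability (Rd d * Rd d)%type R) : Prop :=
  (forall A : set (Rd d), measurable A -> pi (A `*` setT) = mu A) /\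
  (forall B : set (Rd d), measurable B -> pi (setT `*` B) = nu B).

Definition W2sq (mu nu : probability (Rd d) R) : \bar R :=
  ereal_inf [set (\int[pi]_z (sqdist z.1 z.2)%:E)%E |
             pi in [set pi | coupling mu nu pi]].

Definition W2open : set (set (PK hk0)) :=
  [set A | forall mu, A mu -> exists e : R, 0 < e /\
     forall nu, (W2sq (proj1_sig mu) (proj1_sig nu) < (e ^+ 2)%:E)%E -> A nu].

Definition PKm := g_sigma_algebraType W2open.
End PK.

Definition Lphi d m (phi : 'I_m -> 'rV[R]_d -> R) (mu : probability (Rd d) R)
  : 'rV[R]_m := \row_(k < m) Rintegral mu setT (phi k).
Definition cyl_eval d m (psi : 'rV[R]_m -> R) (phi : 'I_m -> 'rV[R]_d -> R)
  (mu : probability (Rd d) R) : R := psi (Lphi phi mu).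
Definition cyl_D d m (psi : 'rV[R]_m -> R) (phi : 'I_m -> 'rV[R]_d -> R)
  (mu : probability (Rd d) R) (x : 'rV[R]_d) : 'rV[R]_d :=
  \sum_(k < m) pderiv psi k (Lphi phi mu) *: grad (phi k) x.

Section Vn.
Variables (d n : nat) (m : 'I_n -> nat)
  (psi : forall i, 'rV[R]_(m i) -> R)
  (phi : forall i, 'I_(m i) -> 'rV[R]_d -> R).

Definition ell (i : 'I_n) (mu : probability (Rd d) R) : R :=
  cyl_eval (@psi i) (@phi i) mu.
Definition Dell (i : 'I_n) (mu : probability (Rd d) R) (x : 'rV[R]_d)
  : 'rV[R]_d := cyl_D (@psi i) (@phi i) mu x.
Definition Veval (c : 'I_n -> R) (mu : probability (Rd d) R) : R :=
  \sum_(i < n) c i * ell i mu.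
Definition VD (c : 'I_n -> R) (mu : probability (Rd d) R) (x : 'rV[R]_d)
  : 'rV[R]_d := \sum_(i < n) c i *: Dell i mu x.
End Vn.

(** pCE_{2,q}(G,H) for a Borel probability q on P(K), with G,H given by
    their derivatives D G, D H. *)
Definition pCE d (K : set (Rd d)) (k0 : Rd d) (hk0 : K k0)
  (q : probability (PKm hk0) R)
  (DG DH : probability (Rd d) R -> 'rV[R]_d -> 'rV[R]_d) : R :=
  Rintegral q setT (fun mu : PKm hk0 =>
    Rintegral (proj1_sig mu) setT (fun x => dotv (DG (proj1_sig mu) x) (DH (proj1_sig mu) x))).

Definition c_delta (delta : R) : R := (1 + delta) * ln (1 + delta) - delta.

End Defs.

(* Main.v *)
Require Import Defs.
From HB Require Import structures.
From mathcomp Require Import all_boot all_order all_algebra.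
From mathcomp Require Import all_classical all_reals all_analysis.
From mathcomp Require Import measurable_realfun ring lra.
Set Implicit Arguments. Unset Strict Implicit. Unset Printing Implicit Defensive.
Import Order.TTheory GRing.Theory Num.Theory.
Import numFieldNormedType.Exports.
Local Open Scope classical_set_scope.
Local Open Scope ring_scope.

(** Write [F = P_n F + g] with [g] orthogonal to [V_n]; the normal equations read
    [G c = beta], where [G] is the empirical mean of the matrices
    [X(mu) = l(mu) l(mu)^T + lambda (D l_i . D l_j)_(ij)] and [E X >= sigma_min].
    On the event [G >= sigma_min / 2] the error [a - c] splits into
    [G^-1 (lambda D_N a - (1/N) sum_j g(mu_j) l(mu_j))] and the noise term
    [G^-1 (1/N) sum_j eta_j l(mu_j)].  The first is estimated deterministically, the
    cross term has mean zero because the noise is independent of the sample, and the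
    two empirical means have second moments at most [K e / N] and [sigma^2 n / N].
    Off that event the clipped error is at most [4 M^2], and the probability of the
    complement is at most [N^-r / 2] by a lower-tail matrix Chernoff bound.

    The Chernoff bound avoids matrix exponentials: the trace of
    [(1 + t (s - sum_j Z_j)) ^ m] with [m = 2^l] and [t = ln 2 / m] replaces
    [tr exp (ln 2 (s - sum_j Z_j))].  Golden-Thompson becomes
    [tr (B C)^m <= tr (B^m C^m)], a consequence of Hoelder's inequality for traces,
    up to an error which tends to zero as [m] grows.  As this trace is a polynomial in
    the sample, the good event is measurable. *)

(** Origin of the constants: as sigma_max >= 1, [c_delta] is at most 1/8 at 1 / (2 sigma_max), so
    the sample-size hypothesis gives 8 (1 + r) K ln N <= N sigma_min. The Chernoff rate (1 - ln 2) /
    2 is at least 1/8, hence the exponential is at most N^-(1+r). The dimension in front of it is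
    absorbed by n sigma_min <= K, which with ln N >= 2/3 gives n / N <= 3/16. The same lower bound
    on ln N makes the sampling error of g at most e.

    Obstacle: the minimizer [c] is an arbitrary selection, with no measurability in [w] assumed and
    no uniqueness where G is singular. Expectations are therefore taken of a measurable majorant in
    which [c] does not occur. The Chernoff trace plays two roles there: the good event is where it
    is below 1, and the trace itself majorizes the indicator of the complement. For the cross term,
    functions of the sample must be measurable for a sigma-algebra that omits one noise variable;
    this is why several measurability statements are made after composition with an arbitrary map
    into [Omega]. *)

Section LinearAlgebra.
Variable R : realFieldType.

(** Discriminant argument behind the Cauchy-Schwarz inequalities below; with [a = 0] it forces the
    linear coefficient to vanish, which yields the normal equations. When [c <= 0] and [b] is
    nonzero, the value of [t] that makes the linear term equal to [a + 1] contradicts the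
    assumption. *)
Lemma sqr_le_of_quadratic (a b c : R) :
  (forall t, 0 <= a - 2 * t * b + t ^+ 2 * c) -> b ^+ 2 <= a * c.
Proof.
move=> H.
have a0 : 0 <= a by have := H 0; rewrite mulr0 mul0r expr0n /= mul0r subr0 addr0.
case: (ltrgtP c 0) => [c0|c0|c0].
- have [b0|b0] := eqVneq b 0.
    have := H ((a + 1) / c - 1); rewrite b0 mulr0 subr0 => H1.
    exfalso.
    have E : ((a + 1) / c - 1) ^+ 2 * c = (a + 1 - c) ^+ 2 / c.
      by field; rewrite lt_eqF.
    rewrite E in H1.
    have : 0 <= (a + (a + 1 - c) ^+ 2 / c) * (- c).
      by rewrite mulr_ge0 // oppr_ge0 ltW.
    have -> : (a + (a + 1 - c) ^+ 2 / c) * (- c) = - (a * c + (a + 1 - c) ^+ 2).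
      by field; rewrite lt_eqF.
    by nra.
  exfalso.
  have := H ((a + 1) / (2 * b)).
  have -> : 2 * ((a + 1) / (2 * b)) * b = a + 1 by field.
  have : ((a + 1) / (2 * b)) ^+ 2 * c <= 0.
    by rewrite mulr_ge0_le0 // ?sqr_ge0 // ltW.
  lra.
- have := H (b / c).
  have -> : a - 2 * (b / c) * b + (b / c) ^+ 2 * c = (a * c - b ^+ 2) / c.
    by field; rewrite gt_eqF.
  by rewrite pmulr_lge0 ?invr_gt0 // subr_ge0.
- have [b0|b0] := eqVneq b 0; first by rewrite b0 c0 expr0n /= mulr0.
  exfalso.
  have := H ((a + 1) / (2 * b)).
  have -> : 2 * ((a + 1) / (2 * b)) * b = a + 1 by field.
  rewrite c0 mulr0; lra.
Qed.

(** * Trace inequalities of Hoelder type for exponents that are powers of two *)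

Variable n : nat.
Implicit Types A B M X : 'M[R]_n.

Lemma mxtrace_mul_tr_ge0 A : 0 <= \tr (A *m A^T).
Proof.
apply: sumr_ge0 => i _; rewrite mxE; apply: sumr_ge0 => j _.
by rewrite mxE -expr2 sqr_ge0.
Qed.

Lemma mxtrace_CauchySchwarz A B :
  (\tr (A *m B)) ^+ 2 <= \tr (A *m A^T) * \tr (B^T *m B).
Proof.
apply: sqr_le_of_quadratic => t.
have := mxtrace_mul_tr_ge0 (A - t *: B^T).
have -> : (A - t *: B^T)^T = A^T - t *: B by rewrite linearB /= linearZ /= trmxK.
rewrite mulmxBl !mulmxBr -!scalemxAl -!scalemxAr.
rewrite !raddfB /= !mxtraceZ.
have -> : \tr (B^T *m A^T) = \tr (A *m B) by rewrite -trmx_mul mxtrace_tr.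
by move=> H; apply: (le_trans H); rewrite le_eqVlt; apply/orP; left; apply/eqP; ring.
Qed.

(* [schatten k A] is the [2^(k+1)]-th power of the Schatten [2^(k+1)]-norm of [A]. *)
Definition schatten k A := \tr ((A^T *m A) ^+ (2 ^ k)).

Lemma trmxX A k : (A ^+ k)^T = (A^T) ^+ k.
Proof.
elim: k => [|k IH]; first by rewrite !expr0 trmx1.
by rewrite exprS trmx_mul IH exprSr.
Qed.

Lemma sym_square (A : 'M[R]_n) k : A^T = A -> (0 < k)%N ->
  A ^+ (2 ^ k) = (A ^+ (2 ^ k.-1)) *m (A ^+ (2 ^ k.-1))^T.
Proof. by case: k => // k As _; rewrite trmxX As -[RHS]/(_ ^+ _ * _ ^+ _) -exprD addnn -mul2n -expnS. Qed.

Lemma schatten_ge0 k A : 0 <= schatten k A.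
Proof.
case: k => [|k]; rewrite /schatten.
  by rewrite expr1 mxtrace_mulC mxtrace_mul_tr_ge0.
by rewrite sym_square ?mxtrace_mul_tr_ge0 // trmx_mul trmxK.
Qed.

Lemma mxtrace_mulX A B k : \tr ((A *m B) ^+ k) = \tr ((B *m A) ^+ k).
Proof.
case: k => [|k]; first by rewrite !expr0.
have H j : (A *m B) ^+ j.+1 = A *m (B *m A) ^+ j *m B.
  elim: j => [|j IH]; first by rewrite expr1 expr0 mulmx1.
  by rewrite exprS IH [in RHS]exprS -![_ *m _]/(_ * _) -!mulrA.
by rewrite H mxtrace_mulC mulmxA exprS.
Qed.

Lemma schatten_tr k A : schatten k A^T = schatten k A.
Proof. by rewrite /schatten trmxK mxtrace_mulX. Qed.

Lemma big_nat_pair (T : Type) (idx : T) (op : Monoid.law idx) (F : nat -> T) N :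
  \big[op/idx]_(0 <= i < 2 * N) F i =
  \big[op/idx]_(0 <= i < N) op (F (2 * i)%N) (F (2 * i).+1).
Proof.
elim: N => [|N IH]; first by rewrite muln0 !big_geq.
rewrite [in RHS]big_nat_recr //= -IH mulnS addnC addn2 !big_nat_recr //=.
by rewrite Monoid.mulmA.
Qed.

Lemma sqrt_le (x y : R) k : 0 <= y -> x ^+ (2 ^ k) <= y ^+ (2 ^ k) -> x <= y.
Proof.
move=> y0; have [x0 _|x0] := lerP x 0; first exact: le_trans x0 y0.
by rewrite ler_pXn2r ?nnegrE ?expn_gt0 // ltW.
Qed.

(** Induction by doubling: adjacent factors are multiplied together, the induction hypothesis is
    applied to the half-length product, and each pair is separated by [pair]. The base case is
    Cauchy-Schwarz for the trace. *)
Lemma mxtrace_Holder k (F : nat -> 'M[R]_n) :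
  (\tr (\prod_(0 <= i < 2 ^ k.+1) F i)) ^+ (2 ^ k.+1) <=
  \prod_(0 <= i < 2 ^ k.+1) schatten k (F i).
Proof.
elim: k F => [|k IH] F.
  rewrite expn1 !big_nat_recr //= !big_geq // !mul1r.
  rewrite -[schatten 0 (F 0%N)]schatten_tr /schatten expn0 !expr1 trmxK.
  exact: mxtrace_CauchySchwarz.
(* By cyclicity the left trace is that of the alternating word [P Q P Q ...] of length [2 ^ k.+1],
   to which the induction hypothesis already applies; a [2 ^ k]-th root of the result is then
   taken. *)
have pair A B : schatten k (A *m B) ^+ 2 <= schatten k.+1 A * schatten k.+1 B.
  pose P := A^T *m A; pose Q := B *m B^T.
  have E : schatten k (A *m B) = \tr ((P *m Q) ^+ (2 ^ k)).
    rewrite /schatten trmx_mul -mulmxA mxtrace_mulX /P /Q.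
    by rewrite -!mulmxA.
  have := IH (fun i => if odd i then Q else P).
  have prodE (S : pzSemiRingType) (x y : S) :
      \prod_(0 <= i < 2 ^ k.+1) (if odd i then y else x) = (x * y) ^+ (2 ^ k).
    rewrite expnS big_nat_pair (eq_bigr (fun=> x * y)); last first.
      by move=> i _; rewrite oddM /= oddM.
    by rewrite prodr_const_nat subn0.
  rewrite (prodE _ P Q) -[_ ^+ (2 ^ k)]/(_ ^+ _) -E.
  rewrite (eq_bigr (fun i => if odd i then schatten k Q else schatten k P)); last first.
    by move=> i _; case: ifP.
  rewrite prodE expnS exprM.
  have -> : schatten k P = schatten k.+1 A.
    by rewrite /schatten /P trmx_mul trmxK -[_ *m _]expr2 -exprM expnS.
  have -> : schatten k Q = schatten k.+1 B.
    by rewrite -[in RHS]schatten_tr /schatten /Q trmx_mul trmxK -[_ *m _]expr2 -exprM expnS.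
  by apply: sqrt_le; rewrite mulr_ge0 ?schatten_ge0.
rewrite [in X in X <= _]expnS [in X in X <= _]big_nat_pair.
have := IH (fun i => F (2 * i)%N * F (2 * i).+1).
rewrite [(2 ^ k.+2)%N]expnS [in X in _ -> _ <= X]big_nat_pair => H.
rewrite mulnC exprM.
apply: (le_trans (y := (\prod_(0 <= i < 2 ^ k.+1) schatten k (F (2 * i)%N * F (2 * i).+1)) ^+ 2)).
  by rewrite ler_pXn2r ?nnegrE ?prodr_ge0 ?exprn_even_ge0 ?oddX // => *; exact: schatten_ge0.
rewrite -prodrXl; apply: ler_prod => i _.
by rewrite sqr_ge0 /= pair.
Qed.

(** Hoelder with all factors equal to [M], followed by a root. *)
Lemma mxtrace_exp_le k M : \tr (M ^+ (2 ^ k.+1)) <= schatten k M.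
Proof.
apply: (@sqrt_le _ _ k.+1); first exact: schatten_ge0.
have := mxtrace_Holder k (fun=> M).
by rewrite !prodr_const_nat subn0.
Qed.

(** Each step trades a squaring: [mxtrace_exp_le] passes from [(B C) ^ (2 m)] to [(C B B C) ^ m],
    which by cyclicity has the trace of [(B^2 C^2) ^ m], and the squares are again symmetric. This
    is the substitute for Golden-Thompson, valid for indefinite [B] and [C]. *)
Lemma mxtrace_sym_mulX_le B C k : B^T = B -> C^T = C ->
  \tr ((B *m C) ^+ (2 ^ k)) <= \tr (B ^+ (2 ^ k) *m C ^+ (2 ^ k)).
Proof.
elim: k B C => [|k IH] B C sB sC; first by rewrite expn0 !expr1.
apply: (le_trans (mxtrace_exp_le k (B *m C))).
rewrite /schatten trmx_mul sB sC -mulmxA mxtrace_mulX.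
have -> : B *m (B *m C) *m C = (B ^+ 2) *m (C ^+ 2) by rewrite !mulmxA.
have := IH (B ^+ 2) (C ^+ 2).
rewrite -!exprM -!expnS; apply; by rewrite trmxX ?sB ?sC.
Qed.

(** * Quadratic forms and positive semidefinite matrices *)

Definition qf A (v : 'cV[R]_n) : R := (v^T *m A *m v) 0 0.
(** Only positivity of the form; symmetry is carried as a separate hypothesis. *)
Definition psd A := forall v, 0 <= qf A v.

Lemma qfE A v : qf A v = \sum_i \sum_j v i 0 * A i j * v j 0.
Proof.
rewrite /qf mxE exchange_big /=; apply: eq_bigr => j _.
by rewrite mxE mulr_suml; apply: eq_bigr => i _; rewrite mxE.
Qed.

Lemma qfD A B v : qf (A + B) v = qf A v + qf B v.
Proof. by rewrite /qf mulmxDr mulmxDl mxE. Qed.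

Lemma qfZ t A v : qf (t *: A) v = t * qf A v.
Proof. by rewrite /qf -scalemxAr -scalemxAl mxE. Qed.

Lemma qfB A B v : qf (A - B) v = qf A v - qf B v.
Proof. by rewrite -scaleN1r qfD qfZ mulN1r. Qed.

Lemma qf_sum (I : Type) (r : seq I) (P : pred I) (F : I -> 'M[R]_n) v :
  qf (\sum_(i <- r | P i) F i) v = \sum_(i <- r | P i) qf (F i) v.
Proof. by rewrite /qf mulmx_sumr mulmx_suml summxE. Qed.

Lemma qf1 v : qf 1%:M v = \sum_i v i 0 ^+ 2.
Proof. by rewrite /qf mulmx1 mxE; apply: eq_bigr => i _; rewrite mxE expr2. Qed.

Lemma qf1_ge0 v : 0 <= qf 1%:M v.
Proof. by rewrite qf1 sumr_ge0 // => i _; rewrite sqr_ge0. Qed.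

Lemma qf1_eq0 v : qf 1%:M v = 0 -> v = 0.
Proof.
rewrite qf1 => /eqP; rewrite psumr_eq0 => [/allP H|i _]; last exact: sqr_ge0.
apply/matrixP => i j; rewrite ord1 mxE.
by have := H i (mem_index_enum _); rewrite sqrf_eq0 => /eqP.
Qed.

Lemma qf_conj A (S : 'M[R]_n) v : qf (S^T *m A *m S) v = qf A (S *m v).
Proof. by rewrite /qf trmx_mul !mulmxA. Qed.

Lemma psdD A B : psd A -> psd B -> psd (A + B).
Proof. by move=> pA pB v; rewrite qfD addr_ge0. Qed.

Lemma psdZ t A : 0 <= t -> psd A -> psd (t *: A).
Proof. by move=> t0 pA v; rewrite qfZ mulr_ge0. Qed.

Lemma psd_conj A (S : 'M[R]_n) : psd A -> psd (S^T *m A *m S).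
Proof. by move=> pA v; rewrite qf_conj. Qed.

Lemma psd_mul_tr (S : 'M[R]_n) : psd (S *m S^T).
Proof.
by move=> v; have := qf_conj 1%:M S^T v; rewrite trmxK mulmx1 => ->; exact: qf1_ge0.
Qed.

Lemma mxtrace_conj_psd_ge0 A (S : 'M[R]_n) : psd A -> 0 <= \tr (S *m A *m S^T).
Proof.
move=> pA; apply: sumr_ge0 => i _.
have -> : (S *m A *m S^T) i i = qf A (row i S)^T.
  rewrite /qf trmxK mxE [RHS]mxE; apply: eq_bigr => j _.
  by rewrite !mxE; congr (_ * _); apply: eq_bigr => l _; rewrite !mxE.
exact: pA.
Qed.

(** For [k > 0] the power is a square [H H^T], so the trace is that of the congruence [H^T X H]. [A]
    may be indefinite, as the Chernoff matrices are. *)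
Lemma mxtrace_sym_exp_mul_ge0 A X k : A^T = A -> (0 < k)%N -> psd X ->
  0 <= \tr (A ^+ (2 ^ k) *m X).
Proof.
move=> sA k0 pX; rewrite sym_square // -mulmxA mxtrace_mulC.
by have := mxtrace_conj_psd_ge0 (A ^+ (2 ^ k.-1))^T pX; rewrite trmxK.
Qed.

Lemma qf_delta2 A i j (x y : R) : qf A (x *: delta_mx i 0 - y *: delta_mx j 0) =
  x ^+ 2 * A i i - x * y * (A i j + A j i) + y ^+ 2 * A j j.
Proof.
have del (a b : 'I_n) : ((delta_mx a 0 : 'cV[R]_n)^T *m A *m (delta_mx b 0 : 'cV[R]_n)) 0 0 = A a b.
  by rewrite trmx_delta -rowE -colE !mxE.
rewrite /qf.
have -> : (x *: delta_mx i 0 - y *: delta_mx j 0 : 'cV[R]_n)^T =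
    x *: (delta_mx i 0)^T - y *: (delta_mx j 0)^T.
  by apply/matrixP => a b; rewrite !mxE.
rewrite !mulmxBl !mulmxBr -!scalemxAl -!scalemxAr.
move: (del i i) (del i j) (del j i) (del j j) => <- <- <- <-.
by rewrite !mxE; ring.
Qed.

(** Positivity on the test vectors [v_j e_i - v_i e_j], summed over all pairs [(i, j)], is twice the
    claim. *)
Lemma qf_le_mxtrace A v : psd A -> qf A v <= \tr A * qf 1%:M v.
Proof.
move=> pA; rewrite qf1 qfE.
have key i j : v i 0 * A i j * v j 0 + v j 0 * A j i * v i 0 <=
    A i i * v j 0 ^+ 2 + A j j * v i 0 ^+ 2.
  have := pA (v j 0 *: delta_mx i 0 - v i 0 *: delta_mx j 0).
  rewrite qf_delta2; lra.
rewrite -(ler_pM2r (_ : 0 < 2)) //.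
have -> : (\sum_i \sum_j v i 0 * A i j * v j 0) * 2 =
    \sum_i \sum_j (v i 0 * A i j * v j 0 + v j 0 * A j i * v i 0).
  rewrite mulr_natr mulr2n {2}exchange_big /= -big_split /=.
  by apply: eq_bigr => i _; rewrite -big_split.
have -> : \tr A * (\sum_i v i 0 ^+ 2) * 2 =
    \sum_i \sum_j (A i i * v j 0 ^+ 2 + A j j * v i 0 ^+ 2).
  rewrite mulr_natr mulr2n [X in X + _]mulr_suml [X in _ + X]mulr_sumr -big_split /=.
  apply: eq_bigr => i _; rewrite big_split /=; congr (_ + _); first by rewrite mulr_sumr.
  by rewrite mulr_suml.
by apply: ler_sum => i _; apply: ler_sum => j _.
Qed.

Lemma psd_1sub A : psd A -> \tr A <= 1 -> psd (1%:M - A).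
Proof.
move=> pA tA v; rewrite qfB subr_ge0 (le_trans (qf_le_mxtrace v pA)) //.
by rewrite -[leRHS]mul1r ler_wpM2r ?qf1_ge0.
Qed.

Lemma psd_diag_ge0 A i : psd A -> 0 <= A i i.
Proof.
move=> /(_ (delta_mx i 0)); rewrite /qf trmx_delta -rowE -colE !mxE //.
Qed.

(* The matrix form of [(1 - t x) ^ m <= 1 - (1 - (1 - t) ^ m) x] on [0, 1],
   which holds because the left-hand side is convex in [x]. *)
Lemma psd_exp_chord X t m : X^T = X -> psd X -> psd (1%:M - X) -> 0 <= t <= 1 ->
  psd (1%:M - (1 - (1 - t) ^+ m) *: X - (1%:M - t *: X) ^+ m).
Proof.
move=> sX pX pX1 /andP[t0 t1]; set C := 1%:M - t *: X; set rho := 1 - t.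
have sC : C^T = C by rewrite /C linearB /= linearZ /= trmx1 sX.
have s1X : (1%:M - X)^T = 1%:M - X by rewrite linearB /= trmx1 sX.
have rho0 : 0 <= rho by rewrite subr_ge0.
have XC : X *m C = C *m X by rewrite mulmxBr mulmxBl mulmx1 mul1mx -scalemxAl -scalemxAr.
have XCi i : X *m C ^+ i = C ^+ i *m X.
  elim: i => [|i IH]; first by rewrite expr0 mulmx1 mul1mx.
  by rewrite exprS mulmxA XC -mulmxA IH mulmxA.
have CE : C = rho%:M + t *: (1%:M - X).
  by apply/matrixP => i j; rewrite !mxE /rho; case: (i == j); rewrite ?mulr1n ?mulr0n; ring.
pose Z := X *m (1%:M - X).
have Zc : Z *m C = C *m Z.
  move: XC; rewrite /Z; move: C {sC CE XCi} => W XW.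
  by rewrite mulmxBr mulmx1 mulmxBl mulmxBr -[X *m X *m W]mulmxA XW !mulmxA XW.
(* Multiplying [X (1 - X)] by [X + (1 - X) = 1] writes this product of commuting matrices as a sum
   of two congruences, hence as a positive semidefinite matrix. *)
have ZE : Z = X *m (1%:M - X) *m X + (1%:M - X) *m X *m (1%:M - X).
  rewrite /Z !mulmxBr !mulmxBl !mulmx1 !mul1mx ?mulmxBl ?mul1mx.
  move: (X *m X *m X) (X *m X) => X3 X2.
  by apply/matrixP => i j; rewrite !mxE; ring.
have pZ0 : psd Z.
  rewrite ZE; apply: psdD.
    by rewrite -{1}sX; exact: psd_conj.
  by rewrite -{1}s1X; exact: psd_conj.
have pZ1 : psd (Z *m C).
  rewrite CE mulmxDr mul_mx_scalar -scalemxAr; apply: psdD; apply: psdZ => //.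
  have -> : Z *m (1%:M - X) = (1%:M - X)^T *m X *m (1%:M - X).
    rewrite s1X /Z; congr (_ *m _); by rewrite mulmxBr mulmxBl mulmx1 mul1mx.
  exact: psd_conj.
have XCE : X *m C = rho *: X + t *: Z.
  by rewrite CE mulmxDr mul_mx_scalar -scalemxAr.
clearbody Z.
(* Two consecutive exponents are carried along because conjugation by [C] raises the exponent by
   two. *)
have pZ i : psd (Z *m C ^+ i) /\ psd (Z *m C ^+ i.+1).
  elim: i => [|i [IH1 IH2]]; first by rewrite expr0 mulmx1 expr1.
  split=> //; have -> : Z *m C ^+ i.+2 = C^T *m (Z *m C ^+ i) *m C.
    have CS : C ^+ i.+2 = C *m (C ^+ i *m C) by rewrite exprS exprSr.
    by rewrite sC CS !mulmxA Zc.
  exact: psd_conj.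
(* Iterating [X C = rho X + t Z] gives [X C^i >= rho^i X]. Since [C^m - C^(m+1) = t X C^m], summing
   these bounds is a geometric series with total [1 - rho^m]. *)
have pE i : psd (X *m C ^+ i - rho ^+ i *: X).
  elim: i => [|i IH]; first by rewrite !expr0 mulmx1 scale1r subrr => v; rewrite /qf mulmx0 mul0mx mxE.
  have -> : X *m C ^+ i.+1 - rho ^+ i.+1 *: X =
      rho *: (X *m C ^+ i - rho ^+ i *: X) + t *: (Z *m C ^+ i).
    rewrite exprS mulmxA XCE.
    by rewrite mulmxDl -!scalemxAl scalerBr scalerA -exprS addrAC.
  by apply: psdD; apply: psdZ => //; case: (pZ i).
elim: m => [|m IH].
  by rewrite !expr0 subrr scale0r subr0 subrr => v; rewrite /qf mulmx0 mul0mx mxE.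
have -> : 1%:M - (1 - rho ^+ m.+1) *: X - C ^+ m.+1 =
    (1%:M - (1 - rho ^+ m) *: X - C ^+ m) + t *: (X *m C ^+ m - rho ^+ m *: X).
  have -> : C ^+ m.+1 = C ^+ m - t *: (X *m C ^+ m).
    by rewrite exprS -[C * _]/(C *m _) /C mulmxBl mul1mx -scalemxAl.
  rewrite exprS; move: (X *m C ^+ m) => Y; move: (C ^+ m) => W.
  by apply/matrixP => i j; rewrite !mxE /rho; ring.
by apply: psdD => //; apply: psdZ.
Qed.

Lemma qf_CauchySchwarz (u v : 'cV[R]_n) :
  ((u^T *m v) 0 0) ^+ 2 <= qf 1%:M u * qf 1%:M v.
Proof.
apply: sqr_le_of_quadratic => t.
have := qf1_ge0 (u - t *: v).
rewrite !qf1 => /le_trans; apply; rewrite le_eqVlt; apply/orP; left; apply/eqP.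
rewrite mxE mulr_sumr mulr_sumr -sumrB -big_split /=.
by apply: eq_bigr => i _; rewrite !mxE; ring.
Qed.

(** A Rayleigh quotient at least 1 survives squaring: by Cauchy-Schwarz
    [(v, B v)^2 <= (v, v) (B v, B v)]. After [k] squarings the matrix is positive semidefinite and
    its trace dominates the quotient. *)
Lemma mxtrace_exp_ge1 B v k : B^T = B -> (0 < k)%N -> 0 < qf 1%:M v ->
  qf 1%:M v <= qf B v -> 1 <= \tr (B ^+ (2 ^ k)).
Proof.
move=> sB k0 v0 vB.
have H j : qf 1%:M v <= qf (B ^+ (2 ^ j)) v.
  elim: j {k0} B sB vB => [|j IH] B sB vB; first by rewrite expr1.
  rewrite expnS exprM; apply: IH; first by rewrite trmxX sB.
  have := qf_CauchySchwarz v (B *m v).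
  rewrite mulmxA -[(_ *m _) 0 0]/(qf B v) -qf_conj sB mulmx1 -[B *m B]expr2 => H.
  rewrite -(ler_pM2l v0); apply: le_trans H; rewrite expr2.
  by apply: ler_pM => //; apply: ltW.
rewrite -(ler_pM2r v0) mul1r; apply: (le_trans (H k)); apply: qf_le_mxtrace.
by rewrite sym_square //; exact: psd_mul_tr.
Qed.

(** * Maximal absolute row sum, a submultiplicative matrix norm *)

Definition rowsum_le A c := forall i, \sum_j `|A i j| <= c.

Lemma rowsumM A B a b : 0 <= b -> rowsum_le A a -> rowsum_le B b -> rowsum_le (A *m B) (a * b).
Proof.
move=> b0 hA hB i.
apply: (@le_trans _ _ (\sum_k \sum_j `|A i j| * `|B j k|)).
  apply: ler_sum => k _; rewrite mxE; apply: (le_trans (ler_norm_sum _ _ _)).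
  by apply: ler_sum => j _; rewrite normrM.
rewrite exchange_big /=.
apply: (@le_trans _ _ (\sum_j `|A i j| * b)); last by rewrite -mulr_suml ler_wpM2r.
by apply: ler_sum => j _; rewrite -mulr_sumr ler_wpM2l.
Qed.

Lemma rowsumD A B a b : rowsum_le A a -> rowsum_le B b -> rowsum_le (A + B) (a + b).
Proof.
move=> hA hB i; apply: le_trans (lerD (hA i) (hB i)).
by rewrite -big_split; apply: ler_sum => j _; rewrite mxE ler_normD.
Qed.

Lemma rowsumZ t A a : rowsum_le A a -> rowsum_le (t *: A) (`|t| * a).
Proof.
move=> hA i; apply: le_trans (ler_wpM2l (normr_ge0 t) (hA i)).
by rewrite mulr_sumr; apply: ler_sum => j _; rewrite mxE normrM.
Qed.

Lemma rowsumW A a b : a <= b -> rowsum_le A a -> rowsum_le A b.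
Proof. by move=> ab hA i; apply: le_trans ab. Qed.

Lemma rowsum1 : rowsum_le 1%:M 1.
Proof.
move=> i; rewrite (bigD1 i) //= mxE eqxx normr1 big1 ?addr0 // => j /negPf ji.
by rewrite mxE eq_sym ji normr0.
Qed.

Lemma rowsumX A a k : 0 <= a -> rowsum_le A a -> rowsum_le (A ^+ k) (a ^+ k).
Proof.
move=> a0 hA; elim: k => [|k IH]; first exact: rowsum1.
by rewrite !exprS; apply: rowsumM => //; apply: exprn_ge0.
Qed.

Lemma rowsum_mxtrace A a : rowsum_le A a -> `|\tr A| <= n%:R * a.
Proof.
move=> hA; apply: (le_trans (ler_norm_sum _ _ _)).
apply: (@le_trans _ _ (\sum_(i < n) a)); last by rewrite sumr_const card_ord mulr_natl.
apply: ler_sum => i _; apply: le_trans (hA i).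
by rewrite (bigD1 i) //= lerDl sumr_ge0.
Qed.

(** Telescoping through [A^k (A - B) + (A^k - B^k) B]. As [c >= 1], every term may be bounded with
    the full power of [c]. *)
Lemma rowsum_expB A B c e k : 1 <= c -> 0 <= e -> rowsum_le A c -> rowsum_le B c ->
  rowsum_le (A - B) e -> rowsum_le (A ^+ k - B ^+ k) (k%:R * e * c ^+ k).
Proof.
move=> c1 e0 hA hB hAB; have c0 : 0 <= c by lra.
elim: k => [|k IH].
  by rewrite !expr0 subrr !mul0r => i; rewrite big1 // => j _; rewrite mxE normr0.
have -> : A ^+ k.+1 - B ^+ k.+1 = A ^+ k *m (A - B) + (A ^+ k - B ^+ k) *m B.
  by rewrite mulmxBr mulmxBl addrA subrK !exprSr.
have := rowsumD (rowsumM e0 (rowsumX k c0 hA) hAB) (rowsumM c0 IH hB).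
apply: rowsumW.
have ck : c ^+ k <= c ^+ k.+1 by rewrite ler_weXn2l.
rewrite -mulrA -exprSr -natr1 !mulrDl mul1r addrC lerD2l mulrC.
by rewrite ler_wpM2l.
Qed.

(** Testing on [e_i + e_j] and [e_i - e_j] bounds each entry by the mean of two diagonal entries,
    hence by 1. *)
Lemma psd_rowsum A : psd A -> A^T = A -> \tr A <= 1 -> rowsum_le A n%:R.
Proof.
move=> pA sA tA i.
apply: (@le_trans _ _ (\sum_(j < n) 1)); last by rewrite sumr_const card_ord.
apply: ler_sum => j _.
have dtr l : A l l <= \tr A.
  by rewrite /mxtrace (bigD1 l) //= lerDl sumr_ge0 // => ? _; exact: psd_diag_ge0.
have sij : A j i = A i j by rewrite -{1}sA mxE.
have H1 := pA (1 *: delta_mx i 0 - 1 *: delta_mx j 0).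
have H2 := pA (1 *: delta_mx i 0 - (-1) *: delta_mx j 0).
rewrite !qf_delta2 sij in H1 H2.
by rewrite ler_norml; have := dtr i; have := dtr j; nra.
Qed.

End LinearAlgebra.

(** * Deterministic estimates for the normal equations *)

Section Ridge.
Variables (R : realFieldType) (n : nat).
Implicit Types (A G D : 'M[R]_n) (u v x y b : 'cV[R]_n).

Definition vdot u v : R := (u^T *m v) 0 0.

Lemma vdotE u v : vdot u v = \sum_i u i 0 * v i 0.
Proof. by rewrite /vdot mxE; apply: eq_bigr => i _; rewrite mxE. Qed.

Lemma vdotC u v : vdot u v = vdot v u.
Proof. by rewrite !vdotE; apply: eq_bigr => i _; rewrite mulrC. Qed.

Lemma vdotDl u v x : vdot (u + v) x = vdot u x + vdot v x.
Proof. by rewrite !vdotE -big_split; apply: eq_bigr => i _; rewrite mxE mulrDl. Qed.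

Lemma vdotZl t u v : vdot (t *: u) v = t * vdot u v.
Proof. by rewrite !vdotE mulr_sumr; apply: eq_bigr => i _; rewrite mxE mulrA. Qed.

Lemma vdotDr u v x : vdot x (u + v) = vdot x u + vdot x v.
Proof. by rewrite vdotC vdotDl !(vdotC x). Qed.

Lemma vdotZr t u v : vdot u (t *: v) = t * vdot u v.
Proof. by rewrite vdotC vdotZl vdotC. Qed.

Lemma vdotBl u v x : vdot (u - v) x = vdot u x - vdot v x.
Proof. by rewrite -scaleN1r vdotDl vdotZl mulN1r. Qed.

Lemma vdotBr u v x : vdot x (u - v) = vdot x u - vdot x v.
Proof. by rewrite vdotC vdotBl !(vdotC x). Qed.

Lemma vdot_suml (I : Type) (s : seq I) (F : I -> 'cV[R]_n) u :
  vdot (\sum_(i <- s) F i) u = \sum_(i <- s) vdot (F i) u.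
Proof. by rewrite /vdot linear_sum mulmx_suml summxE. Qed.

Lemma qf1_vdot u : qf 1%:M u = vdot u u.
Proof. by rewrite /qf mulmx1. Qed.

Lemma qf_vdot A u : qf A u = vdot u (A *m u).
Proof. by rewrite /qf /vdot mulmxA. Qed.

Lemma vdot_ge0 u : 0 <= vdot u u.
Proof. by rewrite -qf1_vdot qf1_ge0. Qed.

Lemma vdot_eq0 u : vdot u u = 0 -> u = 0.
Proof. by rewrite -qf1_vdot; exact: qf1_eq0. Qed.

Lemma vdot_mulmxr A u v : A^T = A -> vdot u (A *m v) = vdot (A *m u) v.
Proof. by move=> sA; rewrite /vdot trmx_mul sA mulmxA. Qed.

Lemma vdot_CauchySchwarz u v : vdot u v ^+ 2 <= vdot u u * vdot v v.
Proof. by rewrite -!qf1_vdot; exact: qf_CauchySchwarz. Qed.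

(** Along a line [c + t v] the increment is [2 t (v, G c - b) + t^2 qf G v]. It is never negative,
    so the linear coefficient vanishes for every [v]. *)
Lemma minimizer_normal_equation G b c : G^T = G ->
  (forall c', qf G c - 2 * vdot c b <= qf G c' - 2 * vdot c' b) -> G *m c = b.
Proof.
move=> sG H.
have key v : vdot v (G *m c - b) = 0.
  have : (- vdot v (G *m c - b)) ^+ 2 <= 0 * qf G v.
    apply: sqr_le_of_quadratic => t.
    have := H (c + t *: v).
    rewrite vdotBr !qf_vdot mulmxDr -scalemxAr !vdotDl !vdotDr !vdotZl !vdotZr.
    have -> : vdot c (G *m v) = vdot v (G *m c) by rewrite vdot_mulmxr // vdotC.
    lra.
  rewrite mul0r sqrrN => h; apply/eqP; rewrite -sqrf_eq0 eq_le h /=.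
  exact: sqr_ge0.
by apply/eqP; rewrite -subr_eq0; apply/eqP; apply: vdot_eq0; exact: key.
Qed.

Section Coercive.
Variables (G : 'M[R]_n) (s0 : R).
Hypothesis (sG : G^T = G) (s00 : 0 < s0).
Hypothesis Gs : forall v, s0 * vdot v v <= qf G v.

Lemma coercive_unitmx : G \in unitmx.
Proof.
rewrite -row_free_unit -kermx_eq0; apply/eqP/row_matrixP => i; rewrite row0.
have : row i (kermx G) *m G = 0 by rewrite -row_mul mulmx_ker row0.
move: (row i _) => u uG; apply: trmx_inj; rewrite trmx0.
have Gu : G *m u^T = 0 by rewrite -sG -trmx_mul uG trmx0.
apply: vdot_eq0; have := Gs u^T; rewrite qf_vdot Gu.
have -> : vdot u^T (0 : 'cV[R]_n) = 0 by rewrite vdotE big1 // => k _; rewrite [X in _ * X]mxE mulr0.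
by have := vdot_ge0 u^T; move: s00; nra.
Qed.

Lemma coercive_solution x y : G *m x = y -> s0 ^+ 2 * vdot x x <= vdot y y.
Proof.
move=> E; have [x0|x0] := eqVneq (vdot x x) 0; first by rewrite x0 mulr0 vdot_ge0.
have xp : 0 < vdot x x by rewrite lt_neqAle eq_sym x0 vdot_ge0.
have h := Gs x; rewrite qf_vdot E in h.
have h2 := vdot_CauchySchwarz x y.
have h3 : (s0 * vdot x x) ^+ 2 <= vdot x x * vdot y y.
  apply: le_trans h2; rewrite ler_pXn2r ?nnegrE //; first by rewrite mulr_ge0 // ltW.
  by apply: le_trans h; rewrite mulr_ge0 // ltW.
rewrite -(ler_pM2l xp); apply: le_trans h3.
by rewrite le_eqVlt; apply/orP; left; apply/eqP; ring.
Qed.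

(** Since [(x, D v) = qf G x >= qf D x], expanding [0 <= qf D (x - v)] gives [qf G x <= qf D v]. The
    gain over inverting [G] directly is a single power of [s0] and the energy [qf D v] in place of
    the norm of [D v]. *)
Lemma ridge_bias D x v : D^T = D -> psd D -> (forall v, qf D v <= qf G v) ->
  G *m x = D *m v -> s0 * vdot x x <= qf D v.
Proof.
move=> sD pD DG E; apply: (le_trans (Gs x)).
have h1 := DG x.
have h2 := pD (x - v).
rewrite qf_vdot mulmxBr !vdotBl !vdotBr -!qf_vdot in h2.
have h3 : vdot v (D *m x) = vdot x (D *m v) by rewrite vdot_mulmxr // vdotC.
have h4 : qf G x = vdot x (D *m v) by rewrite qf_vdot E.
rewrite h3 -h4 in h2; lra.
Qed.

(** Young's inequality with parameter 3. The weight 4 becomes the 8 in front of the penalty once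
    [s0] is half of sigma_min; 4/3 is its conjugate. *)
Lemma vdot_sub_le x y : vdot (x - y) (x - y) <= 4 * vdot x x + 4 / 3 * vdot y y.
Proof.
have := vdot_ge0 (3 *: x + y).
rewrite !vdotBl !vdotBr !vdotDl !vdotDr !vdotZl !vdotZr (vdotC y x).
lra.
Qed.

(* [a - G^-1 bF = G^-1 (D a - bg)] when the design matrix is [G - D]. *)
Lemma ridge_estimate D (a bg u : 'cV[R]_n) : D^T = D -> psd D ->
  (forall v, qf D v <= qf G v) ->
  u = a - invmx G *m ((G - D) *m a + bg) ->
  vdot u u <= 4 / s0 * qf D a + 4 / (3 * s0 ^+ 2) * vdot bg bg.
Proof.
move=> sD pD DG uE.
have Gu := coercive_unitmx.
have -> : u = invmx G *m (D *m a) - invmx G *m bg.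
  rewrite uE mulmxDr mulmxBl mulmxBr mulKmx // opprD opprB.
  by rewrite addrA [a + _]addrC subrK.
apply: (le_trans (vdot_sub_le _ _)).
have h1 : s0 * vdot (invmx G *m (D *m a)) (invmx G *m (D *m a)) <= qf D a.
  by apply: ridge_bias => //; rewrite mulKVmx.
have h2 : s0 ^+ 2 * vdot (invmx G *m bg) (invmx G *m bg) <= vdot bg bg.
  by apply: coercive_solution; rewrite mulKVmx.
apply: lerD.
  by rewrite -mulrA ler_wpM2l // mulrC ler_pdivlMr // mulrC.
have -> : 4 / (3 * s0 ^+ 2) * vdot bg bg = 4 / 3 * (vdot bg bg / s0 ^+ 2).
  by field; rewrite gt_eqF.
by rewrite ler_wpM2l ?divr_ge0 // ler_pdivlMr ?exprn_gt0 // mulrC.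
Qed.

End Coercive.
End Ridge.

(** * Real-valued integrals against a probability measure *)

Section Integration.
Context (R : realType) d (T : measurableType d) (P : probability T R).

Lemma bounded_integrable (f : T -> R) :
  measurable_fun setT f -> (exists B, forall x, `|f x| <= B) ->
  P.-integrable setT (EFin \o f).
Proof.
move=> mf [B hB]; apply: measurable_bounded_integrable => //.
  by rewrite [X in (X < _)%E]probability_setT ltry.
exists B; split; first exact: num_real.
by move=> M BM x _; apply: (le_trans (hB x)); exact: ltW.
Qed.

Lemma integrable_cst (c : R) : P.-integrable setT (EFin \o (fun=> c)).
Proof. by apply: bounded_integrable => //; exists `|c|. Qed.

Lemma integrableD_EFin (f g : T -> R) :
  P.-integrable setT (EFin \o f) -> P.-integrable setT (EFin \o g) ->
  P.-integrable setT (EFin \o (fun x => f x + g x)).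
Proof. by move=> fi gi; exact: (integrableD measurableT fi gi). Qed.

Lemma integrableB_EFin (f g : T -> R) :
  P.-integrable setT (EFin \o f) -> P.-integrable setT (EFin \o g) ->
  P.-integrable setT (EFin \o (fun x => f x - g x)).
Proof. by move=> fi gi; exact: (integrableB measurableT fi gi). Qed.

Lemma integrableZ_EFin (c : R) (f : T -> R) :
  P.-integrable setT (EFin \o f) -> P.-integrable setT (EFin \o (fun x => c * f x)).
Proof. by move=> fi; exact: (integrableZl measurableT c fi). Qed.

Lemma integrable_sum_EFin (I : Type) (s : seq I) (A : pred I) (f : I -> T -> R) :
  (forall i, P.-integrable setT (EFin \o f i)) ->
  P.-integrable setT (EFin \o (fun x => \sum_(i <- s | A i) f i x)).
Proof.
move=> fi; elim: s => [|i s IH].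
  have -> : (fun x => \sum_(i <- [::] | A i) f i x) = fun=> 0.
    by apply/funext => x; rewrite big_nil.
  exact: integrable_cst.
have -> : (fun x => \sum_(j <- i :: s | A j) f j x) =
    if A i then fun x => f i x + \sum_(j <- s | A j) f j x
    else fun x => \sum_(j <- s | A j) f j x.
  by case Ai : (A i); apply/funext => x; rewrite big_cons Ai.
by case: (A i) => //; exact: integrableD_EFin.
Qed.

Lemma Rintegral_sum (I : Type) (s : seq I) (A : pred I) (f : I -> T -> R) :
  (forall i, P.-integrable setT (EFin \o f i)) ->
  Rintegral P setT (fun x => \sum_(i <- s | A i) f i x) =
  \sum_(i <- s | A i) Rintegral P setT (f i).
Proof.
move=> fi; elim: s => [|i s IH].
  rewrite big_nil; under eq_Rintegral do rewrite big_nil.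
  by rewrite Rintegral_cst // mul0r.
rewrite big_cons; case Ai : (A i); last by under eq_Rintegral do rewrite big_cons Ai.
under eq_Rintegral do rewrite big_cons Ai.
by rewrite RintegralD // ?IH //; exact: integrable_sum_EFin.
Qed.

Lemma ae_le_Rintegral (f g : T -> R) (A : set T) :
  measurable A -> P (~` A) = 0%E ->
  P.-integrable setT (EFin \o f) -> P.-integrable setT (EFin \o g) ->
  (forall x, A x -> f x <= g x) ->
  Rintegral P setT f <= Rintegral P setT g.
Proof.
move=> mA PA fi gi fg.
have cut (h : T -> R) : P.-integrable setT (EFin \o h) ->
    Rintegral P setT h = Rintegral P A h.
  move=> hi; rewrite /Rintegral; congr fine.
  rewrite (negligible_integral (measurableC mA) measurableT hi PA).
  by rewrite setDE setTI setCK.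
rewrite (cut f) // (cut g) //; apply: le_Rintegral => //.
- by apply: integrableS fi.
- by apply: integrableS gi.
Qed.
End Integration.

(** * Wasserstein continuity of integrals of bounded continuous functions *)

Section Modulus.
Variables (R : realType) (d : nat).

Lemma sqr_norm_le_sqdist (x y : 'rV[R]_d) : `|x - y| ^+ 2 <= sqdist x y.
Proof.
set z := x - y; have -> : sqdist x y = \sum_(l < d) z ord0 l ^+ 2.
  by apply: eq_bigr => l _; rewrite !mxE.
rewrite /Num.norm /= mx_normrE.
apply: (big_ind (fun m => m ^+ 2 <= \sum_(l < d) z ord0 l ^+ 2)) => /=.
- by rewrite expr0n /= sumr_ge0 // => i _; rewrite sqr_ge0.
- by move=> u v hu hv; rewrite maxEle; case: ifP.
- move=> [i j] _ /=; rewrite real_normK ?num_real // (ord1 i).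
  by rewrite (bigD1 j) //= lerDl sumr_ge0 // => k _; rewrite sqr_ge0.
Qed.

Lemma sqdist_ge0 (x y : 'rV[R]_d) : 0 <= sqdist x y.
Proof. by apply: sumr_ge0 => i _; rewrite sqr_ge0. Qed.

(** Close pairs are handled by continuity near [K], distant ones by boundedness. The modulus is
    quadratic to match the transport cost, and [y] is free so that only the first marginal has to
    live on [K]. *)
Lemma compact_quadratic_modulus (K : set 'rV[R]_d) (h : 'rV[R]_d -> R) (e : R) :
  compact K -> continuous h -> (exists B, forall x, `|h x| <= B) -> 0 < e ->
  exists2 C : R, 0 < C &
    forall x y, K x -> `|h x - h y| <= e + C * sqdist x y.
Proof.
move=> cK ch [B hB] e0.
have B0 : 0 <= B := le_trans (normr_ge0 _) (hB 0).
have H : \forall C \near +oo%R, forall x, K x -> forall y, `|h x - h y| <= e + C * sqdist x y.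
  move/compact_near_coveringP : cK; apply.
  move=> x0 Kx0.
  have /cvgrPdist_lt/(_ (e / 2)) := ch x0.
  rewrite divr_gt0 // => /(_ isT) /nbhs_ballP[dl /= dl0 hdl].
  (* If [y] is outside the [dl]-ball of [x0], then [x] and [y] are at least [dl / 2] apart and this
     [C] makes the quadratic term exceed the oscillation [2 B]. *)
  exists (ball x0 (dl / 2), [set C | 2 * B / (dl / 2) ^+ 2 <= C]).
    split; first by apply: nbhsx_ballx; rewrite divr_gt0.
    apply: nbhs_pinfty_ge; exact: num_real.
  move=> [x C] [/= hx hC] y.
  have [yb|yb] := pselect (ball x0 dl y).
    apply: (@le_trans _ _ e); last first.
      rewrite lerDl mulr_ge0 ?sqdist_ge0 // (le_trans _ hC) //.
      by apply: divr_ge0; [exact: mulr_ge0|exact: sqr_ge0].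
    have xb : ball x0 dl x by apply: le_ball hx; lra.
    have := hdl x xb; have := hdl y yb => /= h1 h2.
    rewrite -(subrKA (h x0)) (le_trans (ler_normD _ _)) // distrC; lra.
  have far : dl / 2 <= `|x - y|.
    rewrite leNgt; apply/negP => xy; apply: yb.
    rewrite (splitr dl); apply: ball_triangle hx _.
    by rewrite -ball_normE.
  apply: (@le_trans _ _ (2 * B)).
    rewrite (le_trans (ler_normB _ _)) //; have := hB x; have := hB y; lra.
  apply: (@le_trans _ _ (C * sqdist x y)); last by rewrite lerDr ltW.
  have d2 : 0 < (dl / 2) ^+ 2 by rewrite exprn_gt0 // divr_gt0.
  have {}far : (dl / 2) ^+ 2 <= sqdist x y.
    by apply: le_trans (sqr_norm_le_sqdist x y); rewrite ler_pXn2r ?nnegrE // divr_ge0 // ltW.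
  have C0 : 0 <= C by apply: le_trans hC; apply: divr_ge0; [exact: mulr_ge0|exact: sqr_ge0].
  apply: (@le_trans _ _ (C * (dl / 2) ^+ 2)); first by rewrite -ler_pdivrMr.
  by rewrite ler_wpM2l.
have [C [C0 HC]] : exists C, 0 < C /\ forall x, K x -> forall y, `|h x - h y| <= e + C * sqdist x y.
  near (+oo%R : set_system R) => C; exists C; split; near: C => //.
  exact: nbhs_pinfty_gt.
by exists C => // x y Kx; exact: HC.
Unshelve. all: end_near.
Qed.

End Modulus.

Section Wasserstein.
Variables (R : realType) (d : nat).

Lemma continuous_measurable_Rd (h : 'rV[R]_d -> R) :
  continuous h -> measurable_fun (setT : set (Rd R d)) (h : Rd R d -> R).
Proof.
move=> ch; apply: (measurability _ (RGenOInfty.measurableE R)).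
move=> _ [_ [a ->] <-]; rewrite setTI; apply: sub_sigma_algebra => /=.
apply: open_comp => [x _|]; first exact: ch.
exact: interval_open.
Qed.

Lemma measurable_sqdist :
  measurable_fun setT (fun z : Rd R d * Rd R d => sqdist z.1 z.2).
Proof.
apply: measurable_sum => l; apply: measurable_funX; apply: measurable_funB.
- have mc : measurable_fun setT ((fun x : 'rV[R]_d => x ord0 l) : Rd R d -> R).
    by apply: continuous_measurable_Rd; exact: coord_continuous.
  by apply: (measurableT_comp mc); exact: measurable_fst.
- have mc : measurable_fun setT ((fun x : 'rV[R]_d => x ord0 l) : Rd R d -> R).
    by apply: continuous_measurable_Rd; exact: coord_continuous.
  by apply: (measurableT_comp mc); exact: measurable_snd.
Qed.

Lemma Rintegral_distribution d1 d2 (T1 : measurableType d1) (T2 : measurableType d2)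
    (P : probability T1 R) (Q : probability T2 R) (f : T1 -> T2) (h : T2 -> R) :
  measurable_fun setT f ->
  (forall A, measurable A -> P (f @^-1` A) = Q A) ->
  measurable_fun setT h -> P.-integrable setT (EFin \o (h \o f)) ->
  Rintegral P setT (h \o f) = Rintegral Q setT h.
Proof.
move=> mf PQ mh hi; rewrite /Rintegral; congr fine.
transitivity (\int[pushforward P f]_y (h y)%:E)%E.
  rewrite (integral_pushforward mf) //; exact/measurable_EFinP.
by apply: eq_measure_integral => A mA _; exact: PQ.
Qed.

Variables (K : set (Rd R d)) (k0 : Rd R d) (hk0 : K k0).
Hypothesis hK : compact (K : set 'rV[R]_d).

Lemma measurable_compact : measurable K.
Proof.
rewrite -(setCK K); apply: measurableC; apply: sub_sigma_algebra.
by apply: closed_openC; apply: compact_closed => //; exact: norm_hausdorff.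
Qed.

(** The quadratic modulus with error [e / 2] is integrated against a coupling of cost below
    [e / (2 C)], which fixes the radius as the square root of that number. *)
Lemma Rintegral_W2_continuous (h : 'rV[R]_d -> R) (mu : PK hk0) (e : R) :
  continuous h -> (exists B, forall x, `|h x| <= B) -> 0 < e ->
  exists2 dl : R, 0 < dl & forall nu : PK hk0,
    (W2sq (proj1_sig mu) (proj1_sig nu) < (dl ^+ 2)%:E)%E ->
    `|Rintegral (proj1_sig mu) setT h - Rintegral (proj1_sig nu) setT h| < e.
Proof.
move=> ch hb e0.
have [C C0 hC] := compact_quadratic_modulus hK ch hb (divr_gt0 e0 (ltr0n _ 2)).
have mh := continuous_measurable_Rd ch.
exists (Num.sqrt (e / (2 * C))); first by rewrite sqrtr_gt0 divr_gt0 // mulr_gt0.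
move=> nu; rewrite sqr_sqrtr; last by rewrite divr_ge0 ?mulr_ge0 // ltW.
move=> /ereal_inf_lt[_ [pi [cpl1 cpl2] <-]] hpi.
have mf1 := @measurable_fst _ _ (Rd R d) (Rd R d).
have mf2 := @measurable_snd _ _ (Rd R d) (Rd R d).
have [B hB] := hb.
have i1 : pi.-integrable setT (EFin \o (h \o fst)).
  apply: (@bounded_integrable _ _ _ pi (h \o _)); last by exists B => x; exact: hB.
  exact: (measurableT_comp mh).
have i2 : pi.-integrable setT (EFin \o (h \o snd)).
  apply: (@bounded_integrable _ _ _ pi (h \o _)); last by exists B => x; exact: hB.
  exact: (measurableT_comp mh).
have -> : Rintegral (proj1_sig mu) setT h = Rintegral pi setT (h \o fst).
  apply/esym/Rintegral_distribution => // A mA.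
  rewrite -(cpl1 _ mA); congr (pi _); apply/seteqP; split => x //=; last by case.
have -> : Rintegral (proj1_sig nu) setT h = Rintegral pi setT (h \o snd).
  apply/esym/Rintegral_distribution => // A mA.
  rewrite -(cpl2 _ mA); congr (pi _); apply/seteqP; split => x //=; last by case.
rewrite -RintegralB //; have iB : pi.-integrable setT (EFin \o (fun z => (h \o fst) z - (h \o snd) z)).
  exact: integrableB_EFin.
apply: (le_lt_trans (le_normr_Rintegral measurableT iB)).
pose g (z : Rd R d * Rd R d) := sqdist z.1 z.2.
have gi : pi.-integrable setT (EFin \o g).
  apply/integrableP; split; first by apply/measurable_EFinP; exact: measurable_sqdist.
  under eq_integral do rewrite /= ger0_norm ?sqdist_ge0 //.
  by apply: lt_trans hpi _; rewrite ltry.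
have Cgi := integrableZ_EFin C gi.
have ci := integrable_cst pi (e / 2).
apply: (@le_lt_trans _ _ (Rintegral pi setT (fun z => e / 2 + C * g z))).
  (* The modulus holds only for a first coordinate in [K]; the complement is null because the first
     marginal is [mu]. *)
  apply: (@ae_le_Rintegral _ _ _ _ _ _ (K `*` setT)).
  - by apply: measurableX => //; exact: measurable_compact.
  - have -> : ~` (K `*` [set: Rd R d]) = (~` K) `*` setT.
      apply/seteqP; split => -[x y] /=; first by move=> H; split=> // Kx; apply: H.
      by move=> [H _] [].
    rewrite cpl1; last by apply: measurableC; exact: measurable_compact.
    exact: (proj2_sig mu).
  - exact: (integrable_norm iB).
  - exact: integrableD_EFin.
  - by move=> [x y] [/= Kx _]; exact: hC.
rewrite RintegralD // Rintegral_cst // RintegralZl //.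
have -> : fine (pi setT) = 1 by have -> := @probability_setT _ _ _ pi.
rewrite mulr1.
have : Rintegral pi setT g < e / (2 * C).
  rewrite -lte_fin /Rintegral fineK //.
  exact: integrable_fin_num.
rewrite ltr_pdivlMr ?mulr_gt0 // => H; nra.
Qed.

End Wasserstein.

Lemma cvg_sum_seq (R : realType) (T I : Type) (F : set_system T) (FF : Filter F)
    (s : seq I) (f : I -> T -> R) (a : I -> R) :
  (forall i, f i @ F --> a i) ->
  (fun x => \sum_(i <- s) f i x) @ F --> \sum_(i <- s) a i.
Proof.
move=> cf; elim: s => [|i s IH].
  by under eq_fun do rewrite big_nil; rewrite big_nil; exact: cvg_cst.
by under eq_fun do rewrite big_cons; rewrite big_cons; apply: cvgD; [exact: cf|exact: IH].
Qed.

Section WassersteinFilter.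
Variables (R : realType) (d : nat) (K : set (Rd R d)) (k0 : Rd R d) (hk0 : K k0).
Hypothesis hK : compact (K : set 'rV[R]_d).

(** The sigma-algebra of [PKm] is generated by the sets that contain such a ball around each of
    their points. Convergence along this filter at every point therefore gives measurability, and
    the usual limit rules for sums, products and compositions apply. *)
Definition W2nbhs (mu : PK hk0) : set_system (PK hk0) :=
  filter_from [set dl : R | 0 < dl]
    (fun dl => [set nu | (W2sq (proj1_sig mu) (proj1_sig nu) < (dl ^+ 2)%:E)%E]).

#[global] Instance W2nbhs_filter mu : Filter (W2nbhs mu).
Proof.
apply: filter_from_filter; first by exists 1 => /=.
move=> i j /= i0 j0; exists (Num.min i j); first by rewrite /= lt_min i0.
have m0 : 0 < Num.min i j by rewrite lt_min i0.
move=> nu /= h; split; apply: (lt_le_trans h); rewrite lee_fin ler_pXn2r ?nnegrE ?(ltW m0) ?(ltW i0) ?(ltW j0) //.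
  by rewrite ge_min lexx.
by rewrite ge_min lexx orbT.
Qed.

Definition W2cts {T : topologicalType} (f : PK hk0 -> T) :=
  forall mu, f @ W2nbhs mu --> f mu.

Lemma W2cts_measurable (f : PK hk0 -> R) :
  W2cts f -> measurable_fun setT (f : PKm hk0 -> R).
Proof.
move=> cf; apply: (measurability _ (RGenOInfty.measurableE R)).
move=> _ [_ [a ->] <-]; rewrite setTI; apply: sub_sigma_algebra => /=.
move=> mu /= fmu.
have : nbhs (f mu) `]a, +oo[%classic by apply: open_nbhs_nbhs; split => //; exact: interval_open.
move=> /cf[dl /= dl0 H]; exists dl; split => // nu hnu; exact: H.
Qed.

Lemma W2cts_Rintegral (h : 'rV[R]_d -> R) :
  continuous h -> (exists B, forall x, `|h x| <= B) ->
  W2cts (fun mu : PK hk0 => Rintegral (proj1_sig mu) setT h).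
Proof.
move=> ch bh mu; apply/cvgrPdist_lt => e e0.
have [dl dl0 H] := Rintegral_W2_continuous hK mu ch bh e0.
by exists dl.
Qed.

Lemma W2cts_Lphi m (phi : 'I_m -> 'rV[R]_d -> R) :
  (forall k, continuous (phi k)) -> (forall k, exists B, forall x, `|phi k x| <= B) ->
  W2cts (fun mu : PK hk0 => Lphi phi (proj1_sig mu)).
Proof.
move=> cphi bphi mu; apply/cvg_ballP => e e0.
have H k : (fun mu : PK hk0 => Rintegral (proj1_sig mu) setT (phi k)) @ W2nbhs mu -->
  Rintegral (proj1_sig mu) setT (phi k) by exact: W2cts_Rintegral.
have : W2nbhs mu [set nu : PK hk0 | forall k,
    ball (Rintegral (proj1_sig mu) setT (phi k)) e (Rintegral (proj1_sig nu) setT (phi k))].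
  apply: (@filter_forall _ _ (fun k (nu : PK hk0) => ball (Rintegral (proj1_sig mu) setT (phi k)) e (Rintegral (proj1_sig nu) setT (phi k))) (W2nbhs mu)) => k.
  have /cvg_ballP := H k; exact.
apply: (@filterS _ (W2nbhs mu)) => nu Hnu; split=> // i j.
by rewrite !mxE; exact: Hnu.
Qed.

Lemma W2cts_comp (T U : topologicalType) (f : PK hk0 -> T) (g : T -> U) :
  W2cts f -> continuous g -> W2cts (g \o f).
Proof. move=> cf cg mu; apply: cvg_comp; [exact: cf|exact: cg]. Qed.

Lemma W2ctsM (f g : PK hk0 -> R) : W2cts f -> W2cts g -> W2cts (fun mu => f mu * g mu).
Proof. by move=> cf cg mu; apply: cvgM; [exact: cf|exact: cg]. Qed.

Lemma W2cts_sum (I : Type) (s : seq I) (f : I -> PK hk0 -> R) :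
  (forall i, W2cts (f i)) -> W2cts (fun mu => \sum_(i <- s) f i mu).
Proof.
by move=> cf mu; apply: cvg_sum_seq => i; exact: cf.
Qed.

End WassersteinFilter.

Section BoundedFunctions.
Variables (R : realType) (T : Type).
Implicit Types f g : T -> R.

Definition bfun f := exists B : R, forall x, `|f x| <= B.

Lemma bfun_cst c : bfun (fun=> c).
Proof. by exists `|c|. Qed.

Lemma bfunD f g : bfun f -> bfun g -> bfun (fun x => f x + g x).
Proof.
move=> [A hA] [B hB]; exists (A + B) => x.
by rewrite (le_trans (ler_normD _ _)) // lerD.
Qed.

Lemma bfunN f : bfun f -> bfun (fun x => - f x).
Proof. by move=> [A hA]; exists A => x; rewrite normrN. Qed.

Lemma bfunB f g : bfun f -> bfun g -> bfun (fun x => f x - g x).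
Proof. by move=> hf hg; apply: bfunD => //; exact: bfunN. Qed.

Lemma bfunM f g : bfun f -> bfun g -> bfun (fun x => f x * g x).
Proof.
move=> [A hA] [B hB]; exists (A * B) => x.
by rewrite normrM ler_pM.
Qed.

Lemma bfun_sum (I : Type) (s : seq I) (F : I -> T -> R) :
  (forall i, bfun (F i)) -> bfun (fun x => \sum_(i <- s) F i x).
Proof.
move=> hF; elim: s => [|i s IH].
  by exists 0 => x; rewrite big_nil normr0.
by have [B hB] := bfunD (hF i) IH; exists B => x; rewrite big_cons.
Qed.

End BoundedFunctions.

Lemma bfun_comp (R : realType) (T U : Type) (f : T -> R) (h : U -> T) :
  bfun f -> bfun (f \o h).
Proof. by move=> [B hB]; exists B => x; exact: hB. Qed.

(** * Cylinder functions: continuity and boundedness of values and gradient Gram matrices *)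

Section Cylinder.
Variables (R : realType) (d : nat) (K : set (Rd R d)) (k0 : Rd R d) (hk0 : K k0).
Hypothesis hK : compact (K : set 'rV[R]_d).
Variables (n : nat) (m : 'I_n -> nat) (psi : forall i, 'rV[R]_(m i) -> R)
  (phi : forall i, 'I_(m i) -> 'rV[R]_d -> R).
Hypothesis (hpsi : forall i, C1b (@psi i)) (hphi : forall i k, C1b (@phi i k)).

Let ellP (i : 'I_n) (mu : PK hk0) : R := ell psi phi i (proj1_sig mu).
Let coef (i : 'I_n) (k : 'I_(m i)) (mu : PK hk0) : R :=
  pderiv (@psi i) k (Lphi (@phi i) (proj1_sig mu)).
Let gg i (k : 'I_(m i)) j (l : 'I_(m j)) (x : 'rV[R]_d) : R := dotv (grad (@phi i k) x) (grad (@phi j l) x).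

Lemma C1b_continuous q (f : 'rV[R]_q -> R) : C1b f -> continuous f.
Proof. by move=> [_ [df _]] x; exact: differentiable_continuous. Qed.

Lemma dotv_grad_continuous i (k : 'I_(m i)) j (l : 'I_(m j)) : continuous (gg k l).
Proof.
have -> : gg k l = fun x => \sum_s pderiv (@phi i k) s x * pderiv (@phi j l) s x.
  by apply/funext => x; apply: eq_bigr => s _; rewrite !mxE.
have [_ [_ [c1 _]]] := @hphi i k; have [_ [_ [c2 _]]] := @hphi j l.
move=> x; apply: (cvg_sum_seq (nbhs_filter x)) => s.
by apply: cvgM; [exact: c1|exact: c2].
Qed.

Lemma dotv_grad_bounded i (k : 'I_(m i)) j (l : 'I_(m j)) : bfun (gg k l).
Proof.
apply: bfun_sum => s; have [_ [_ [_ /(_ s) b1]]] := @hphi i k.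
have [_ [_ [_ /(_ s) b2]]] := @hphi j l.
by have [B hB] := bfunM b1 b2; exists B => x; rewrite !mxE.
Qed.

Definition Dmat (mu : PK hk0) : 'M[R]_n := \matrix_(i, j)
  Rintegral (proj1_sig mu) setT
    (fun x => dotv (Dell psi phi i (proj1_sig mu) x) (Dell psi phi j (proj1_sig mu) x)).

Lemma W2cts_ell i : W2cts (ellP i).
Proof.
apply: (@W2cts_comp _ _ _ _ _ _ _ (fun mu : PK hk0 => Lphi (@phi i) (proj1_sig mu)) (@psi i)).
  apply: W2cts_Lphi => // k; first exact: C1b_continuous.
  by have [] := @hphi i k.
exact: C1b_continuous.
Qed.

Lemma bounded_ell i : bfun (ellP i).
Proof. by have [[B hB] _] := @hpsi i; exists B => mu; exact: hB. Qed.

Lemma W2cts_coef i k : W2cts (@coef i k).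
Proof.
apply: (@W2cts_comp _ _ _ _ _ _ _ (fun mu : PK hk0 => Lphi (@phi i) (proj1_sig mu)) (pderiv (@psi i) k)).
  apply: W2cts_Lphi => // l; first exact: C1b_continuous.
  by have [] := @hphi i l.
by have [_ [_ []]] := @hpsi i.
Qed.

Lemma bounded_coef i k : bfun (@coef i k).
Proof. by have [_ [_ [_ /(_ k)[B hB]]]] := @hpsi i; exists B => mu; exact: hB. Qed.

(** Separates [mu] from [x]. In [Dmat] the measure enters both the integrand and the integration;
    after this expansion it appears only in continuous coefficients and in integrals of fixed
    continuous functions. *)
Lemma dotv_DellE i j (mu : PK hk0) (x : 'rV[R]_d) :
  dotv (Dell psi phi i (proj1_sig mu) x) (Dell psi phi j (proj1_sig mu) x) =
  \sum_(k < m i) \sum_(l < m j) @coef i k mu * @coef j l mu * gg k l x.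
Proof.
rewrite /dotv.
have E a s : Dell psi phi a (proj1_sig mu) x ord0 s = \sum_(k < m a) @coef a k mu * grad (@phi a k) x ord0 s.
  by rewrite /Dell /cyl_D summxE; apply: eq_bigr => k _; rewrite mxE.
under eq_bigr do rewrite !E mulr_suml.
rewrite exchange_big /=; apply: eq_bigr => k _.
under eq_bigr do rewrite mulr_sumr.
rewrite exchange_big /=; apply: eq_bigr => l _.
by rewrite /gg /dotv mulr_sumr; apply: eq_bigr => s _; ring.
Qed.

Lemma dotv_Dell_meas_bounded i j (mu : PK hk0) :
  let h (x : Rd R d) := dotv (Dell psi phi i (proj1_sig mu) x) (Dell psi phi j (proj1_sig mu) x) in
  measurable_fun setT h /\ bfun h.
Proof.
split.
  under eq_fun do rewrite dotv_DellE.
  apply: measurable_sum => k; apply: measurable_sum => l.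
  apply: measurable_funM => //; apply: continuous_measurable_Rd; exact: dotv_grad_continuous.
have : bfun (fun x => \sum_(k < m i) \sum_(l < m j) @coef i k mu * @coef j l mu * gg k l x).
  apply: bfun_sum => k; apply: bfun_sum => l; apply: bfunM; first exact: bfun_cst.
  exact: dotv_grad_bounded.
by move=> [B hB]; exists B => x; rewrite dotv_DellE.
Qed.

Lemma integrable_dotv_Dell i j (mu : PK hk0) :
  (proj1_sig mu).-integrable setT (EFin \o (fun x : Rd R d =>
    dotv (Dell psi phi i (proj1_sig mu) x) (Dell psi phi j (proj1_sig mu) x))).
Proof. by have [] := dotv_Dell_meas_bounded i j mu; exact: bounded_integrable. Qed.

Lemma DmatE mu i j : Dmat mu i j =
  \sum_(k < m i) \sum_(l < m j) @coef i k mu * @coef j l mu * Rintegral (proj1_sig mu) setT (gg k l : Rd R d -> R).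
Proof.
rewrite mxE; under eq_Rintegral do rewrite dotv_DellE.
have I k l : (proj1_sig mu).-integrable setT (EFin \o (gg k l : Rd R d -> R)).
  apply: bounded_integrable; last exact: dotv_grad_bounded.
  by apply: continuous_measurable_Rd; exact: dotv_grad_continuous.
rewrite Rintegral_sum => [|k]; last first.
  by apply: integrable_sum_EFin => l; exact: integrableZ_EFin.
apply: eq_bigr => k _; rewrite Rintegral_sum => [|l]; last exact: integrableZ_EFin.
by apply: eq_bigr => l _; rewrite RintegralZl.
Qed.

Lemma W2cts_Dmat i j : W2cts (fun mu => Dmat mu i j).
Proof.
rewrite (_ : (fun mu => _) = fun mu => \sum_(k < m i) \sum_(l < m j) @coef i k mu * @coef j l mu *
    Rintegral (proj1_sig mu) setT (gg k l : Rd R d -> R)); last first.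
  by apply/funext => mu; exact: DmatE.
apply: W2cts_sum => k; apply: W2cts_sum => l; apply: W2ctsM.
  by apply: W2ctsM; exact: W2cts_coef.
by apply: W2cts_Rintegral => //; [exact: dotv_grad_continuous|exact: dotv_grad_bounded].
Qed.

Lemma bounded_Dmat i j : bfun (fun mu => Dmat mu i j).
Proof.
have [B hB] : bfun (fun mu => \sum_(k < m i) \sum_(l < m j) @coef i k mu * @coef j l mu *
    Rintegral (proj1_sig mu) setT (gg k l : Rd R d -> R)).
  apply: bfun_sum => k; apply: bfun_sum => l; apply: bfunM.
    by apply: bfunM; exact: bounded_coef.
  have [B hB] := @dotv_grad_bounded i k j l; exists B => mu.
  have mg : measurable_fun setT (gg k l : Rd R d -> R).
    by apply: continuous_measurable_Rd; exact: dotv_grad_continuous.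
  have gi : (proj1_sig mu).-integrable setT (EFin \o (gg k l : Rd R d -> R)).
    by apply: bounded_integrable => //; exact: dotv_grad_bounded.
  apply: (le_trans (le_normr_Rintegral measurableT gi)).
  apply: (@le_trans _ _ (Rintegral (proj1_sig mu) setT (fun=> B))).
    apply: le_Rintegral => //; first exact: (integrable_norm gi).
    exact: integrable_cst.
  rewrite Rintegral_cst //.
  have -> : fine (proj1_sig mu setT) = 1 by have -> := @probability_setT _ _ _ (proj1_sig mu).
  by rewrite mulr1.
by exists B => mu; rewrite DmatE.
Qed.

Lemma Rintegral_sqnorm_VD (b : 'I_n -> R) (mu : PK hk0) :
  Rintegral (proj1_sig mu) setT
    (fun x : Rd R d => dotv (VD psi phi b (proj1_sig mu) x) (VD psi phi b (proj1_sig mu) x)) =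
  \sum_i \sum_j b i * Dmat mu i j * b j.
Proof.
have E (x : 'rV[R]_d) : dotv (VD psi phi b (proj1_sig mu) x) (VD psi phi b (proj1_sig mu) x) =
    \sum_i \sum_j b i * b j * dotv (Dell psi phi i (proj1_sig mu) x) (Dell psi phi j (proj1_sig mu) x).
  have E s : VD psi phi b (proj1_sig mu) x ord0 s = \sum_i b i * Dell psi phi i (proj1_sig mu) x ord0 s.
    by rewrite /VD summxE; apply: eq_bigr => k _; rewrite mxE.
  rewrite /dotv; under eq_bigr do rewrite !E mulr_suml.
  rewrite exchange_big /=; apply: eq_bigr => k _.
  under eq_bigr do rewrite mulr_sumr.
  rewrite exchange_big /=; apply: eq_bigr => l _.
  by rewrite mulr_sumr; apply: eq_bigr => s _; ring.
under eq_Rintegral do rewrite E.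
rewrite Rintegral_sum => [|i]; last first.
  by apply: integrable_sum_EFin => j; apply: integrableZ_EFin; exact: integrable_dotv_Dell.
apply: eq_bigr => i _; rewrite Rintegral_sum => [|j]; last first.
  by apply: integrableZ_EFin; exact: integrable_dotv_Dell.
apply: eq_bigr => j _; rewrite RintegralZl //; last exact: integrable_dotv_Dell.
by rewrite mxE; ring.
Qed.

Lemma Dmat_tr mu : (Dmat mu)^T = Dmat mu.
Proof.
apply/matrixP => i j; rewrite !mxE; apply: eq_Rintegral => x _.
by apply: eq_bigr => s _; rewrite mulrC.
Qed.

Lemma Dmat_psd mu (b : 'I_n -> R) : 0 <= \sum_i \sum_j b i * Dmat mu i j * b j.
Proof.
rewrite -Rintegral_sqnorm_VD; apply: Rintegral_ge0 => x _.
by apply: sumr_ge0 => s _; rewrite -expr2 sqr_ge0.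
Qed.

End Cylinder.

(** * Independence and factorization of expectations *)

Section IndependentPair.
Context (R : realType) d (Omega : measurableType d) (P : probability Omega R).
Context d2 (T2 : measurableType d2) (V : Omega -> T2) (G : set (set Omega)).
Hypothesis mV : measurable_fun setT V.
Hypothesis mG : G `<=` measurable.
Hypothesis GT : G setT.
Hypothesis GI : setI_closed G.
Hypothesis indGV : forall A B, G A -> measurable B ->
  P (A `&` V @^-1` B) = (P A * P (V @^-1` B))%E.

Let OmegaG := g_sigma_algebraType G.

Lemma sub_sigma_measurable (A : set Omega) : <<s G >> A -> measurable A.
Proof. by move=> h; apply: (smallest_sub _ mG h); exact: sigma_algebra_measurable. Qed.

Lemma sub_sigma_measurable_fun d3 (T3 : measurableType d3) (W : Omega -> T3) :
  measurable_fun setT (W : OmegaG -> T3) -> measurable_fun setT W.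
Proof.
move=> mW _ B mB; have := mW measurableT B mB.
by rewrite !setTI => /sub_sigma_measurable.
Qed.

(** For fixed [B], both sides are finite measures in [A] that agree on the pi-system [G], hence on
    the sigma-algebra it generates. *)
Lemma independent_sigma (A : set Omega) (B : set T2) : <<s G >> A -> measurable B ->
  P (A `&` V @^-1` B) = (P A * P (V @^-1` B))%E.
Proof.
move=> GA mB.
have mVB : measurable (V @^-1` B) by rewrite -[X in measurable X]setTI; exact: mV.
have fB : P (V @^-1` B) \is a fin_num by exact: fin_num_measure.
pose q : {nonneg R} := NngNum (fine_ge0 (measure_ge0 P (V @^-1` B))).
have qE : q%:num%:E = P (V @^-1` B) by rewrite /q /= fineK.
have E := @g_sigma_algebra_measure_unique _ R Omega G mG (fun=> setT) (fun=> GT) _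
  (mrestr P mVB) (mscale q P) GI.
have {}E : mrestr P mVB A = mscale q P A.
  apply: E => //.
  - by rewrite bigcup_const //; exists 0%N.
  - move=> C GC; change (P (C `&` V @^-1` B) = (q%:num%:E * P C)%E).
    by rewrite qE muleC; exact: indGV.
  - move=> _; change (P (setT `&` V @^-1` B) < +oo)%E; rewrite setTI; apply: le_lt_trans (probability_le1 _ _) _ => //.
    exact: ltry.
move: E; change (P (A `&` V @^-1` B) = (q%:num%:E * P A)%E -> P (A `&` V @^-1` B) = (P A * P (V @^-1` B))%E).
by rewrite qE muleC.
Qed.

Lemma independent_integral (W : Omega -> R) (f : T2 -> R) :
  measurable_fun setT (W : OmegaG -> R) -> measurable_fun setT f ->
  P.-integrable setT (EFin \o W) -> P.-integrable setT (EFin \o (f \o V)) ->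
  P.-integrable setT (EFin \o (fun w => W w * f (V w))) /\
  Rintegral P setT (fun w => W w * f (V w)) =
    Rintegral P setT W * Rintegral P setT (f \o V).
Proof.
move=> mW mf iW ifV.
have mid : measurable_fun setT (idfun : Omega -> OmegaG).
  by move=> _ B mB; rewrite setTI; exact: sub_sigma_measurable.
have mJ : measurable_fun setT ((fun w => (w, V w)) : Omega -> (OmegaG * T2)%type).
  exact: measurable_fun_pair.
pose X : {mfun Omega >-> OmegaG} := HB.pack (idfun : Omega -> OmegaG) (isMeasurableFun.Build _ _ _ _ _ mid).
pose Y : {mfun Omega >-> T2} := HB.pack V (isMeasurableFun.Build _ _ _ _ _ mV).
pose J : {mfun Omega >-> (OmegaG * T2)%type} := HB.pack ((fun w => (w, V w)) : Omega -> (OmegaG * T2)%type) (isMeasurableFun.Build _ _ _ _ _ mJ).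
pose m1 := distribution P X; pose m2 := distribution P Y.
pose g (z : OmegaG * T2) : \bar R := (W z.1 * f z.2)%:E.
have mg : measurable_fun setT g.
  apply/measurable_EFinP; apply: measurable_funM.
    by apply: (measurableT_comp mW); exact: measurable_fst.
  by apply: (measurableT_comp mf); exact: measurable_snd.
(* The graph map [w -> (w, V w)], with [Omega] carrying the smaller sigma-algebra, has the product
   law; the factorization is then Fubini's theorem. *)
have JE : forall C, measurable C -> (m1 \x m2)%E C = distribution P J C.
  apply: product_measure_unique => A B mA mB.
  change (P (A `&` V @^-1` B) = (P A * P (V @^-1` B))%E).
  exact: independent_sigma.
have iXW : m1.-integrable setT (EFin \o W).
  apply/integrableP; split; first exact/measurable_EFinP.
  rewrite ge0_integral_distribution //; last by do 2 apply: measurableT_comp => //.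
  by case/integrableP : iW.
have iYf : m2.-integrable setT (EFin \o f).
  apply/integrableP; split; first exact/measurable_EFinP.
  rewrite ge0_integral_distribution //; last by do 2 apply: measurableT_comp => //.
  by case/integrableP : ifV.
have ig : (m1 \x m2)%E.-integrable setT g.
  apply/integrable12ltyP => //.
  have -> : (\int[m1]_x \int[m2]_y `|g (x, y)| = (\int[m1]_x `|(W x)%:E|) * (\int[m2]_y `|(f y)%:E|))%E.
    have If0 : (0 <= \int[m2]_y `|(f y)%:E|)%E by exact: integral_ge0.
    rewrite -ge0_integralZr //; last by do 2 apply: measurableT_comp => //.
    apply: eq_integral => x _; rewrite -ge0_integralZl //.
      by apply: eq_integral => y _; rewrite -abseM -EFinM.
    by do 2 apply: measurableT_comp => //.
  have fin (dd : measure_display) (T : measurableType dd) (m : {measure set T -> \bar R}) (h : T -> R) :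
      m.-integrable setT (EFin \o h) -> (\int[m]_x `|(h x)%:E|)%E \is a fin_num.
    by move=> /integrableP[_ hoo]; rewrite ge0_fin_numE // integral_ge0.
  by rewrite ltey_eq fin_numM //; exact: fin.
have iJ : (distribution P J).-integrable setT g.
  apply/integrableP; split => //.
  rewrite (eq_measure_integral (m1 \x m2)%E) //; first by case/integrableP : ig.
  by move=> A mA _; apply/esym; exact: JE.
have iP : P.-integrable setT (EFin \o (fun w => W w * f (V w))).
  apply/integrableP; split.
    apply/measurable_EFinP; apply: measurable_funM; first exact: sub_sigma_measurable_fun.
    exact: measurableT_comp.
  case/integrableP : iJ => _; rewrite ge0_integral_distribution //.
  exact: measurableT_comp.
split => //.
have finf : (\int[m2]_y (f y)%:E)%E \is a fin_num by exact: integrable_fin_num iYf.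
have finW : (\int[m1]_x (W x)%:E)%E \is a fin_num by exact: integrable_fin_num iXW.
have E1 : (\int[P]_w (W w * f (V w))%:E = (\int[m1]_x (W x)%:E) * \int[m2]_y (f y)%:E)%E.
  transitivity (\int[distribution P J]_z g z)%E.
    by rewrite integral_distribution.
  rewrite (eq_measure_integral (m1 \x m2)%E); last by move=> A mA _; apply/esym; exact: JE.
  rewrite -(integral12_prod_meas1 ig) -(fineK finf) -integralZr //.
  apply: eq_integral => x _; rewrite fineK // -integralZl //.
rewrite /Rintegral E1 fineM //; congr (fine _ * fine _).
  by rewrite integral_distribution //; exact/measurable_EFinP.
by rewrite integral_distribution //; exact/measurable_EFinP.
Qed.

End IndependentPair.

Section IndependentSample.
Context (R : realType) d (Omega : measurableType d) (P : probability Omega R).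
Context d1 d2 (T1 : measurableType d1) (T2 : measurableType d2) (N : nat).
Variables (X : 'I_N -> Omega -> T1) (Y : 'I_N -> Omega -> T2).
Hypothesis mX : forall i, measurable_fun setT (X i).
Hypothesis mY : forall i, measurable_fun setT (Y i).
Hypothesis indXY : forall (A : 'I_N -> set T1) (B : 'I_N -> set T2),
  (forall j, measurable (A j)) -> (forall j, measurable (B j)) ->
  P (\bigcap_(j in [set: 'I_N]) (X j @^-1` A j `&` Y j @^-1` B j)) =
  (\prod_(j < N) (P (X j @^-1` A j) * P (Y j @^-1` B j)))%E.
Variable j : 'I_N.

(* Generates the sigma-algebra of all the variables except [Y j]. *)
Definition all_but : set (set Omega) :=
  [set C | exists A B, [/\ forall i, measurable (A i), forall i, measurable (B i), B j = setT
    & C = \bigcap_(i in [set: 'I_N]) (X i @^-1` A i `&` Y i @^-1` B i)]].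

Lemma all_but_measurable : all_but `<=` measurable.
Proof.
move=> _ [A [B [mA mB _ ->]]]; apply: fin_bigcap_measurable => // i _.
apply: measurableI; rewrite -[X in measurable X]setTI; [exact: mX|exact: mY].
Qed.

Lemma all_butT : all_but setT.
Proof.
exists (fun=> setT), (fun=> setT); split => //.
by apply/seteqP; split => w //= _ i _; split.
Qed.

Lemma all_butI : setI_closed all_but.
Proof.
move=> _ _ [A [B [mA mB Bj ->]]] [A' [B' [mA' mB' Bj' ->]]].
exists (fun i => A i `&` A' i), (fun i => B i `&` B' i); split.
- by move=> i; exact: measurableI.
- by move=> i; exact: measurableI.
- by rewrite Bj Bj' setIT.
- apply/seteqP; split => w /=.
    by move=> [h h'] i _; have [? ?] := h i I; have [? ?] := h' i I.
  by move=> h; split => i _; have [[? ?] [? ?]] := h i I.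
Qed.

(** A generator leaves slot [j] of [Y] free, so [B0] can be inserted there and the product formula
    compared with and without it. *)
Lemma all_but_independent C B0 : all_but C -> measurable B0 ->
  P (C `&` Y j @^-1` B0) = (P C * P (Y j @^-1` B0))%E.
Proof.
move=> [A [B [mA mB Bj ->]]] mB0.
pose B' i := if i == j then B0 else B i.
have -> : \bigcap_(i in [set: 'I_N]) (X i @^-1` A i `&` Y i @^-1` B i) `&` Y j @^-1` B0 =
    \bigcap_(i in [set: 'I_N]) (X i @^-1` A i `&` Y i @^-1` B' i).
  apply/seteqP; split => w /=.
    by move=> [h h0] i _; have [h1 h2] := h i I; split=> //=; rewrite /B'; case: eqP => // ->.
  move=> h; split=> [i _|]; last by have [_] := h j I; rewrite /= /B' eqxx.
  have [h1 h2] := h i I; split => //=; move: h2; rewrite /= /B'; case: eqP => // -> _.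
  by rewrite Bj.
rewrite !indXY //; last by move=> i; rewrite /B'; case: ifP.
rewrite (bigD1 j) //= [X in (_ = X * _)%E](bigD1 j) //= /B' eqxx Bj preimage_setT probability_setT mule1.
rewrite (eq_bigr (fun i => P (X i @^-1` A i) * P (Y i @^-1` B i))%E); last first.
  by move=> i /negPf ->.
by rewrite -!muleA; congr (_ * _)%E; rewrite muleC.
Qed.

Let OmegaJ := g_sigma_algebraType all_but.

Lemma all_but_measurableX i : measurable_fun setT (X i : OmegaJ -> T1).
Proof.
move=> _ A0 mA0; rewrite setTI; apply: sub_sigma_algebra.
exists (fun k => if k == i then A0 else setT), (fun=> setT); split => //.
  by move=> k; case: ifP.
apply/seteqP; split => w /=.
  by move=> h k _; split => //=; case: eqP => // ->.
by move=> h; have [] := h i I; rewrite /= eqxx.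
Qed.

Lemma all_but_measurableY i : i != j -> measurable_fun setT (Y i : OmegaJ -> T2).
Proof.
move=> ij _ B0 mB0; rewrite setTI; apply: sub_sigma_algebra.
exists (fun=> setT), (fun k => if k == i then B0 else setT); split => //.
- by move=> k; case: ifP.
- by rewrite eq_sym (negPf ij).
apply/seteqP; split => w /=.
  by move=> h k _; split => //=; case: eqP => // ->.
by move=> h; have [] := h i I; rewrite /= eqxx.
Qed.

Lemma all_but_integral (W : Omega -> R) (f : T2 -> R) :
  measurable_fun setT (W : OmegaJ -> R) -> measurable_fun setT f ->
  P.-integrable setT (EFin \o W) -> P.-integrable setT (EFin \o (f \o Y j)) ->
  P.-integrable setT (EFin \o (fun w => W w * f (Y j w))) /\
  Rintegral P setT (fun w => W w * f (Y j w)) =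
    Rintegral P setT W * Rintegral P setT (f \o Y j).
Proof.
apply: independent_integral; [exact: mY|exact: all_but_measurable|exact: all_butT|
  exact: all_butI|exact: all_but_independent].
Qed.

End IndependentSample.

(** * Entrywise measurable and bounded random matrices *)

Section RandomMatrix.
Context (R : realType) d (T : measurableType d) (n : nat).
Implicit Types A B : T -> 'M[R]_n.

Definition mmx A := forall a b, measurable_fun setT (fun w => A w a b).
Definition bmx A := forall a b, bfun (fun w => A w a b).

Lemma mmx_cst (M : 'M[R]_n) : mmx (fun=> M).
Proof. by move=> a b; exact: measurable_cst. Qed.

Lemma mmxD A B : mmx A -> mmx B -> mmx (fun w => A w + B w).
Proof. by move=> hA hB a b; under eq_fun do rewrite mxE; exact: measurable_funD. Qed.

Lemma mmxZ c A : mmx A -> mmx (fun w => c *: A w).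
Proof. by move=> hA a b; under eq_fun do rewrite mxE; exact: measurable_funM. Qed.

Lemma mmxM A B : mmx A -> mmx B -> mmx (fun w => A w *m B w).
Proof.
move=> hA hB a b; under eq_fun do rewrite mxE.
by apply: measurable_sum => k; exact: measurable_funM.
Qed.

Lemma mmxX A k : mmx A -> mmx (fun w => A w ^+ k).
Proof.
move=> hA; elim: k => [|k IH]; first exact: mmx_cst.
by under eq_fun do rewrite exprS; exact: mmxM.
Qed.

Lemma mmx_sum (I : Type) (s : seq I) (Q : pred I) (F : I -> T -> 'M[R]_n) :
  (forall i, mmx (F i)) -> mmx (fun w => \sum_(i <- s | Q i) F i w).
Proof.
move=> hF a b; under eq_fun do rewrite summxE -big_filter.
by apply: measurable_sum => i; exact: hF.
Qed.

Lemma mmx_trace A : mmx A -> measurable_fun setT (fun w => \tr (A w)).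
Proof. by move=> hA; apply: measurable_sum => i; exact: hA. Qed.

Lemma bmx_cst (M : 'M[R]_n) : bmx (fun=> M).
Proof. by move=> a b; exact: bfun_cst. Qed.

Lemma bmxM A B : bmx A -> bmx B -> bmx (fun w => A w *m B w).
Proof.
move=> hA hB a b; under eq_fun do rewrite mxE.
by apply: bfun_sum => k; exact: bfunM.
Qed.

Lemma bmxX A k : bmx A -> bmx (fun w => A w ^+ k).
Proof.
move=> hA; elim: k => [|k IH]; first exact: bmx_cst.
by under eq_fun do rewrite exprS; exact: bmxM.
Qed.

Lemma bmx_trace A : bmx A -> bfun (fun w => \tr (A w)).
Proof. by move=> hA; apply: bfun_sum => i; exact: hA. Qed.

End RandomMatrix.

Lemma exp1D_le (R : realType) (x : R) k : 0 <= 1 + x -> (1 + x) ^+ k <= expR (k%:R * x).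
Proof.
move=> x0; rewrite expRM_natl lerXn2r ?nnegrE //; last exact: expR_ge1Dx.
Qed.

(** * Lower-tail matrix Chernoff bound *)

Section MatrixChernoff.
Context (R : realType) d (Omega : measurableType d) (P : probability Omega R).
Variables (N n : nat) (Z : 'I_N -> Omega -> 'M[R]_n) (S : 'M[R]_n) (q : R).
Variable G : 'I_N -> set (set Omega).
Hypothesis Zsym : forall j w, (Z j w)^T = Z j w.
Hypothesis Zpsd : forall j w, psd (Z j w).
Hypothesis Ztr : forall j w, \tr (Z j w) <= 1.
Hypothesis Zmeas : forall j, mmx (Z j).
Hypothesis GZ : forall i j, i != j -> mmx (Z i : g_sigma_algebraType (G j) -> 'M[R]_n).
Hypothesis indZ : forall j (W : Omega -> R),
  measurable_fun setT (W : g_sigma_algebraType (G j) -> R) -> bfun W ->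
  forall a b, Rintegral P setT (fun w => W w * Z j w a b) = Rintegral P setT W * S a b.
Hypothesis q01 : 0 <= q <= 1.
Hypothesis Sq : psd (S - q%:M).

Lemma bmxZj j : bmx (Z j).
Proof.
move=> a b; exists n%:R => w.
apply: le_trans (psd_rowsum (Zpsd j w) (Zsym j w) (Ztr j w) a).
by rewrite (bigD1 b) //= lerDl sumr_ge0.
Qed.

(** Half of the lower bound [N q] on the mean of the sum. *)
Let s : R := N%:R * q / 2.

Lemma s_ge0 : 0 <= s.
Proof. by rewrite /s; case/andP: q01 => q0 _; rewrite divr_ge0 // mulr_ge0. Qed.

Section Fixed_l.
Variable l : nat.
Hypothesis l0 : (0 < l)%N.
Let tau : R := ln 2 / (2 ^ l)%:R.
Let msize : (0 : R) < (2 ^ l)%:R. Proof. by rewrite ltr0n expn_gt0. Qed.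
Let ln2_gt0 : (0 : R) < ln 2. Proof. by rewrite ln_gt0 // ltr1n. Qed.
Let ln2_le1 : ln 2 <= 1 :> R.
Proof. have := @le_ln1Dx R 1; rewrite -[1 + 1]/(2); apply; lra. Qed.

Let tau_ge0 : 0 <= tau. Proof. by rewrite divr_ge0 ?ltW. Qed.
Let tau_le1 : tau <= 1.
Proof.
rewrite ler_pdivrMr // mul1r (le_trans ln2_le1) // ler1n expn_gt0 //.
Qed.
Let mtau : (2 ^ l)%:R * tau = ln 2.
Proof. by rewrite /tau mulrC divfK // gt_eqF. Qed.

Definition chernoff_mx (k : nat) (w : Omega) : 'M[R]_n :=
  (1 + tau * s)%:M - tau *: \sum_(i < N | (i < k)%N) Z i w.

(** [L0] bounds the row sums of [s] minus a partial sum. [L] is chosen so that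
    [(1 + tau L0) (1 + tau n) <= 1 + tau L], using [tau <= 1]. [err] is the power-difference bound
    [rowsum_expB] for an error [tau^2 L0 n], with [(1 + tau L) ^ (2 ^ l) <= exp (ln 2 L)]. *)
Let L0 : R := s + (N * n)%:R.
Let L : R := L0 + n%:R + L0 * n%:R.
Let err : R := n%:R * ((2 ^ l)%:R * (tau ^+ 2 * L0 * n%:R) * expR (ln 2 * L)).

Lemma chernoff_mxS (j : 'I_N) w : chernoff_mx j.+1 w = chernoff_mx j w - tau *: Z j w.
Proof.
rewrite /chernoff_mx (bigD1 j) //= scalerDr opprD addrA addrAC; congr (_ - _ - _).
congr (_ *: _); apply: eq_bigl => i.
by rewrite ltnS leq_eqVlt -val_eqE; case: ltngtP.
Qed.

Lemma chernoff_mx_tr k w : (chernoff_mx k w)^T = chernoff_mx k w.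
Proof.
rewrite /chernoff_mx linearB /= linearZ /= tr_scalar_mx; congr (_ - _ *: _).
by rewrite linear_sum /=; apply: eq_bigr => i _; exact: Zsym.
Qed.

Lemma rowsum_partial k w : rowsum_le (s%:M - \sum_(i < N | (i < k)%N) Z i w) L0.
Proof.
have -> : s%:M - \sum_(i < N | (i < k)%N) Z i w = s *: 1%:M + (-1) *: \sum_(i < N | (i < k)%N) Z i w.
  by rewrite scaleN1r scalemx1.
apply: rowsumD.
  apply: rowsumW (rowsumZ s (@rowsum1 R n)).
  by rewrite mulr1 ger0_norm // s_ge0.
apply: rowsumW (_ : _ <= _) (rowsumZ (-1) (a := (N * n)%:R) _).
  by rewrite normrN1 mul1r.
move=> a; apply: (@le_trans _ _ (\sum_b \sum_(i < N) `|Z i w a b|)).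
  apply: ler_sum => b _; rewrite summxE (le_trans (ler_norm_sum _ _ _)) //.
  by rewrite [leRHS](bigID (fun i : 'I_N => (i < k)%N)) /= lerDl sumr_ge0.
rewrite exchange_big /= natrM.
apply: (@le_trans _ _ (\sum_(i < N) n%:R)); last by rewrite sumr_const card_ord mulr_natl.
by apply: ler_sum => i _; exact: psd_rowsum.
Qed.

Lemma chernoff_mxE k w : chernoff_mx k w = 1%:M + tau *: (s%:M - \sum_(i < N | (i < k)%N) Z i w).
Proof.
rewrite /chernoff_mx scalerBr addrA; congr (_ - _).
by apply/matrixP => a b; rewrite !mxE; case: (a == b); rewrite ?mulr1n ?mulr0n; ring.
Qed.

Lemma rowsum_chernoff k w : rowsum_le (chernoff_mx k w) (1 + tau * L0).
Proof.
rewrite chernoff_mxE; apply: rowsumD; first exact: rowsum1.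
apply: rowsumW (rowsumZ tau (rowsum_partial k w)).
by rewrite ger0_norm.
Qed.

(** The additive update [B - tau Y] is replaced by the product [B C] at cost [err]; the trace
    inequality then isolates [C ^ (2 ^ l)], which the chord bound makes affine in [Y]. *)
Lemma chernoff_step (j : 'I_N) w :
  \tr (chernoff_mx j.+1 w ^+ (2 ^ l)) <=
  \tr (chernoff_mx j w ^+ (2 ^ l)) - 2^-1 * \tr (chernoff_mx j w ^+ (2 ^ l) *m Z j w) + err.
Proof.
set B := chernoff_mx j w; set Y := Z j w; set C := 1%:M - tau *: Y.
have sB : B^T = B by exact: chernoff_mx_tr.
have sY : Y^T = Y by exact: Zsym.
have sC : C^T = C by rewrite /C linearB /= linearZ /= trmx1 sY.
have L00 : 0 <= L0 by rewrite addr_ge0 ?s_ge0.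
have Le : L0 <= L.
  by rewrite /L -addrA lerDl; apply: addr_ge0 => //; apply: mulr_ge0.
have T1 : \tr (chernoff_mx j.+1 w ^+ (2 ^ l)) <= \tr ((B *m C) ^+ (2 ^ l)) + err.
  rewrite -lerBlDl -raddfB /=; apply: (le_trans (ler_norm _)).
  have rY : rowsum_le Y n%:R by exact: (psd_rowsum (Zpsd j w) sY (Ztr j w)).
  have r1 : rowsum_le (chernoff_mx j.+1 w) (1 + tau * L).
    by apply: rowsumW (rowsum_chernoff _ _); rewrite lerD2l ler_wpM2l.
  have rC : rowsum_le C (1 + tau * n%:R).
    rewrite /C -scaleNr; apply: rowsumD; first exact: rowsum1.
    by apply: rowsumW (rowsumZ _ rY); rewrite normrN ger0_norm.
  have r2 : rowsum_le (B *m C) (1 + tau * L).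
    apply: rowsumW (rowsumM _ (rowsum_chernoff j w) rC); last by rewrite addr_ge0 // mulr_ge0.
    rewrite /L; have : tau * tau * (L0 * n%:R) <= tau * (L0 * n%:R).
      by rewrite ler_wpM2r ?mulr_ge0 // -[leRHS]mulr1 ler_wpM2l.
    nra.
  have rd : rowsum_le (chernoff_mx j.+1 w - B *m C) (tau ^+ 2 * L0 * n%:R).
    (* The first-order terms cancel because [B - 1] is itself of order [tau]. The error is of order
       [tau^2], and it stays small after multiplication by the exponent [2 ^ l]. *)
    have -> : chernoff_mx j.+1 w - B *m C =
        tau ^+ 2 *: ((s%:M - \sum_(i < N | (i < j)%N) Z i w) *m Y).
      rewrite chernoff_mxS -/B -/Y /C mulmxBr mulmx1 opprB addrC addrA subrK.
      rewrite -scalemxAr -scalerBr /B chernoff_mxE mulmxDl mul1mx addrAC subrr add0r.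
      by rewrite -scalemxAl scalerA -expr2.
    apply: rowsumW (rowsumZ _ (rowsumM _ (rowsum_partial j w) rY)); last by [].
    by rewrite ger0_norm ?mulrA //; exact: sqr_ge0.
  have c1 : 1 <= 1 + tau * L by rewrite lerDl mulr_ge0 // (le_trans L00).
  have e0 : 0 <= tau ^+ 2 * L0 * n%:R.
    by apply: mulr_ge0 => //; apply: mulr_ge0 => //; exact: sqr_ge0.
  have := rowsum_mxtrace (rowsum_expB (2 ^ l) c1 e0 r1 r2 rd).
  move=> /le_trans; apply; rewrite /err; apply: ler_wpM2l => //.
  apply: ler_wpM2l; first exact: mulr_ge0.
  have -> : ln 2 * L = (2 ^ l)%:R * (tau * L) by rewrite mulrA mtau.
  by apply: exp1D_le; rewrite (le_trans _ c1).
apply: (le_trans T1); rewrite lerD2r.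
apply: (le_trans (mxtrace_sym_mulX_le l sB sC)).
have pY1 : psd (1%:M - Y) by exact: (psd_1sub (Zpsd j w) (Ztr j w)).
have tau01 : 0 <= tau <= 1 by rewrite tau_ge0.
have ch := psd_exp_chord (2 ^ l) sY (Zpsd j w) pY1 tau01.
have := mxtrace_sym_exp_mul_ge0 sB l0 ch.
rewrite !mulmxBr mulmx1 -scalemxAr !raddfB /= mxtraceZ -/C subr_ge0 => /le_trans; apply.
rewrite lerD2l lerN2 ler_wpM2r //; first exact: (mxtrace_sym_exp_mul_ge0 sB l0 (Zpsd j w)).
(* The choice [2 ^ l tau = ln 2] is made for this value, so that the chord has slope at least
   1/2. *)
have : (1 - tau) ^+ (2 ^ l) <= 2^-1.
  apply: (le_trans (exp1D_le _ _)); first by rewrite subr_ge0.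
  by rewrite mulrN mtau expRN lnK // posrE.
lra.
Qed.

Let f k w := \tr (chernoff_mx k w ^+ (2 ^ l)).

Lemma mmx_chernoff d' (T' : measurableType d') (g : T' -> Omega) k :
  (forall i : 'I_N, (i < k)%N -> mmx (Z i \o g)) -> mmx (chernoff_mx k \o g).
Proof.
move=> h; rewrite /chernoff_mx.
(* The redundant conditional makes every summand measurable, also for [i >= k], where nothing is
   known about [Z i \o g]. *)
have -> : (fun w => (1 + tau * s)%:M - tau *: \sum_(i < N | (i < k)%N) Z i w) \o g =
  fun w => (1 + tau * s)%:M + (- tau) *: \sum_(i < N | (i < k)%N) (if (i < k)%N then Z i (g w) else 0).
  by apply/funext => w /=; rewrite scaleNr; congr (_ - _ *: _); apply: eq_bigr => i ik; rewrite ik.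
apply: mmxD; first exact: mmx_cst.
apply: mmxZ; apply: mmx_sum => i; case ik : (i < k)%N; first exact: h.
exact: mmx_cst.
Qed.

Lemma bmx_chernoff k : bmx (chernoff_mx k).
Proof.
move=> a b; exists (1 + tau * L0) => w.
apply: le_trans (rowsum_chernoff k w a).
by rewrite (bigD1 b) //= lerDl sumr_ge0.
Qed.

Lemma measurable_chernoff_trace k : measurable_fun setT (f k).
Proof.
apply: mmx_trace; apply: mmxX.
by apply: (@mmx_chernoff _ _ idfun k) => i _; exact: Zmeas.
Qed.

Lemma bounded_chernoff_trace k : bfun (f k).
Proof. by apply: bmx_trace; apply: bmxX; exact: bmx_chernoff. Qed.

Lemma chernoff_trace_ge0 k w : 0 <= f k w.
Proof.
rewrite /f -[X in \tr X]mulmx1; apply: mxtrace_sym_exp_mul_ge0 => //.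
  exact: chernoff_mx_tr.
by move=> v; exact: qf1_ge0.
Qed.

Lemma integrable_chernoff_trace k : P.-integrable setT (EFin \o f k).
Proof.
by apply: bounded_integrable; [exact: measurable_chernoff_trace|exact: bounded_chernoff_trace].
Qed.

Lemma chernoff_expectation_step (j : 'I_N) :
  Rintegral P setT (f j.+1) <= (1 - q / 2) * Rintegral P setT (f j) + err.
Proof.
pose B w := chernoff_mx j w ^+ (2 ^ l).
have mB : mmx B.
  by apply: mmxX; apply: (@mmx_chernoff _ _ idfun j) => i _; exact: Zmeas.
have bB : bmx B by apply: bmxX; exact: bmx_chernoff.
have gB : mmx (B : g_sigma_algebraType (G j) -> 'M[R]_n).
  apply: mmxX; apply: (@mmx_chernoff _ (g_sigma_algebraType (G j)) idfun j) => i ij.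
  by apply: GZ; rewrite -val_eqE /= ltn_eqF.
have iBZ a b c e : P.-integrable setT (EFin \o (fun w => B w a b * Z j w c e)).
  apply: bounded_integrable; first by apply: measurable_funM; [exact: mB|exact: Zmeas].
  by apply: bfunM; [exact: bB|exact: bmxZj].
have iB a b : P.-integrable setT (EFin \o (fun w => B w a b)).
  by apply: bounded_integrable; [exact: mB|exact: bB].
have trE (A C : 'M[R]_n) : \tr (A *m C) = \sum_a \sum_b A a b * C b a.
  by apply: eq_bigr => a _; rewrite mxE.
have iT : P.-integrable setT (EFin \o (fun w => \tr (B w *m Z j w))).
  rewrite (_ : (fun w => \tr (B w *m Z j w)) = fun w => \sum_a \sum_b B w a b * Z j w b a); last first.
    by apply/funext => w; exact: trE.
  by apply: integrable_sum_EFin => a; apply: integrable_sum_EFin => b; exact: iBZ.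
have iTS (M : 'M[R]_n) : P.-integrable setT (EFin \o (fun w => \tr (B w *m M))).
  rewrite (_ : (fun w => \tr (B w *m M)) = fun w => \sum_a \sum_b M b a * B w a b); last first.
    by apply/funext => w; rewrite trE; apply: eq_bigr => a _; apply: eq_bigr => b _; rewrite mulrC.
  by apply: integrable_sum_EFin => a; apply: integrable_sum_EFin => b; exact: integrableZ_EFin.
(* [B] involves only the indices below [j], so independence replaces [Z j] by its mean entry by
   entry. *)
have E1 : Rintegral P setT (fun w => \tr (B w *m Z j w)) = Rintegral P setT (fun w => \tr (B w *m S)).
  under eq_Rintegral do rewrite trE.
  under [RHS]eq_Rintegral do rewrite trE.
  rewrite Rintegral_sum => [|a]; last by apply: integrable_sum_EFin => b; exact: iBZ.
  rewrite [RHS]Rintegral_sum => [|a]; last first.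
    apply: integrable_sum_EFin => b.
    rewrite (_ : (fun w => B w a b * S b a) = fun w => S b a * B w a b); first exact: integrableZ_EFin.
    by apply/funext => w; rewrite mulrC.
  apply: eq_bigr => a _; rewrite Rintegral_sum => [|b]; last exact: iBZ.
  rewrite [RHS]Rintegral_sum => [|b]; last first.
    rewrite (_ : (fun w => B w a b * S b a) = fun w => S b a * B w a b); first exact: integrableZ_EFin.
    by apply/funext => w; rewrite mulrC.
  apply: eq_bigr => b _; rewrite RintegralZr //; apply: indZ; [exact: gB|exact: bB].
have E2 : q * Rintegral P setT (f j) <= Rintegral P setT (fun w => \tr (B w *m Z j w)).
  rewrite E1 -RintegralZl //; last exact: integrable_chernoff_trace.
  apply: le_Rintegral => //; first by apply: integrableZ_EFin; exact: integrable_chernoff_trace.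
  move=> w _; have := mxtrace_sym_exp_mul_ge0 (chernoff_mx_tr j w) l0 Sq.
  by rewrite mulmxBr mul_mx_scalar raddfB /= mxtraceZ subr_ge0.
have i3 := integrable_chernoff_trace j.
have i4 : P.-integrable setT (EFin \o (fun w => 2^-1 * \tr (B w *m Z j w))) by exact: integrableZ_EFin.
have i5 : P.-integrable setT (EFin \o (fun w => f j w - 2^-1 * \tr (B w *m Z j w))).
  exact: integrableB_EFin.
have i6 := integrable_cst P err.
apply: (@le_trans _ _ (Rintegral P setT (fun w => f j w - 2^-1 * \tr (B w *m Z j w) + err))).
  apply: le_Rintegral => //; [exact: integrable_chernoff_trace|exact: integrableD_EFin|].
  by move=> w _; exact: chernoff_step.
rewrite RintegralD // RintegralB // RintegralZl // Rintegral_cst //.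
have -> : fine (P setT) = 1 by rewrite probability_setT.
lra.
Qed.

Lemma err_ge0 : 0 <= err.
Proof.
have L00 : 0 <= L0 by rewrite addr_ge0 ?s_ge0.
rewrite /err; apply: mulr_ge0 => //; apply: mulr_ge0; last exact: expR_ge0.
by apply: mulr_ge0 => //; apply: mulr_ge0 => //; apply: mulr_ge0 => //; exact: sqr_ge0.
Qed.

(** The [N] contractions give [exp (- N q / 2)], the initial scalar matrix contributes
    [n exp (ln 2 s)], and [s = N q / 2] combines them into the rate [(1 - ln 2) / 2]. *)
Lemma chernoff_expectation :
  Rintegral P setT (f N) <= n%:R * expR (- ((1 - ln 2) / 2 * (N%:R * q))) + N%:R * err.
Proof.
have q0 : 0 <= 1 - q / 2 by case/andP: q01; lra.
have q1 : 1 - q / 2 <= 1 by case/andP: q01; lra.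
have H k : (k <= N)%N -> Rintegral P setT (f k) <=
    (1 - q / 2) ^+ k * (n%:R * (1 + tau * s) ^+ (2 ^ l)) + k%:R * err.
  elim: k => [_|k IH kN].
    rewrite expr0 mul1r mul0r addr0.
    have -> : f 0%N = fun=> n%:R * (1 + tau * s) ^+ (2 ^ l).
      apply/funext => w; rewrite /f /chernoff_mx big_pred0 // scaler0 subr0.
      have -> : forall c k, (c%:M : 'M[R]_n) ^+ k = (c ^+ k)%:M.
        by move=> c k; elim: k => [|k IH]; rewrite ?expr0 // exprS IH [in RHS]exprS scalar_mxM.
      by rewrite mxtrace_scalar mulr_natl.
    rewrite Rintegral_cst //.
    have -> : fine (P setT) = 1 by rewrite probability_setT.
    by rewrite mulr1.
  apply: (le_trans (chernoff_expectation_step (Ordinal kN))) => /=.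
  have := ler_wpM2l q0 (IH (ltnW kN)); rewrite (exprS _ k) -(natr1 k).
  have : (1 - q / 2) * (k%:R * err) <= k%:R * err.
    by rewrite -[leRHS]mul1r ler_wpM2r // mulr_ge0 // err_ge0.
  move: (1 - q / 2) (Rintegral _ _ _) (_ ^+ k) (_ * _ ^+ (2 ^ l)) (k%:R) => p I pk X kk.
  lra.
apply: (le_trans (H N (leqnn N))); rewrite lerD2r mulrCA ler_wpM2l //.
have -> : - ((1 - ln 2) / 2 * (N%:R * q)) = N%:R * (- (q / 2)) + ln 2 * s.
  by rewrite /s; field.
rewrite expRD ler_pM ?exprn_ge0 //.
- by apply: addr_ge0 => //; apply: mulr_ge0 => //; exact: s_ge0.
- exact: exp1D_le.
- have -> : ln 2 * s = (2 ^ l)%:R * (tau * s) by rewrite mulrA mtau.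
  by apply: exp1D_le; apply: addr_ge0 => //; apply: mulr_ge0 => //; exact: s_ge0.
Qed.

(** By contraposition: a direction in which the sum falls below [s] gives the Chernoff matrix a
    Rayleigh quotient above 1. *)
Lemma chernoff_trace_lt1 w v : f N w < 1 -> s * qf 1%:M v <= qf (\sum_j Z j w) v.
Proof.
move=> f1; rewrite leNgt; apply/negP => h.
have tau0 : 0 < tau by rewrite divr_gt0.
have v0 : 0 < qf 1%:M v.
  rewrite lt_neqAle qf1_ge0 andbT eq_sym; apply/eqP => v0.
  by move: h; rewrite (qf1_eq0 v0) /qf !mulmx0 !mxE mulr0 ltxx.
suff : 1 <= f N w by rewrite leNgt f1.
apply: (mxtrace_exp_ge1 (chernoff_mx_tr N w) l0 v0).
rewrite chernoff_mxE qfD qfZ qfB lerDl mulr_ge0 // subr_ge0.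
have -> : qf s%:M v = s * qf 1%:M v by rewrite -qfZ scalemx1.
rewrite (eq_bigl xpredT); first exact: ltW.
by move=> i; rewrite ltn_ord.
Qed.

End Fixed_l.

Lemma chernoff_level (eps : R) : 0 < eps -> exists2 l, (0 < l)%N &
  Rintegral P setT (fun w => \tr (chernoff_mx l N w ^+ (2 ^ l))) <=
  n%:R * expR (- ((1 - ln 2) / 2 * (N%:R * q))) + eps.
Proof.
move=> eps0.
pose L0 : R := s + (N * n)%:R.
pose A : R := N%:R * (n%:R * (L0 * n%:R * ln 2 ^+ 2 * expR (ln 2 * (L0 + n%:R + L0 * n%:R)))).
(* The accumulated error [N err] equals [A / 2 ^ l] with [A] independent of [l], so any [l] with
   [2 ^ l >= A / eps] is enough. *)
have [l0 hl] : exists l0 : nat, A / eps <= l0%:R.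
  exists (Num.bound `|A / eps|); apply: (le_trans (ler_norm _)); apply: ltW.
  by apply: archi_boundP; exact: normr_ge0.
exists l0.+1 => //; apply: (le_trans (chernoff_expectation (l := l0.+1) _)) => //.
rewrite lerD2l -/L0.
have p0 : (0 : R) < (2 ^ l0.+1)%:R by rewrite ltr0n expn_gt0.
have -> : N%:R * (n%:R * ((2 ^ l0.+1)%:R * ((ln 2 / (2 ^ l0.+1)%:R) ^+ 2 * L0 * n%:R) *
    expR (ln 2 * (L0 + n%:R + L0 * n%:R)))) = A / (2 ^ l0.+1)%:R.
  by rewrite /A; field; rewrite gt_eqF.
rewrite ler_pdivrMr // mulrC -ler_pdivrMr //; apply: (le_trans hl).
by rewrite ler_nat ltnW // (leq_trans (ltnSn l0)) // ltnW // ltn_expl.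
Qed.

End MatrixChernoff.

(** * Numerical bounds on logarithms and on [c_delta] *)

Section Numerics.
Variable R : realType.

Lemma le_lnB1 (x : R) : 0 < x -> ln x <= x - 1.
Proof. by move=> x0; have := @le_ln1Dx R (x - 1); rewrite addrCA subrr addr0; apply; lra. Qed.

Lemma ln_le_exp1D (x y : R) k : 0 < x -> 0 <= 1 + y -> x <= (1 + y) ^+ k -> ln x <= k%:R * y.
Proof.
move=> x0 y0 xy; rewrite -[leRHS]expRK ler_ln ?posrE ?expR_gt0 //.
exact: le_trans xy (exp1D_le _ y0).
Qed.

(** 3/4 is the value that makes the rate [(1 - ln 2) / 2] at least 1/8; it is certified by
    [(1 + 3/32)^8 >= 2]. *)
Lemma ln2_le : ln 2 <= 3 / 4 :> R.
Proof.
have -> : 3 / 4 = 8%:R * (3 / 32) :> R by field.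
apply: ln_le_exp1D; rewrite ?exprS ?expr0; lra.
Qed.

Lemma ln2_ge : 2 / 3 <= ln 2 :> R.
Proof.
have : ln (2^-1) <= 10%:R * (- (1 / 15)) :> R.
  apply: ln_le_exp1D; rewrite ?exprS ?expr0; lra.
rewrite lnV ?posrE //; lra.
Qed.

Lemma ln3half_le : ln (3 / 2) <= 5 / 12 :> R.
Proof.
have -> : 5 / 12 = 8%:R * (5 / 96) :> R by field.
apply: ln_le_exp1D; rewrite ?exprS ?expr0; lra.
Qed.

(** The logarithm is bounded through its tangent at 3/2, with 5/12 in place of [ln (3/2)]; the
    resulting convex quadratic is exactly 1/8 at [x = 1/2]. *)
Lemma c_delta_le (x : R) : 0 < x <= 1 / 2 -> c_delta x <= 1 / 8.
Proof.
move=> /andP[x0 x1]; rewrite /c_delta.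
have : ln (1 + x) <= 5 / 12 + ((1 + x) / (3 / 2) - 1).
  have -> : 1 + x = 3 / 2 * ((1 + x) / (3 / 2)) by field.
  rewrite lnM ?posrE ?divr_gt0 //; [|lra..].
  rewrite lerD ?ln3half_le // -?[3 / 2 * _]mulrC ?divfK; [|lra..].
  by apply: le_lnB1; rewrite divr_gt0; lra.
nra.
Qed.

(** With [v^2 = 1 + x] and [ln v >= 1 - 1/v], the value is at least
    [2 (v^2 - v) - (v^2 - 1) = (v - 1)^2]. *)
Lemma c_delta_gt0 (x : R) : 0 < x -> 0 < c_delta x.
Proof.
move=> x0; rewrite /c_delta.
pose v := Num.sqrt (1 + x).
have vE : v ^+ 2 = 1 + x by rewrite sqr_sqrtr //; lra.
have v0 : 0 < v by rewrite sqrtr_gt0; lra.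
have v1 : 1 < v by rewrite -(ltr_pXn2r (_ : (0 < 2)%N)) ?nnegrE ?ltW // vE; lra.
have h : 1 - v^-1 <= ln v by have := @le_lnB1 v^-1; rewrite invr_gt0 lnV ?posrE // => /(_ v0); lra.
rewrite -vE expr2 lnM ?posrE // -expr2.
have -> : x = v ^+ 2 - 1 by rewrite vE; lra.
have : v ^+ 2 * (1 - v^-1) = v ^+ 2 - v by field; rewrite gt_eqF.
have : v ^+ 2 * (1 - v^-1) <= v ^+ 2 * ln v by rewrite ler_wpM2l ?sqr_ge0.
nra.
Qed.

End Numerics.

(** * Second moments of empirical means *)

Section Moments.
Context (R : realType) d (Omega : measurableType d) (P : probability Omega R).

(* The integral of a nonnegative function is a supremum over simple minorants,
   so monotonicity needs no measurability. *)
Lemma ge0_le_integral_nonmeasurable (f g : Omega -> \bar R) :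
  (forall w, 0 <= f w)%E -> (forall w, f w <= g w)%E ->
  (\int[P]_w f w <= \int[P]_w g w)%E.
Proof.
move=> f0 fg; rewrite !ge0_integralTE //; last by move=> w; exact: le_trans (fg w).
apply: le_ereal_sup => _ [h hf <-]; exists h => // w.
exact: le_trans (fg w).
Qed.

Lemma integral_EFin_Rintegral (f : Omega -> R) : P.-integrable setT (EFin \o f) ->
  (\int[P]_w (f w)%:E)%E = (Rintegral P setT f)%:E.
Proof. by move=> fi; rewrite fineK //; exact: integrable_fin_num fi. Qed.

Lemma mean_second_moment (N : nat) (xi : 'I_N -> Omega -> R) (v : R) :
  (forall j k, P.-integrable setT (EFin \o (fun w => xi j w * xi k w))) ->
  (forall j k, j != k -> Rintegral P setT (fun w => xi j w * xi k w) = 0) ->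
  (forall j, Rintegral P setT (fun w => xi j w * xi j w) <= v) ->
  P.-integrable setT (EFin \o (fun w => (N%:R^-1 * \sum_j xi j w) ^+ 2)) /\
  Rintegral P setT (fun w => (N%:R^-1 * \sum_j xi j w) ^+ 2) <= v / N%:R.
Proof.
move=> ixi xi0 xiv.
have E : (fun w => (N%:R^-1 * \sum_j xi j w) ^+ 2) =
    fun w => N%:R^-1 ^+ 2 * \sum_j \sum_k xi j w * xi k w.
  apply/funext => w; rewrite exprMn; congr (_ * _); rewrite expr2 mulr_suml.
  by apply: eq_bigr => j _; rewrite mulr_sumr.
have i1 j : P.-integrable setT (EFin \o (fun w => \sum_k xi j w * xi k w)).
  exact: integrable_sum_EFin.
have i2 : P.-integrable setT (EFin \o (fun w => \sum_j \sum_k xi j w * xi k w)).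
  exact: integrable_sum_EFin.
rewrite E; split; first exact: integrableZ_EFin.
rewrite RintegralZl // Rintegral_sum //.
have [N0|N0] := posnP N.
  (* For [N = 0] both sides vanish because the inverse of zero is zero. *)
  by subst N; rewrite big_ord0 mulr0 invr0 mulr0.
have H : \sum_j Rintegral P setT (fun w => \sum_k xi j w * xi k w) <= N%:R * v.
  apply: (@le_trans _ _ (\sum_(j < N) v)); last by rewrite sumr_const card_ord mulr_natl.
  apply: ler_sum => j _; rewrite Rintegral_sum // (bigD1 j) //= big1 ?addr0 // => k kj.
  by rewrite xi0 // eq_sym.
have Np : (0 : R) < N%:R by rewrite ltr0n.
apply: (@le_trans _ _ (N%:R^-1 ^+ 2 * (N%:R * v))).
  by rewrite ler_wpM2l // exprn_ge0 // invr_ge0.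
rewrite le_eqVlt; apply/orP; left; apply/eqP; field.
by rewrite gt_eqF.
Qed.

End Moments.

(** * Measurability of the matrix inverse *)

Section MeasurableMatrixInverse.
Context (R : realType) d (T : measurableType d).

Lemma measurable_det n (A : T -> 'M[R]_n) :
  (forall i j, measurable_fun setT (fun w => A w i j)) ->
  measurable_fun setT (fun w => \det (A w)).
Proof.
move=> mA; apply: measurable_sum => s; apply: measurable_funM => //.
by apply: measurable_prod => i _; exact: mA.
Qed.

Lemma measurable_inv (f : T -> R) :
  measurable_fun setT f -> measurable_fun setT (fun w => (f w)^-1).
Proof.
move=> mf.
have -> : (fun w => (f w)^-1) = fun w => f w * ((f w ^+ 2) `^ (-1)).
  apply/funext => w; rewrite powR_inv1 ?sqr_ge0 //.
  have [->|f0] := eqVneq (f w) 0; first by rewrite invr0 mul0r.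
  by field.
apply: measurable_funM => //.
apply: (measurableT_comp (measurable_powR (-1))); exact: measurable_funX.
Qed.

(** The adjugate formula is measurable on the whole space, including where [A] is singular; on the
    good event it coincides with [invmx]. *)
Lemma mmx_inv_adj n (A : T -> 'M[R]_n) : mmx A ->
  mmx (fun w => (\det (A w))^-1 *: \adj (A w)).
Proof.
move=> mA i j; under eq_fun do rewrite mxE.
apply: measurable_funM; first by apply: measurable_inv; exact: measurable_det.
under eq_fun do rewrite mxE /cofactor.
apply: measurable_funM => //; apply: measurable_det => k l.
by under eq_fun do rewrite !mxE; exact: mA.
Qed.

End MeasurableMatrixInverse.

(** * Risk of the clipped ridge estimator *)

Section RidgeRegression.
Context (R : realType) dT (T : measurableType dT) (p : probability T R).
Context dO (Omega : measurableType dO) (P : probability Omega R) (N n : nat).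
Variables (ell : 'I_n -> T -> R) (D : T -> 'M[R]_n) (lam K mumin : R).
Hypothesis mell : forall i, measurable_fun setT (ell i).
Hypothesis bell : forall i, bfun (ell i).
Hypothesis mD : mmx D.
Hypothesis bD : bmx D.
Hypothesis Dsym : forall t, (D t)^T = D t.
Hypothesis Dpsd : forall t, psd (D t).
Hypothesis orth : forall i j, Rintegral p setT (fun t => ell i t * ell j t) = (i == j)%:R.
Hypothesis Dorth : forall i j, i != j -> Rintegral p setT (fun t => D t i j) = 0.
Hypothesis lam0 : 0 <= lam.
Hypothesis hK : forall t, \sum_i (ell i t ^+ 2 + lam * D t i i) <= K.
Hypothesis mu0 : 0 <= mumin.
Hypothesis hmu : forall i, mumin <= Rintegral p setT (fun t => D t i i).
Variables (mus : 'I_N -> Omega -> T) (eta : 'I_N -> Omega -> R).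
Hypothesis mmus : forall j, measurable_fun setT (mus j).
Hypothesis meta : forall j, measurable_fun setT (eta j).
Hypothesis lawmus : forall j A, measurable A -> P (mus j @^-1` A) = p A.
Hypothesis indep : forall (A : 'I_N -> set T) (B : 'I_N -> set R),
  (forall j, measurable (A j)) -> (forall j, measurable (B j)) ->
  P (\bigcap_(j in [set: 'I_N]) (mus j @^-1` A j `&` eta j @^-1` B j)) =
  (\prod_(j < N) (P (mus j @^-1` A j) * P (eta j @^-1` B j)))%E.

Let indep_swap (A : 'I_N -> set R) (B : 'I_N -> set T) :
  (forall j, measurable (A j)) -> (forall j, measurable (B j)) ->
  P (\bigcap_(j in [set: 'I_N]) (eta j @^-1` A j `&` mus j @^-1` B j)) =
  (\prod_(j < N) (P (eta j @^-1` A j) * P (mus j @^-1` B j)))%E.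
Proof.
move=> mA mB; under eq_bigr do rewrite muleC; rewrite -indep //.
by congr (P _); apply: eq_bigcapr => j _; rewrite setIC.
Qed.

Lemma expectation_sample (h : T -> R) j : measurable_fun setT h -> bfun h ->
  Rintegral P setT (h \o mus j) = Rintegral p setT h.
Proof.
move=> mh bh; apply: Rintegral_distribution => //; first exact: lawmus.
apply: bounded_integrable; first exact: measurableT_comp.
exact: bfun_comp.
Qed.

Lemma expectation_sample_pair (h k : T -> R) i j : i != j ->
  measurable_fun setT h -> bfun h -> measurable_fun setT k -> bfun k ->
  Rintegral P setT (fun w => h (mus i w) * k (mus j w)) =
  Rintegral p setT h * Rintegral p setT k.
Proof.
move=> ij mh bh mk bk.
have [_ ->] := @all_but_integral _ _ _ P _ _ _ _ N eta mus meta mmus indep_swap j (h \o mus i) k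
  (measurableT_comp mh (all_but_measurableY (X := eta) (Y := mus) ij)) mk
  (bounded_integrable P (measurableT_comp mh (mmus i)) (bfun_comp _ bh))
  (bounded_integrable P (measurableT_comp mk (mmus j)) (bfun_comp _ bk)).
by rewrite -(expectation_sample i mh bh) -(expectation_sample j mk bk).
Qed.

Let lv t : 'cV[R]_n := \col_i ell i t.
Let Xm t : 'M[R]_n := lv t *m (lv t)^T + lam *: D t.

Let XmE t a b : Xm t a b = ell a t * ell b t + lam * D t a b.
Proof. by rewrite /Xm 3!mxE big_ord1 !mxE. Qed.

Let mXm : mmx Xm.
Proof.
move=> a b; under eq_fun do rewrite XmE.
by apply: measurable_funD; apply: measurable_funM.
Qed.

Let bXm : bmx Xm.
Proof.
move=> a b; under eq_fun do rewrite XmE.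
by apply: bfunD; apply: bfunM => //; exact: bfun_cst.
Qed.

Let Xm_tr t : (Xm t)^T = Xm t.
Proof.
apply/matrixP => a b; rewrite mxE !XmE mulrC; congr (_ + _ * _).
by rewrite -[in LHS]Dsym mxE.
Qed.

Let qf_outer (u v : 'cV[R]_n) : qf (u *m u^T) v = vdot u v ^+ 2.
Proof.
have -> : qf (u *m u^T) v = vdot v u * vdot u v.
  by rewrite /qf mulmxA -mulmxA mxE big_ord1.
by rewrite vdotC expr2.
Qed.

Let Xm_psd t : psd (Xm t).
Proof.
move=> v; rewrite qfD qf_outer qfZ addr_ge0 ?sqr_ge0 // mulr_ge0 //; exact: Dpsd.
Qed.

Let Xm_trace t : \tr (Xm t) <= K.
Proof.
by apply: le_trans (hK t); apply: ler_sum => i _; rewrite XmE expr2.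
Qed.

Let sigmin := 1 + lam * mumin.
Let sigmin1 : 1 <= sigmin. Proof. by rewrite lerDl mulr_ge0. Qed.
Let s0 := sigmin / 2.
Let s00 : 0 < s0. Proof. by rewrite /s0; move: sigmin1; lra. Qed.

Let iD a b : p.-integrable setT (EFin \o (fun t => D t a b)).
Proof. by apply: bounded_integrable; [exact: mD|exact: bD]. Qed.

Let iell a b : p.-integrable setT (EFin \o (fun t => ell a t * ell b t)).
Proof. by apply: bounded_integrable; [exact: measurable_funM|exact: bfunM]. Qed.

Let E_Xm a b : Rintegral p setT (fun t => Xm t a b) =
  (a == b)%:R * (1 + lam * Rintegral p setT (fun t => D t a a)).
Proof.
under eq_Rintegral do rewrite XmE.
rewrite RintegralD //; last exact: integrableZ_EFin.
rewrite RintegralZl // orth; have [->|ab] := eqVneq a b; first by rewrite mul1r.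
by rewrite Dorth // mulr0 addr0 mul0r.
Qed.

(** The trace of [Xm] is at most [K] pointwise, while its mean is the sum of the [n] diagonal
    entries, each at least [sigmin]. This controls the dimension factor in the Chernoff bound. *)
Let K_ge : n%:R * sigmin <= K.
Proof.
have : Rintegral p setT (fun t => \tr (Xm t)) <= K.
  have := @le_Rintegral _ _ _ p setT (fun t => \tr (Xm t)) (fun=> K) measurableT.
  have -> : Rintegral p setT (fun=> K) = K.
    rewrite Rintegral_cst //.
    have -> : fine (p setT) = 1 by rewrite probability_setT.
    by rewrite mulr1.
  apply => //; last exact: integrable_cst.
  by apply: bounded_integrable; [exact: mmx_trace|exact: bmx_trace].
apply: le_trans; rewrite Rintegral_sum; last first.
  by move=> i; apply: bounded_integrable; [exact: mXm|exact: bXm].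
apply: (@le_trans _ _ (\sum_(i < n) sigmin)); first by rewrite sumr_const card_ord mulr_natl.
apply: ler_sum => i _; rewrite E_Xm eqxx mul1r lerD2l; exact: ler_wpM2l.
Qed.

Definition ridge_design w : 'M[R]_n := N%:R^-1 *: \sum_j Xm (mus j w).
Let G := ridge_design.

Variable r : R.
Hypothesis r0 : 0 < r.
Hypothesis N2 : (2 <= N)%N.
Hypothesis hN : 8 * ((1 + r) * K * ln N%:R) <= N%:R * sigmin.

Let Npos : (0 : R) < N%:R. Proof. by rewrite ltr0n (leq_trans _ N2). Qed.
Let lnN : 2 / 3 <= ln N%:R :> R.
Proof. by apply: (le_trans (ln2_ge R)); rewrite ler_ln ?posrE // ler_nat. Qed.

(** [fl] is the Chernoff trace of the matrices [Xm / K], whose traces are at most 1. Measurability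
    is stated through [g] so that [fl] can also be used on [Omega] with a sigma-algebra omitting one
    noise variable. *)
Lemma good_event : exists fl : Omega -> R,
  [/\ forall d' (T' : measurableType d') (g : T' -> Omega),
        (forall j, measurable_fun setT (mus j \o g)) -> measurable_fun setT (fl \o g),
      bfun fl, forall w, 0 <= fl w,
      Rintegral P setT fl <= N%:R `^ (- r) / 2 &
      forall w, fl w < 1 -> forall v, s0 * vdot v v <= qf (G w) v].
Proof.
(* For [n = 0] the constant [K] could be zero, and the normalization by [K^-1] below would be
   meaningless. *)
have [n0|n0] := posnP n.
  exists (fun=> 0); split.
  - by move=> *; exact: measurable_cst.
  - exact: bfun_cst.
  - by [].
  - by rewrite Rintegral_cst // mul0r divr_ge0 // powR_ge0.
  - move=> w _ v; rewrite vdotE qfE.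
    have no_index (i : 'I_n) : False.
      by have := leq_ltn_trans (leq0n i) (ltn_ord i); rewrite lt0n => /eqP; apply.
    by rewrite !big1 ?mulr0 // => i; case: (no_index i).
have n1 : (1 : R) <= n%:R by rewrite ler1n.
have K1 : sigmin <= K by apply: le_trans K_ge; rewrite -[leLHS]mul1r ler_wpM2r // (le_trans _ sigmin1).
have K0 : 0 < K by apply: lt_le_trans K1; move: sigmin1; lra.
pose Z j w := K^-1 *: Xm (mus j w).
pose S : 'M[R]_n := \matrix_(a, b) Rintegral p setT (fun t => K^-1 * Xm t a b).
pose q := sigmin / K.
have ZE j w a b : Z j w a b = K^-1 * Xm (mus j w) a b by rewrite mxE.
have mZe a b : measurable_fun setT (fun t => K^-1 * Xm t a b).
  by apply: measurable_funM => //; exact: mXm.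
have bZe a b : bfun (fun t => K^-1 * Xm t a b).
  by apply: bfunM; [exact: bfun_cst|exact: bXm].
have Zsym j w : (Z j w)^T = Z j w by rewrite /Z linearZ /= Xm_tr.
have Zpsd j w : psd (Z j w) by apply: psdZ; [rewrite invr_ge0 ltW|exact: Xm_psd].
have Ztr j w : \tr (Z j w) <= 1.
  by rewrite mxtraceZ mulrC ler_pdivrMr // mul1r.
have Zmeas j : mmx (Z j).
  by move=> a b; under eq_fun do rewrite ZE; exact: (measurableT_comp (mZe a b)).
pose Gs j := all_but eta mus j.
have GZ i j : i != j -> mmx (Z i : g_sigma_algebraType (Gs j) -> 'M[R]_n).
  move=> ij a b; under eq_fun do rewrite ZE.
  exact: (measurableT_comp (mZe a b) (all_but_measurableY (X := eta) (Y := mus) ij)).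
have indZ j (W : Omega -> R) :
    measurable_fun setT (W : g_sigma_algebraType (Gs j) -> R) -> bfun W ->
    forall a b, Rintegral P setT (fun w => W w * Z j w a b) = Rintegral P setT W * S a b.
  move=> mW bW a b.
  have mW' : measurable_fun setT W.
    exact: (sub_sigma_measurable_fun (all_but_measurable (Y := mus) meta mmus (j := j)) mW).
  have := @all_but_integral _ _ _ P _ _ _ _ N eta mus meta mmus indep_swap j W
    (fun t => K^-1 * Xm t a b) mW (mZe a b) (bounded_integrable P mW' bW)
    (bounded_integrable P (measurableT_comp (mZe a b) (mmus j)) (bfun_comp _ (bZe a b))).
  move=> [_ E]; under eq_Rintegral do rewrite ZE.
  by rewrite E [S a b]mxE (expectation_sample j (mZe a b) (bZe a b)).
have q01 : 0 <= q <= 1.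
  by rewrite /q divr_ge0 ?ler_pdivrMr ?mul1r // ltW // (lt_le_trans _ sigmin1).
(* Both orthogonality relations together make [S] diagonal, with entries at least
   [sigmin / K = q]. *)
have Sq : psd (S - q%:M).
  move=> v; rewrite qfE; apply: sumr_ge0 => a _.
  have SE b : (S - q%:M) a b = (a == b)%:R * (lam * (Rintegral p setT (fun t => D t a a) - mumin) / K).
    rewrite !mxE RintegralZl //; last by apply: bounded_integrable; [exact: mXm|exact: bXm].
    rewrite E_Xm /q /sigmin; case: (a == b); rewrite ?mulr1n ?mulr0n ?mul1r ?mul0r; last by rewrite mulr0 subr0.
    by field; rewrite gt_eqF.
  rewrite (bigD1 a) //= big1 ?addr0 => [|b ba].
    rewrite SE eqxx mul1r mulrAC -expr2 mulr_ge0 ?sqr_ge0 //.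
    by rewrite divr_ge0 ?(ltW K0) // mulr_ge0 // subr_ge0.
  by rewrite SE eq_sym (negPf ba) mul0r mulr0 mul0r.
have powN : 0 < N%:R `^ (- r) by rewrite powR_gt0.
(* The tolerance is 5/16 of [N^-r]: the exponential part is at most [n / N <= 3/16] of it, and the
   two add up to one half. *)
have [l l0 hl] := chernoff_level Zsym Zpsd Ztr Zmeas GZ indZ q01 Sq
  (divr_gt0 (mulr_gt0 (ltr0n _ 5) powN) (ltr0n _ 16)).
exists (fun w => \tr (chernoff_mx Z q l N w ^+ (2 ^ l))); split.
- move=> d' T' g hg; apply: mmx_trace; apply: mmxX; apply: mmx_chernoff => // i _ a b.
  have -> : (fun w => (Z i \o g) w a b) = (fun t => K^-1 * Xm t a b) \o (mus i \o g).
    by apply/funext => w /=; rewrite ZE.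
  exact: (measurableT_comp (mZe a b)).
- exact: bounded_chernoff_trace.
- by move=> w; exact: chernoff_trace_ge0.
- apply: (le_trans hl).
  have hexp : expR (- ((1 - ln 2) / 2 * (N%:R * q))) <= N%:R^-1 * N%:R `^ (- r).
    have -> : N%:R^-1 * N%:R `^ (- r) = expR (- ((1 + r) * ln N%:R)).
      rewrite /powR gt_eqF // mulrDl mul1r opprD expRD mulNr; congr (_ * _).
      by rewrite expRN lnK // posrE.
    rewrite ler_expR lerN2.
    have h8 : 8 * ((1 + r) * ln N%:R) <= N%:R * q.
      rewrite /q [leRHS]mulrA ler_pdivlMr //; apply: le_trans hN.
      by rewrite le_eqVlt; apply/orP; left; apply/eqP; ring.
    have := ln2_le R; have q0 : 0 <= N%:R * q by rewrite mulr_ge0 //; case/andP: q01.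
    nra.
  have hnN : n%:R * N%:R^-1 <= 3 / 16 :> R.
    rewrite ler_pdivrMr //.
    have : 8 * ((1 + r) * (n%:R * sigmin) * ln N%:R) <= N%:R * sigmin.
      apply: le_trans hN; apply: ler_wpM2l => //.
      apply: ler_wpM2r; first by move: lnN; lra.
      by apply: ler_wpM2l; [move: r0; lra|exact: K_ge].
    have sp : 0 < sigmin by move: sigmin1; lra.
    have -> : 8 * ((1 + r) * (n%:R * sigmin) * ln N%:R) = 8 * ((1 + r) * n%:R * ln N%:R) * sigmin by ring.
    rewrite ler_pM2r // => h.
    have : 2 / 3 * n%:R <= (1 + r) * n%:R * ln N%:R.
      have : (2 / 3 : R) * n%:R <= ln (N%:R : R) * n%:R by apply: ler_wpM2r.
      have : 0 <= r * (n%:R * ln N%:R) by rewrite mulr_ge0 ?(ltW r0) // mulr_ge0 //; move: lnN; lra.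
      lra.
    lra.
  have := ler_wpM2l (ler0n R n) hexp; rewrite mulrA => h1.
  have h2 := ler_wpM2r (ltW powN) hnN.
  lra.
- move=> w h v; have := chernoff_trace_lt1 Zsym l0 v h.
  have -> : \sum_j Z j w = (N%:R / K) *: G w.
    rewrite /G /ridge_design scalerA -scaler_sumr; congr (_ *: _).
    by field; rewrite !gt_eqF.
  rewrite qfZ qf1_vdot => h1.
  have NK : 0 < N%:R / K by rewrite divr_gt0.
  rewrite -(ler_pM2l NK); apply: le_trans h1.
  rewrite le_eqVlt; apply/orP; left; apply/eqP; rewrite /s0 /q; field; by rewrite gt_eqF.
Qed.

Variables (sigma2 M : R) (F : T -> R) (a : 'I_n -> R) (c : Omega -> 'I_n -> R).
Hypothesis ieta : forall j, P.-integrable setT (EFin \o eta j).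
Hypothesis eta_mean : forall j, Rintegral P setT (eta j) = 0.
Hypothesis ieta2 : forall j, P.-integrable setT (EFin \o (fun w => eta j w ^+ 2)).
Hypothesis eta_var : forall j, Rintegral P setT (fun w => eta j w ^+ 2) <= sigma2.
Hypothesis M0 : 0 < M.
Hypothesis mF : measurable_fun setT F.
Hypothesis hF : forall t, - M <= F t <= M.
Hypothesis hproj : forall j,
  Rintegral p setT (fun t => (F t - \sum_i a i * ell i t) * ell j t) = 0.
Hypothesis hc : forall w c',
  let obj (b : 'I_n -> R) :=
    N%:R^-1 * \sum_j (F (mus j w) + eta j w - \sum_i b i * ell i (mus j w)) ^+ 2
    + lam * (N%:R^-1 * \sum_j \sum_i \sum_k b i * D (mus j w) i k * b k) in
  obj (c w) <= obj c'.

Let cv (b : 'I_n -> R) : 'cV[R]_n := \col_i b i.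
Let av := cv a.
Let g t := F t - vdot av (lv t).
Let bg w : 'cV[R]_n := N%:R^-1 *: \sum_j g (mus j w) *: lv (mus j w).
Let be w : 'cV[R]_n := N%:R^-1 *: \sum_j eta j w *: lv (mus j w).
Let Dn w : 'M[R]_n := N%:R^-1 *: \sum_j lam *: D (mus j w).
Let e := Rintegral p setT (fun t => g t ^+ 2).

Let vdot_lv b t : vdot (cv b) (lv t) = \sum_i b i * ell i t.
Proof. by rewrite vdotE; apply: eq_bigr => i _; rewrite !mxE. Qed.

Let mg : measurable_fun setT g.
Proof.
apply: measurable_funB => //; under eq_fun do rewrite vdot_lv.
by apply: measurable_sum => i; exact: measurable_funM.
Qed.

Let bF : bfun F.
Proof. by exists M => t; rewrite ler_norml; exact: hF. Qed.

Let bg_fun : bfun g.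
Proof.
apply: bfunB => //.
have [B hB] : bfun (fun t => \sum_i a i * ell i t).
  by apply: bfun_sum => i; apply: bfunM => //; exact: bfun_cst.
by exists B => t; rewrite vdot_lv.
Qed.

Let g_ell j : Rintegral p setT (fun t => g t * ell j t) = 0.
Proof. by rewrite -(hproj j); apply: eq_Rintegral => t _; rewrite /g vdot_lv. Qed.

Let ibm (h : T -> R) : measurable_fun setT h -> bfun h -> p.-integrable setT (EFin \o h).
Proof. exact: bounded_integrable. Qed.

(** Pythagoras: [g] is orthogonal to the span of the orthonormal [ell]. *)
Let residual_sqr (v : 'cV[R]_n) :
  (\int[p]_t ((g t + vdot v (lv t)) ^+ 2)%:E)%E = (e + vdot v v)%:E.
Proof.
pose f2 t := 2 * \sum_i v i 0 * (g t * ell i t).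
pose f3 t := \sum_i \sum_j (v i 0 * v j 0) * (ell i t * ell j t).
have E t : (g t + vdot v (lv t)) ^+ 2 = g t ^+ 2 + f2 t + f3 t.
  have -> : vdot v (lv t) = \sum_i v i 0 * ell i t.
    by rewrite vdotE; apply: eq_bigr => i _; rewrite mxE.
  have -> : f2 t = 2 * (g t * \sum_i v i 0 * ell i t).
    by rewrite /f2; congr (_ * _); rewrite mulr_sumr; apply: eq_bigr => i _; ring.
  have -> : f3 t = (\sum_i v i 0 * ell i t) ^+ 2.
    rewrite expr2 mulr_suml; apply: eq_bigr => i _; rewrite mulr_sumr.
    by apply: eq_bigr => j _; ring.
  by ring.
have i1 : p.-integrable setT (EFin \o (fun t => g t ^+ 2)).
  by apply: ibm; [exact: measurable_funX|exact: (bfunM bg_fun bg_fun)].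
have ige i : p.-integrable setT (EFin \o (fun t => g t * ell i t)).
  by apply: ibm; [exact: measurable_funM|exact: bfunM].
have i2' : p.-integrable setT (EFin \o (fun t => \sum_i v i 0 * (g t * ell i t))).
  by apply: integrable_sum_EFin => i; exact: integrableZ_EFin.
have i2 : p.-integrable setT (EFin \o f2) by exact: integrableZ_EFin.
have i3 : p.-integrable setT (EFin \o f3).
  by apply: integrable_sum_EFin => i; apply: integrable_sum_EFin => j; exact: integrableZ_EFin.
have i12 := integrableD_EFin i1 i2.
have i123 := integrableD_EFin i12 i3.
under eq_integral do rewrite E.
rewrite integral_EFin_Rintegral // RintegralD // RintegralD //; congr (_%:E).
rewrite /f2 RintegralZl // Rintegral_sum => [|i]; last exact: integrableZ_EFin.
rewrite big1 ?mulr0 ?addr0 => [|i _]; last by rewrite RintegralZl // g_ell mulr0.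
congr (_ + _); rewrite /f3 vdotE Rintegral_sum => [|i]; last first.
  by apply: integrable_sum_EFin => j; exact: integrableZ_EFin.
apply: eq_bigr => i _; rewrite Rintegral_sum => [|j]; last exact: integrableZ_EFin.
rewrite (bigD1 i) //= big1 ?addr0 => [|j ji]; rewrite RintegralZl // orth.
  by rewrite eqxx mulr1.
by rewrite eq_sym (negPf ji) mulr0.
Qed.

Let outerE t (v : 'cV[R]_n) : lv t *m (lv t)^T *m v = vdot v (lv t) *: lv t.
Proof.
rewrite -mulmxA; apply/matrixP => i k; rewrite (ord1 k) mxE big_ord1 [RHS]mxE mulrC.
by congr (_ * _); rewrite -/(vdot (lv t) v) vdotC.
Qed.

Let G_sub w : G w - Dn w = N%:R^-1 *: \sum_j lv (mus j w) *m (lv (mus j w))^T.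
Proof.
rewrite /G /ridge_design /Dn -scalerBr -sumrB; congr (_ *: _).
by apply: eq_bigr => j _; rewrite /Xm addrK.
Qed.

Let beta w : 'cV[R]_n := N%:R^-1 *: \sum_j (F (mus j w) + eta j w) *: lv (mus j w).

Let betaE w : beta w = ((G w - Dn w) *m av + bg w) + be w.
Proof.
rewrite G_sub -scalemxAl mulmx_suml /bg /be -!scalerDr -!big_split /=; congr (_ *: _).
by apply: eq_bigr => j _; rewrite outerE -!scalerDl /g; congr (_ *: _); ring.
Qed.

Let G_tr w : (G w)^T = G w.
Proof.
rewrite /G /ridge_design linearZ /= linear_sum /=; congr (_ *: _).
by apply: eq_bigr => j _; exact: Xm_tr.
Qed.

Let Dn_tr w : (Dn w)^T = Dn w.
Proof.
rewrite /Dn linearZ /= linear_sum /=; congr (_ *: _).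
by apply: eq_bigr => j _; rewrite linearZ /= Dsym.
Qed.

Let qf_Dn w v : qf (Dn w) v = N%:R^-1 * \sum_j lam * qf (D (mus j w)) v.
Proof. by rewrite qfZ qf_sum; congr (_ * _); apply: eq_bigr => j _; rewrite qfZ. Qed.

Let qf_G w v : qf (G w) v = N%:R^-1 * \sum_j (vdot v (lv (mus j w)) ^+ 2 + lam * qf (D (mus j w)) v).
Proof.
rewrite qfZ qf_sum; congr (_ * _); apply: eq_bigr => j _.
by rewrite qfD qf_outer qfZ vdotC.
Qed.

Let Ninv0 : (0 : R) <= N%:R^-1. Proof. by rewrite invr_ge0. Qed.

Let Dn_psd w : psd (Dn w).
Proof.
move=> v; rewrite qf_Dn mulr_ge0 // sumr_ge0 // => j _; rewrite mulr_ge0 //; exact: Dpsd.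
Qed.

Let Dn_le_G w v : qf (Dn w) v <= qf (G w) v.
Proof.
rewrite qf_Dn qf_G ler_wpM2l //; apply: ler_sum => j _.
by rewrite lerDr sqr_ge0.
Qed.

Let normal_equation w : G w *m cv (c w) = beta w.
Proof.
pose cst := N%:R^-1 * \sum_j (F (mus j w) + eta j w) ^+ 2.
have objE b : N%:R^-1 * \sum_j (F (mus j w) + eta j w - \sum_i b i * ell i (mus j w)) ^+ 2
    + lam * (N%:R^-1 * \sum_j \sum_i \sum_k b i * D (mus j w) i k * b k) =
    cst + (qf (G w) (cv b) - 2 * vdot (cv b) (beta w)).
  rewrite qf_G /beta vdotZr vdotC vdot_suml /cst mulrCA -mulrDr.
  rewrite [2 * _]mulrCA -mulrBr -mulrDr; congr (_ * _).
  rewrite !mulr_sumr -!sumrB -!big_split /=; apply: eq_bigr => j _.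
  rewrite -vdot_lv vdotZl (vdotC (lv _)).
  have -> : \sum_i \sum_k b i * D (mus j w) i k * b k = qf (D (mus j w)) (cv b).
    by rewrite qfE; apply: eq_bigr => i _; apply: eq_bigr => k _; rewrite !mxE.
  by ring.
apply: minimizer_normal_equation; first exact: G_tr.
move=> c'; have := hc w (fun i => c' i 0); rewrite /= !objE lerD2l.
by have -> : cv (fun i => c' i 0) = c' by apply/matrixP => i k; rewrite mxE (ord1 k).
Qed.

Let Gi w : 'M[R]_n := (\det (G w))^-1 *: \adj (G w).
(** Coefficient error of the estimator fed with the noiseless values of [F]; it depends on the
    sample only, which is what makes the cross term with the noise centred. *)
Let u w : 'cV[R]_n := av - Gi w *m ((G w - Dn w) *m av + bg w).

Let iP (h : Omega -> R) : measurable_fun setT h -> bfun h -> P.-integrable setT (EFin \o h).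
Proof. exact: bounded_integrable. Qed.

Let qf_Dn_expectation :
  (P.-integrable setT (EFin \o (fun w => qf (Dn w) av)) /\ bfun (fun w => qf (Dn w) av)) /\
  Rintegral P setT (fun w => qf (Dn w) av) = lam * Rintegral p setT (fun t => qf (D t) av).
Proof.
have mq : measurable_fun setT (fun t => qf (D t) av).
  under eq_fun do rewrite qfE.
  apply: measurable_sum => i; apply: measurable_sum => k.
  by apply: measurable_funM => //; apply: measurable_funM => //; exact: mD.
have bq : bfun (fun t => qf (D t) av).
  have [B hB] : bfun (fun t => \sum_i \sum_k av i 0 * D t i k * av k 0).
    apply: bfun_sum => i; apply: bfun_sum => k; apply: bfunM; last exact: bfun_cst.
    by apply: bfunM; [exact: bfun_cst|exact: bD].
  by exists B => t; rewrite qfE.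
have iq j : P.-integrable setT (EFin \o (fun w => qf (D (mus j w)) av)).
  by apply: iP; [exact: (measurableT_comp mq)|exact: (bfun_comp (mus j) bq)].
have E : (fun w => qf (Dn w) av) = fun w => N%:R^-1 * \sum_j lam * qf (D (mus j w)) av.
  by apply/funext => w; exact: qf_Dn.
have is1 : P.-integrable setT (EFin \o (fun w => \sum_j lam * qf (D (mus j w)) av)).
  by apply: integrable_sum_EFin => j; exact: integrableZ_EFin.
rewrite E; split; first split; first exact: integrableZ_EFin.
  apply: bfunM; first exact: bfun_cst.
  apply: bfun_sum => j; apply: bfunM; first exact: bfun_cst.
  exact: (bfun_comp (mus j) bq).
rewrite RintegralZl // Rintegral_sum => [|j]; last exact: integrableZ_EFin.
rewrite (eq_bigr (fun=> lam * Rintegral p setT (fun t => qf (D t) av))) => [|j _]; last first.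
  by rewrite RintegralZl // -(expectation_sample j mq bq).
by rewrite sumr_const card_ord -[X in _ * X]mulr_natl mulrA mulVf ?mul1r // gt_eqF.
Qed.

Let sqr_mean (x : 'I_N -> Omega -> R) w :
  let b : 'cV[R]_n := N%:R^-1 *: \sum_j x j w *: lv (mus j w) in
  vdot b b = \sum_i (N%:R^-1 * \sum_j x j w * ell i (mus j w)) ^+ 2.
Proof.
rewrite /= vdotE; apply: eq_bigr => i _; rewrite -expr2; congr (_ ^+ 2).
by rewrite mxE summxE; congr (_ * _); apply: eq_bigr => j _; rewrite !mxE.
Qed.

(** The products [g ell_i] are centred by orthogonality, so only diagonal terms remain; summed over
    [i] they are at most [K e], because [K] dominates the sum of the [ell_i ^ 2] pointwise. *)
Let bias_moment :
  P.-integrable setT (EFin \o (fun w => vdot (bg w) (bg w))) /\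
  Rintegral P setT (fun w => vdot (bg w) (bg w)) <= K * e / N%:R.
Proof.
pose phi i t := g t * ell i t.
have mphi i : measurable_fun setT (phi i) by exact: measurable_funM.
have bphi i : bfun (phi i) by exact: bfunM.
have H i : P.-integrable setT (EFin \o (fun w => (N%:R^-1 * \sum_j phi i (mus j w)) ^+ 2)) /\
    Rintegral P setT (fun w => (N%:R^-1 * \sum_j phi i (mus j w)) ^+ 2) <=
    Rintegral p setT (fun t => phi i t * phi i t) / N%:R.
  apply: mean_second_moment => [j k|j k jk|j].
  - apply: iP; first by apply: measurable_funM; exact: (measurableT_comp (mphi i)).
    by apply: bfunM; exact: (bfun_comp _ (bphi i)).
  - by rewrite (expectation_sample_pair jk) // /phi g_ell mul0r.
  - by rewrite -(expectation_sample j) //; [exact: measurable_funM|exact: bfunM].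
have E : (fun w => vdot (bg w) (bg w)) = fun w => \sum_i (N%:R^-1 * \sum_j phi i (mus j w)) ^+ 2.
  by apply/funext => w; rewrite /bg (sqr_mean (fun j w => g (mus j w))).
rewrite E; split; first by apply: integrable_sum_EFin => i; case: (H i).
rewrite Rintegral_sum => [|i]; last by case: (H i).
apply: (@le_trans _ _ (\sum_i Rintegral p setT (fun t => phi i t * phi i t) / N%:R)).
  by apply: ler_sum => i _; case: (H i).
have ipp i : p.-integrable setT (EFin \o (fun t => phi i t * phi i t)).
  by apply: ibm; [exact: measurable_funM|exact: bfunM].
have i1 : p.-integrable setT (EFin \o (fun t => g t ^+ 2)).
  by apply: ibm; [exact: measurable_funX|exact: (bfunM bg_fun bg_fun)].
rewrite -mulr_suml ler_wpM2r // -Rintegral_sum // -RintegralZl //.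
apply: le_Rintegral => //; [exact: integrable_sum_EFin|exact: integrableZ_EFin|].
move=> t _; have -> : \sum_i phi i t * phi i t = (\sum_i ell i t ^+ 2) * g t ^+ 2.
  by rewrite mulr_suml; apply: eq_bigr => i _; rewrite /phi; ring.
rewrite ler_wpM2r ?sqr_ge0 //; apply: le_trans (hK t); apply: ler_sum => i _.
by rewrite lerDl mulr_ge0 //; exact: psd_diag_ge0.
Qed.

Let noise_moment :
  P.-integrable setT (EFin \o (fun w => vdot (be w) (be w))) /\
  Rintegral P setT (fun w => vdot (be w) (be w)) <= sigma2 * (n%:R / N%:R).
Proof.
have abi j (W : Omega -> R) (f : R -> R) := @all_but_integral _ _ _ P _ _ _ _ N mus eta mmus meta indep j W f.
have mid : measurable_fun setT (idfun : R -> R) by exact: measurable_id.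
(* The noise is unbounded, so integrability of the product comes from independence used twice: first
   to multiply the bounded [V] by [eta j], then the result by the centred [eta k]. *)
have cross i j k : j != k ->
    P.-integrable setT (EFin \o (fun w => (eta j w * ell i (mus j w)) * (eta k w * ell i (mus k w)))) /\
    Rintegral P setT (fun w => (eta j w * ell i (mus j w)) * (eta k w * ell i (mus k w))) = 0.
  move=> jk; pose V w := ell i (mus j w) * ell i (mus k w).
  have mV d' (T' : measurableType d') (h : T' -> Omega) :
      (forall l, measurable_fun setT (mus l \o h)) -> measurable_fun setT (V \o h).
    move=> hm; apply: measurable_funM.
      exact: (measurableT_comp (mell i) (hm j)).
    exact: (measurableT_comp (mell i) (hm k)).
  have bV : bfun V by apply: bfunM; [exact: (bfun_comp _ (bell i))|exact: (bfun_comp _ (bell i))].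
  have iV : P.-integrable setT (EFin \o V) by apply: iP => //; exact: (mV _ _ idfun).
  have mVj : measurable_fun setT (V : g_sigma_algebraType (all_but mus eta j) -> R).
    by apply: (mV _ _ (idfun : g_sigma_algebraType (all_but mus eta j) -> Omega)) => l; exact: all_but_measurableX.
  have [iVj _] := abi j V idfun mVj mid iV (ieta j).
  pose W w := V w * eta j w.
  have mW : measurable_fun setT (W : g_sigma_algebraType (all_but mus eta k) -> R).
    apply: measurable_funM; last exact: (all_but_measurableY (X := mus) (Y := eta) jk).
    by apply: (mV _ _ (idfun : g_sigma_algebraType (all_but mus eta k) -> Omega)) => l; exact: all_but_measurableX.
  have [iWk EW] := abi k W idfun mW mid iVj (ieta k).
  have E : (fun w => (eta j w * ell i (mus j w)) * (eta k w * ell i (mus k w))) = fun w => W w * eta k w.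
    by apply/funext => w; rewrite /W /V; ring.
  by rewrite E; split=> //; rewrite EW [X in _ * X]eta_mean mulr0.
have diag i j :
    P.-integrable setT (EFin \o (fun w => (eta j w * ell i (mus j w)) * (eta j w * ell i (mus j w)))) /\
    Rintegral P setT (fun w => (eta j w * ell i (mus j w)) * (eta j w * ell i (mus j w))) <= sigma2.
  pose V t := ell i t * ell i t.
  have mV : measurable_fun setT V by exact: measurable_funM.
  have bV : bfun V by exact: bfunM.
  have mVj : measurable_fun setT (V \o mus j : g_sigma_algebraType (all_but mus eta j) -> R).
    by apply: (measurableT_comp mV); exact: all_but_measurableX.
  have iV : P.-integrable setT (EFin \o (V \o mus j)).
    by apply: iP; [exact: (measurableT_comp mV)|exact: bfun_comp].
  have msq : measurable_fun setT (fun x : R => x ^+ 2) by exact: measurable_funX.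
  have [iVj EV] := abi j (V \o mus j) (fun x => x ^+ 2) mVj msq iV (ieta2 j).
  have E : (fun w => (eta j w * ell i (mus j w)) * (eta j w * ell i (mus j w))) =
      fun w => (V \o mus j) w * eta j w ^+ 2.
    by apply/funext => w; rewrite /V /=; ring.
  rewrite E; split => //; rewrite EV (expectation_sample j mV bV) orth eqxx mul1r.
  exact: eta_var.
have H i : P.-integrable setT (EFin \o (fun w => (N%:R^-1 * \sum_j eta j w * ell i (mus j w)) ^+ 2)) /\
    Rintegral P setT (fun w => (N%:R^-1 * \sum_j eta j w * ell i (mus j w)) ^+ 2) <= sigma2 / N%:R.
  apply: (@mean_second_moment _ _ _ P N (fun j w => eta j w * ell i (mus j w))) => [j k|j k jk|j].
  - by have [->|jk] := eqVneq j k; [case: (diag i k)|case: (cross i j k jk)].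
  - by case: (cross i j k jk).
  - by case: (diag i j).
have E : (fun w => vdot (be w) (be w)) = fun w => \sum_i (N%:R^-1 * \sum_j eta j w * ell i (mus j w)) ^+ 2.
  by apply/funext => w; rewrite /be (sqr_mean eta).
rewrite E; split; first by apply: integrable_sum_EFin => i; case: (H i).
rewrite Rintegral_sum => [|i]; last by case: (H i).
apply: (@le_trans _ _ (\sum_(i < n) (sigma2 / N%:R))).
  by apply: ler_sum => i _; case: (H i).
by rewrite sumr_const card_ord -[X in X <= _]mulr_natl mulrCA.
Qed.

Let measurable_Gi d' (T' : measurableType d') (h : T' -> Omega) :
  (forall j, measurable_fun setT (mus j \o h)) -> mmx (Gi \o h).
Proof.
move=> hm; apply: (@mmx_inv_adj _ _ _ _ (G \o h)) => i k.
have -> : (fun w => (G \o h) w i k) = fun w => N%:R^-1 * \sum_j Xm (mus j (h w)) i k.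
  by apply/funext => w; rewrite /= /G /ridge_design mxE summxE.
apply: measurable_funM => //; apply: measurable_sum => j.
exact: (measurableT_comp (mXm i k) (hm j)).
Qed.

Let measurable_u d' (T' : measurableType d') (h : T' -> Omega) i :
  (forall j, measurable_fun setT (mus j \o h)) ->
  measurable_fun setT (fun w => u (h w) i 0).
Proof.
move=> hm; have mGi := measurable_Gi hm.
have -> : (fun w => u (h w) i 0) = fun w => av i 0 - \sum_k Gi (h w) i k *
    ((\sum_l (N%:R^-1 * \sum_j ell k (mus j (h w)) * ell l (mus j (h w))) * av l 0) +
     N%:R^-1 * \sum_j g (mus j (h w)) * ell k (mus j (h w))).
  apply/funext => w; rewrite /u mxE [X in _ + X]mxE [X in _ - X]mxE; congr (_ - _).
  apply: eq_bigr => k _; congr (_ * _); rewrite mxE; congr (_ + _).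
    rewrite mxE; apply: eq_bigr => l _; congr (_ * _); rewrite G_sub mxE summxE.
    by congr (_ * _); apply: eq_bigr => j _; rewrite mxE big_ord1 !mxE.
  by rewrite /bg mxE summxE; congr (_ * _); apply: eq_bigr => j _; rewrite !mxE.
apply: measurable_funB => //; apply: measurable_sum => k; apply: measurable_funM; first exact: mGi.
apply: measurable_funD.
  apply: measurable_sum => l; apply: measurable_funM => //; apply: measurable_funM => //.
  apply: measurable_sum => j; apply: measurable_funM.
    exact: (measurableT_comp (mell k) (hm j)).
  exact: (measurableT_comp (mell l) (hm j)).
apply: measurable_funM => //; apply: measurable_sum => j; apply: measurable_funM.
  exact: (measurableT_comp mg (hm j)).
exact: (measurableT_comp (mell k) (hm j)).
Qed.

Let vdot_abs_le (x y : 'cV[R]_n) : `|vdot x y| <= (vdot x x + vdot y y) / 2.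
Proof.
have h1 := vdot_ge0 (x + y); have h2 := vdot_ge0 (x - y).
rewrite vdotDl !vdotDr (vdotC y x) in h1.
rewrite vdotBl !vdotBr (vdotC y x) in h2.
by rewrite ler_norml; lra.
Qed.

Let vdot_sqrB (x y : 'cV[R]_n) :
  vdot (x - y) (x - y) = vdot x x - 2 * vdot x y + vdot y y.
Proof. by rewrite vdotBl !vdotBr (vdotC y x); ring. Qed.

Let clip (x : R) : R := Num.max (- M) (Num.min x M).

Let clip_bound x : - M <= clip x <= M.
Proof.
rewrite /clip le_max lexx /= ge_max ge_min lexx orbT andbT.
by move: M0; lra.
Qed.

Let clip_sqr_le (y x : R) : - M <= y <= M -> (y - clip x) ^+ 2 <= (y - x) ^+ 2.
Proof.
move=> /andP[y1 y2]; rewrite /clip.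
case: (leP x M) => xM; case: (leP (- M) _) => xM'; nra.
Qed.

Theorem ridge_risk :
  (\int[P]_w (\int[p]_t ((F t - Num.max (- M) (Num.min (\sum_i c w i * ell i t) M)) ^+ 2)%:E) <=
   (2 * Rintegral p setT (fun t => (F t - \sum_i a i * ell i t) ^+ 2)
    + 8 * lam * Rintegral p setT (fun t => \sum_i \sum_k a i * D t i k * a k)
    + 4 * (sigma2 / sigmin ^+ 2) * (n%:R / N%:R)
    + 2 * M ^+ 2 * (N%:R `^ (- r)))%:E)%E.
Proof.
have [fl [mfl bfl fl0 Efl flG]] := good_event.
pose pca := Rintegral p setT (fun t => qf (D t) av).
have -> : Rintegral p setT (fun t => \sum_i \sum_k a i * D t i k * a k) = pca.
  apply: eq_Rintegral => t _; rewrite qfE.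
  by apply: eq_bigr => i _; apply: eq_bigr => k _; rewrite !mxE.
have -> : Rintegral p setT (fun t => (F t - \sum_i a i * ell i t) ^+ 2) = e.
  by apply: eq_Rintegral => t _; rewrite /g vdot_lv.
have M24 : 0 <= 4 * M ^+ 2 by apply: mulr_ge0 => //; exact: sqr_ge0.
have s0i : 0 <= s0 ^- 2 by rewrite invr_ge0 exprn_ge0 // ltW.
have s0c : 0 <= 4 / (3 * s0 ^+ 2).
  by apply: divr_ge0 => //; apply: mulr_ge0 => //; apply: exprn_ge0; exact: ltW.
(* Coefficient of [eta j] in the cross term, cut off to the good event. The cutoff keeps it bounded
   and still a function of the sample alone. *)
pose W j w := if fl w < 1 then vdot (u w) (Gi w *m lv (mus j w)) else 0.
have mmus_id : forall j, measurable_fun setT (mus j \o idfun) by [].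
have mW d' (T' : measurableType d') (h : T' -> Omega) j :
    (forall l, measurable_fun setT (mus l \o h)) -> measurable_fun setT (W j \o h).
  move=> hm; apply: measurable_fun_ifT.
  - by apply: measurable_fun_ltr => //; exact: mfl.
  - have -> : (fun w => vdot (u (h w)) (Gi (h w) *m lv (mus j (h w)))) =
        fun w => \sum_i u (h w) i 0 * \sum_k Gi (h w) i k * ell k (mus j (h w)).
      apply/funext => w; rewrite vdotE; apply: eq_bigr => i _; congr (_ * _).
      by rewrite mxE; apply: eq_bigr => k _; rewrite [X in _ * X]mxE.
    apply: measurable_sum => i; apply: measurable_funM; first exact: measurable_u.
    apply: measurable_sum => k; apply: measurable_funM; first exact: (measurable_Gi hm).
    exact: (measurableT_comp (mell k) (hm j)).
  - exact: measurable_cst.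
pose H w := 4 / s0 * qf (Dn w) av + 4 / (3 * s0 ^+ 2) * vdot (bg w) (bg w).
have Gi_inv w : fl w < 1 -> Gi w = invmx (G w).
  move=> fw; have Gu := coercive_unitmx (G_tr w) s00 (flG w fw).
  by rewrite /invmx Gu.
have uH w : fl w < 1 -> vdot (u w) (u w) <= H w.
  move=> fw; apply: (ridge_estimate (G_tr w) s00 (flG w fw) (Dn_tr w) (Dn_psd w) (Dn_le_G w)).
  by rewrite /u Gi_inv.
have Gi_le w x : fl w < 1 -> vdot (Gi w *m x) (Gi w *m x) <= s0 ^- 2 * vdot x x.
  move=> fw; rewrite mulrC ler_pdivlMr ?exprn_gt0 // mulrC.
  apply: (coercive_solution s00 (flG w fw)).
  by rewrite Gi_inv // mulKVmx // (coercive_unitmx (G_tr w) s00 (flG w fw)).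
have [[iDn bDn] EDn] := qf_Dn_expectation.
have [ibg Ebg] := bias_moment.
have [ibe Ebe] := noise_moment.
have bbg : bfun (fun w => vdot (bg w) (bg w)).
  have [B hB] : bfun (fun w => \sum_i (N%:R^-1 * \sum_j g (mus j w) * ell i (mus j w)) ^+ 2).
    apply: bfun_sum => i.
    have b1 : bfun (fun w => N%:R^-1 * \sum_j g (mus j w) * ell i (mus j w)).
      apply: bfunM; first exact: bfun_cst.
      apply: bfun_sum => j; apply: bfunM; first exact: (bfun_comp (mus j) bg_fun).
      exact: (bfun_comp (mus j) (bell i)).
    exact: (bfunM b1 b1).
  by exists B => w; rewrite /bg (sqr_mean (fun j w => g (mus j w))).
have bW j : bfun (W j).
  have [B hB] : bfun (fun w => (H w + s0 ^- 2 * \sum_i ell i (mus j w) * ell i (mus j w)) / 2).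
    apply: bfunM; last exact: bfun_cst.
    apply: bfunD; first by apply: bfunD; (apply: bfunM => //; exact: bfun_cst).
    apply: bfunM; first exact: bfun_cst.
    by apply: bfun_sum => i; apply: bfunM; exact: (bfun_comp (mus j) (bell i)).
  exists B => w; rewrite /W; case: ifP => fw; last by rewrite normr0 (le_trans _ (hB w)).
  apply: (le_trans (vdot_abs_le _ _)); apply: le_trans (le_trans (ler_norm _) (hB w)).
  rewrite ler_wpM2r // lerD // ?uH //; apply: (le_trans (Gi_le _ _ fw)).
  apply: ler_wpM2l; first by rewrite invr_ge0 exprn_ge0 // ltW.
  rewrite vdotE le_eqVlt; apply/orP; left; apply/eqP.
  by apply: eq_bigr => i _; rewrite !mxE.
have cross j : P.-integrable setT (EFin \o (fun w => W j w * eta j w)) /\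
    Rintegral P setT (fun w => W j w * eta j w) = 0.
  have mWj : measurable_fun setT (W j : g_sigma_algebraType (all_but mus eta j) -> R).
    apply: (mW _ _ (idfun : g_sigma_algebraType (all_but mus eta j) -> Omega)) => l.
    exact: all_but_measurableX.
  have iW : P.-integrable setT (EFin \o W j) by apply: iP => //; exact: (mW _ _ idfun).
  have [i1 E1] := @all_but_integral _ _ _ P _ _ _ _ N mus eta mmus meta indep j (W j) idfun
    mWj (@measurable_id _ _ _) iW (ieta j).
  by split=> //; rewrite E1 [X in _ * X]eta_mean mulr0.
(* The integrable majorant of the loss: the squared coefficient error on the good event, plus
   [4 M^2 fl], which covers the complement since [fl >= 1] there. *)
pose h w := e + (4 / s0 * qf (Dn w) av + 4 / (3 * s0 ^+ 2) * vdot (bg w) (bg w)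
  + s0 ^- 2 * vdot (be w) (be w)) - 2 * N%:R^-1 * (\sum_j W j w * eta j w) + 4 * M ^+ 2 * fl w.
have point w : (\int[p]_t ((F t - clip (\sum_i c w i * ell i t)) ^+ 2)%:E <= (h w)%:E)%E.
  have [fw|fw] := ltP (fl w) 1.
    apply: (@le_trans _ _ (\int[p]_t ((F t - \sum_i c w i * ell i t) ^+ 2)%:E)%E).
      apply: ge0_le_integral_nonmeasurable => t; first by rewrite lee_fin sqr_ge0.
      by rewrite lee_fin clip_sqr_le.
    have -> : (fun t => ((F t - \sum_i c w i * ell i t) ^+ 2)%:E) =
        fun t => ((g t + vdot (av - cv (c w)) (lv t)) ^+ 2)%:E.
      apply/funext => t; rewrite vdotBl -(vdot_lv (c w)) /g; congr (_ ^+ 2)%:E.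
      by ring.
    rewrite residual_sqr lee_fin /h -!addrA lerD2l !addrA.
    have Gu := coercive_unitmx (G_tr w) s00 (flG w fw).
    have cE : av - cv (c w) = u w - Gi w *m be w.
      rewrite -[cv (c w)](mulKmx Gu) normal_equation betaE /u Gi_inv //.
      by rewrite [in LHS]mulmxDr opprD addrA.
    have beE : vdot (u w) (Gi w *m be w) = N%:R^-1 * \sum_j W j w * eta j w.
      rewrite /be -scalemxAr vdotZr vdotC mulmx_sumr vdot_suml; congr (_ * _).
      apply: eq_bigr => j _; rewrite -scalemxAr vdotZl vdotC mulrC /W fw.
      by congr (_ * _).
    rewrite cE vdot_sqrB beE.
    have := uH w fw; have := Gi_le w (be w) fw; have := fl0 w; rewrite /H.
    have : 0 <= 4 * M ^+ 2 * fl w by apply: mulr_ge0; [exact: M24|exact: fl0].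
    lra.
  (* Bad event: both functions lie in [[-M, M]], the cross term of [h] is zero by the cutoff, and
     its other terms are nonnegative. *)
  apply: (@le_trans _ _ (\int[p]_t (4 * M ^+ 2)%:E)%E).
    apply: ge0_le_integral_nonmeasurable => t; first by rewrite lee_fin sqr_ge0.
    rewrite lee_fin; have /andP[f1 f2] := hF t.
    have /andP[] := clip_bound (\sum_i c w i * ell i t).
    move: (clip _) => y y1 y2; nra.
  rewrite (integral_EFin_Rintegral (integrable_cst p _)) Rintegral_cst //.
  have -> : fine (p setT) = 1 by rewrite probability_setT.
  rewrite mulr1 lee_fin /h.
  have -> : \sum_j W j w * eta j w = 0.
    by apply: big1 => j _; rewrite /W ltNge fw mul0r.
  have e0 : 0 <= e by apply: Rintegral_ge0 => t _; exact: sqr_ge0.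
  have t1 : 0 <= 4 / s0 * qf (Dn w) av by apply: mulr_ge0; [rewrite divr_ge0 // ltW|exact: Dn_psd].
  have t2 : 0 <= 4 / (3 * s0 ^+ 2) * vdot (bg w) (bg w).
    by apply: mulr_ge0; [exact: s0c|exact: vdot_ge0].
  have t3 : 0 <= s0 ^- 2 * vdot (be w) (be w).
    by apply: mulr_ge0; [exact: s0i|exact: vdot_ge0].
  have t4 : 4 * M ^+ 2 * 1 <= 4 * M ^+ 2 * fl w by apply: ler_wpM2l; [exact: M24|exact: fw].
  lra.
have ifl : P.-integrable setT (EFin \o fl) by apply: iP => //; exact: (mfl _ _ idfun).
have i1 : P.-integrable setT (EFin \o (fun w => 4 / s0 * qf (Dn w) av)) by exact: integrableZ_EFin.
have i2 : P.-integrable setT (EFin \o (fun w => 4 / (3 * s0 ^+ 2) * vdot (bg w) (bg w))).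
  exact: integrableZ_EFin.
have i3 : P.-integrable setT (EFin \o (fun w => s0 ^- 2 * vdot (be w) (be w))) by exact: integrableZ_EFin.
have i4' : P.-integrable setT (EFin \o (fun w => \sum_j W j w * eta j w)).
  by apply: integrable_sum_EFin => j; case: (cross j).
have i4 : P.-integrable setT (EFin \o (fun w => 2 * N%:R^-1 * (\sum_j W j w * eta j w))).
  exact: integrableZ_EFin.
have i5 : P.-integrable setT (EFin \o (fun w => 4 * M ^+ 2 * fl w)) by exact: integrableZ_EFin.
have j1 := integrableD_EFin i1 i2.
have j2 := integrableD_EFin j1 i3.
have j3 := integrableD_EFin (integrable_cst P e) j2.
have j4 := integrableB_EFin j3 i4.
have j5 := integrableD_EFin j4 i5.
apply: (@le_trans _ _ (\int[P]_w (h w)%:E)%E).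
  apply: ge0_le_integral_nonmeasurable => [w|w]; last exact: point.
  by apply: integral_ge0 => t _; rewrite lee_fin sqr_ge0.
rewrite integral_EFin_Rintegral // lee_fin /h.
rewrite RintegralD // RintegralB // RintegralD //; last exact: integrable_cst.
rewrite RintegralD // RintegralD // !RintegralZl // Rintegral_cst //.
have -> : fine (P setT) = 1 by rewrite probability_setT.
rewrite EDn Rintegral_sum => [|j]; last by case: (cross j).
rewrite big1 => [|j _]; last by case: (cross j).
rewrite mulr1 mulr0 subr0 -/pca.
have sp : 0 < sigmin by move: sigmin1; lra.
have s0E : s0 = sigmin / 2 by [].
have pca0 : 0 <= pca by apply: Rintegral_ge0 => t _; exact: Dpsd.
have e0 : 0 <= e by apply: Rintegral_ge0 => t _; exact: sqr_ge0.
have b1 : 4 / s0 * (lam * pca) <= 8 * lam * pca.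
  have -> : 4 / s0 * (lam * pca) = 8 * (lam * pca) / sigmin.
    by rewrite s0E; field; rewrite gt_eqF.
  rewrite -[8 * lam * pca]mulrA ler_pdivrMr // ler_peMr // mulr_ge0 // mulr_ge0 //.
(* With [s0 = sigmin / 2] the factor of [e] is [(16/3) K / (sigmin^2 N)]. Here 16/3 is 8 times the
   lower bound 2/3 on [ln N], so [hN] and [sigmin >= 1] bound it by 1. *)
have b2 : 4 / (3 * s0 ^+ 2) * Rintegral P setT (fun w => vdot (bg w) (bg w)) <= e.
  apply: (@le_trans _ _ (4 / (3 * s0 ^+ 2) * (K * e / N%:R))).
    by apply: ler_wpM2l; [exact: s0c|exact: Ebg].
  have -> : 4 / (3 * s0 ^+ 2) * (K * e / N%:R) = (16 / 3 * K) * e / (sigmin ^+ 2 * N%:R).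
    by rewrite s0E; field; rewrite !gt_eqF.
  rewrite ler_pdivrMr ?mulr_gt0 ?exprn_gt0 // mulrC ler_wpM2l //.
  have K0 : 0 <= K by apply: le_trans K_ge; rewrite mulr_ge0 // ltW.
  have h1 : 16 / 3 * K <= N%:R * sigmin.
    apply: le_trans hN.
    have : K * (2 / 3) <= K * ln N%:R by rewrite ler_wpM2l.
    have : 0 <= r * (K * ln N%:R).
      by rewrite mulr_ge0 ?(ltW r0) // mulr_ge0 //; move: lnN; lra.
    lra.
  apply: (le_trans h1); rewrite mulrC ler_wpM2r // expr2 ler_peMr // ltW //.
have b3 : s0 ^- 2 * Rintegral P setT (fun w => vdot (be w) (be w)) <=
    4 * (sigma2 / sigmin ^+ 2) * (n%:R / N%:R).
  apply: (@le_trans _ _ (s0 ^- 2 * (sigma2 * (n%:R / N%:R)))).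
    by apply: ler_wpM2l; [exact: s0i|exact: Ebe].
  rewrite le_eqVlt; apply/orP; left; apply/eqP; rewrite s0E; field.
  by rewrite !gt_eqF.
have b4 : 4 * M ^+ 2 * Rintegral P setT fl <= 2 * M ^+ 2 * N%:R `^ (- r).
  have -> : 2 * M ^+ 2 * N%:R `^ (- r) = 4 * M ^+ 2 * (N%:R `^ (- r) / 2) by field.
  by apply: ler_wpM2l; [exact: M24|exact: Efl].
lra.
Qed.

End RidgeRegression.

Unset Implicit Arguments. Set Strict Implicit. Set Printing Implicit Defensive.

Theorem theorem4p14 (R : realType) (d : nat) (K : set (Rd R d)) (k0 : Rd R d)
  (hk0 : K k0) (hK : compact (K : set 'rV[R]_d))
  (p : probability (PKm hk0) R) (lam : R) (hlam : 0 <= lam) (n N : nat)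
  (m : 'I_n -> nat) (psi : forall i, 'rV[R]_(m i) -> R)
  (phi : forall i, 'I_(m i) -> 'rV[R]_d -> R)
  (hpsi : forall i, C1b (psi i)) (hphi : forall i k, C1b (phi i k))
  (horth : forall i j : 'I_n,
     Rintegral p setT (fun mu : PKm hk0 =>
        ell psi phi i (proj1_sig mu) * ell psi phi j (proj1_sig mu)) = (i == j)%:R)
  (hpCEorth : forall i j : 'I_n, i != j ->
     pCE p (Dell psi phi i) (Dell psi phi j) = 0)
  (dO : measure_display) (Omega : measurableType dO) (P : probability Omega R)
  (mus : 'I_N -> Omega -> PKm hk0) (eta : 'I_N -> Omega -> R)
  (hmus_meas : forall j, measurable_fun setT (mus j))
  (heta_meas : forall j, measurable_fun setT (eta j))
  (hmus_law : forall j (A : set (PKm hk0)), measurable A ->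
     P (mus j @^-1` A) = p A)
  (heta_law : forall j k (B : set R), measurable B ->
     P (eta j @^-1` B) = P (eta k @^-1` B))
  (hindep : forall (A : 'I_N -> set (PKm hk0)) (B : 'I_N -> set R),
     (forall j, measurable (A j)) -> (forall j, measurable (B j)) ->
     P (\bigcap_(j in [set: 'I_N]) (mus j @^-1` A j `&` eta j @^-1` B j)) =
     (\prod_(j < N) (P (mus j @^-1` A j) * P (eta j @^-1` B j)))%E)
  (sigma : R) (hsigma : 0 < sigma)
  (heta_int : forall j, P.-integrable setT (fun w => (eta j w)%:E))
  (heta_mean : forall j, (\int[P]_w (eta j w)%:E = 0)%E)
  (heta_var : forall j, (\int[P]_w ((eta j w) ^+ 2)%:E <= (sigma ^+ 2)%:E)%E)
  (M : R) (hM : 0 < M) (F : PKm hk0 -> R) (hF_meas : measurable_fun setT F)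
  (hF_bd : forall mu, - M <= F mu <= M)
  (c : Omega -> 'I_n -> R)
  (hc_min : forall w (c' : 'I_n -> R),
     let obj (b : 'I_n -> R) :=
       N%:R^-1 * \sum_(j < N)
          (F (mus j w) + eta j w - Veval psi phi b (proj1_sig (mus j w))) ^+ 2
       + lam * (N%:R^-1 * \sum_(j < N)
          Rintegral (proj1_sig (mus j w)) setT
            (fun x => sqnorm (VD psi phi b (proj1_sig (mus j w)) x))) in
     obj (c w) <= obj c')
  (a : 'I_n -> R)
  (ha_proj : forall j : 'I_n,
     Rintegral p setT (fun mu : PKm hk0 =>
       (F mu - Veval psi phi a (proj1_sig mu)) * ell psi phi j (proj1_sig mu)) = 0)
  (r : R) (hr : 0 < r) (hN2 : (2 <= N)%N) :
  let Fstar (w : Omega) (mu : PKm hk0) : R :=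
    Num.max (- M) (Num.min (Veval psi phi (c w) (proj1_sig mu)) M) in
  let pCEell (i : 'I_n) : R := pCE p (Dell psi phi i) (Dell psi phi i) in
  let Klam : R := sup [set (\sum_(i < n)
       (ell psi phi i (proj1_sig mu) ^+ 2 + lam * Rintegral (proj1_sig mu) setT
           (fun x => sqnorm (Dell psi phi i (proj1_sig mu) x))))
       | mu in [set: PK hk0]] in
  let mumin : R := inf [set pCEell i | i in [set: 'I_n]] in
  let mumax : R := sup [set pCEell i | i in [set: 'I_n]] in
  let sigmin : R := 1 + lam * mumin in
  let sigmax : R := 1 + lam * mumax in
  let e : R := Rintegral p setT (fun mu : PKm hk0 =>
      (Veval psi phi a (proj1_sig mu) - F mu) ^+ 2) in
  N%:R / ln N%:R >= (1 + r) * Klam / (sigmin * c_delta (1 / (2 * sigmax))) ->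
  (\int[P]_w (\int[p]_mu ((F mu - Fstar w mu) ^+ 2)%:E) <=
   (2 * e * (1 + c_delta (1 / 2) / (ln N%:R * (1 + r) * (1 / 2 + lam * mumin) ^+ 2))
    + 8 * lam * pCE p (VD psi phi a) (VD psi phi a)
    + 4 * (sigma ^+ 2 / (1 + lam * mumin) ^+ 2) * (n%:R / N%:R)
    + 2 * M ^+ 2 * (N%:R `^ (- r)))%:E)%E.
Proof.
move=> Fstar pCEell Klam mumin mumax sigmin sigmax e hN.
pose ellP i (mu : PKm hk0) : R := ell psi phi i (proj1_sig mu).
pose D (mu : PKm hk0) : 'M[R]_n := @Dmat R d K k0 hk0 n m psi phi mu.
have mell i : measurable_fun setT (ellP i).
  by apply: W2cts_measurable; exact: (W2cts_ell hK hpsi hphi).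
have bell i : bfun (ellP i) by apply: bounded_ell.
have mD : mmx D.
  by move=> i k; apply: W2cts_measurable; exact: (W2cts_Dmat hK hpsi hphi).
have bD : bmx D by move=> i k; apply: bounded_Dmat.
have Dsym mu : (D mu)^T = D mu by exact: Dmat_tr.
have Dpsd mu : psd (D mu).
  by move=> v; rewrite qfE; exact: (Dmat_psd psi hphi mu (fun i => v i 0)).
have DE i (mu : PKm hk0) : D mu i i = Rintegral (proj1_sig mu) setT
    (fun x => sqnorm (Dell psi phi i (proj1_sig mu) x)) by rewrite mxE.
have pCEE i k : pCE p (Dell psi phi i) (Dell psi phi k) = Rintegral p setT (fun mu => D mu i k).
  by apply: eq_Rintegral => mu _; rewrite mxE.
have Dorth i k : i != k -> Rintegral p setT (fun mu => D mu i k) = 0.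
  by move=> ik; rewrite -pCEE hpCEorth.
have pCE0 i : 0 <= pCEell i.
  by rewrite /pCEell pCEE; apply: Rintegral_ge0 => mu _; exact: psd_diag_ge0.
have mumin0 : 0 <= mumin.
  have [n0|n0] := posnP n.
    (* With an empty basis the infimum takes the default value 0. *)
    rewrite /mumin (_ : [set _ | _ in _] = set0) ?inf0 //.
    apply/seteqP; split => // x [i _ _].
    by have := leq_ltn_trans (leq0n i) (ltn_ord i); rewrite lt0n => /eqP; apply.
  by apply: lb_le_inf => [|x [i _ <-]] //; exists (pCEell (Ordinal n0)), (Ordinal n0).
have hmu i : mumin <= Rintegral p setT (fun mu => D mu i i).
  rewrite -pCEE; apply: ge_inf; last by exists i.
  by exists 0 => x [k _ <-].
have mumax0 : 0 <= mumax.
  have [n0|n0] := posnP n.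
    rewrite /mumax (_ : [set _ | _ in _] = set0) ?sup0 //.
    apply/seteqP; split => // x [i _ _].
    by have := leq_ltn_trans (leq0n i) (ltn_ord i); rewrite lt0n => /eqP; apply.
  apply: le_trans (pCE0 (Ordinal n0)) _; apply: ub_le_sup; last by exists (Ordinal n0).
  exists (\sum_i pCEell i) => x [k _ <-].
  by rewrite (bigD1 k) //= lerDl sumr_ge0.
have hKl (mu : PKm hk0) : \sum_i (ellP i mu ^+ 2 + lam * D mu i i) <= Klam.
  apply: ub_le_sup; last first.
    by exists mu => //; apply: eq_bigr => i _; rewrite DE.
  (* A real [sup] is an upper bound only if the set is bounded; the [C1b] assumptions provide the
     bound. *)
  have [B hB] : bfun (fun nu : PKm hk0 => \sum_i (ellP i nu ^+ 2 + lam * D nu i i)).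
    apply: bfun_sum => i; apply: bfunD; first exact: (bfunM (bell i) (bell i)).
    by apply: bfunM; [exact: bfun_cst|exact: bD].
  exists B => x [nu _ <-]; apply: le_trans (ler_norm _) (le_trans _ (hB nu)).
  rewrite le_eqVlt; apply/orP; left; apply/eqP; congr (`|_|).
  by apply: eq_bigr => i _; rewrite DE.
have lnN0 : 0 < ln N%:R :> R by rewrite ln_gt0 // ltr1n.
have N0 : (0 : R) < N%:R by rewrite ltr0n (leq_trans _ hN2).
have sigmin1 : 1 <= sigmin by rewrite lerDl mulr_ge0.
have sigmax1 : 1 <= sigmax by rewrite lerDl mulr_ge0.
have d0 : 0 < 1 / (2 * sigmax) by rewrite divr_gt0 // mulr_gt0 // (lt_le_trans ltr01).
have d1 : 1 / (2 * sigmax) <= 1 / 2.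
  by rewrite ler_pdivrMr; [lra|rewrite mulr_gt0 // (lt_le_trans ltr01)].
have Klam0 : 0 <= Klam.
  apply: le_trans (hKl point); apply: sumr_ge0 => i _.
  by rewrite addr_ge0 ?sqr_ge0 // mulr_ge0 // psd_diag_ge0.
(* As [sigmax >= 1], the argument of [c_delta] is at most 1/2 and its value at most 1/8. *)
have hN' : 8 * ((1 + r) * Klam * ln N%:R) <= N%:R * sigmin.
  have cd0 := c_delta_gt0 d0.
  have cd1 : c_delta (1 / (2 * sigmax)) <= 1 / 8 by apply: c_delta_le; rewrite d0.
  have sp : 0 < sigmin by exact: lt_le_trans sigmin1.
  move: hN; rewrite ler_pdivrMr ?mulr_gt0 // mulrAC ler_pdivlMr // => hN.
  have : N%:R * (sigmin * c_delta (1 / (2 * sigmax))) <= N%:R * (sigmin * (1 / 8)).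
    by rewrite ler_pM2l // ler_pM2l.
  move: hN; move: (c_delta _) => cd; lra.
have ieta2 j : P.-integrable setT (EFin \o (fun w => eta j w ^+ 2)).
  apply/integrableP; split.
    by apply/measurable_EFinP; exact: measurable_funX.
  under eq_integral do rewrite /= ger0_norm ?sqr_ge0 //.
  by apply: le_lt_trans (heta_var j) _; rewrite ltry.
have eta_var j : Rintegral P setT (fun w => eta j w ^+ 2) <= sigma ^+ 2.
  by rewrite -lee_fin -integral_EFin_Rintegral.
have eta_mean j : Rintegral P setT (eta j) = 0 by rewrite /Rintegral heta_mean.
have hmin w (c' : 'I_n -> R) :
    let obj (b : 'I_n -> R) :=
      N%:R^-1 * \sum_j (F (mus j w) + eta j w - \sum_i b i * ellP i (mus j w)) ^+ 2
      + lam * (N%:R^-1 * \sum_j \sum_i \sum_k b i * D (mus j w) i k * b k) in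
    obj (c w) <= obj c'.
  have penE (b : 'I_n -> R) : \sum_(j < N) Rintegral (proj1_sig (mus j w)) setT
      (fun x => sqnorm (VD psi phi b (proj1_sig (mus j w)) x)) =
      \sum_j \sum_i \sum_k b i * D (mus j w) i k * b k.
    by apply: eq_bigr => j _; exact: (Rintegral_sqnorm_VD psi hphi b (mus j w)).
  by have := hc_min w c'; rewrite /= !penE.
have := @ridge_risk _ _ _ p _ _ P N n ellP D lam Klam mumin mell bell mD bD Dsym Dpsd horth
  Dorth hlam hKl mumin0 hmu mus eta hmus_meas heta_meas hmus_law hindep r hr hN2 hN'
  (sigma ^+ 2) M F a c heta_int eta_mean ieta2 eta_var hM hF_meas hF_bd ha_proj hmin.
move=> /le_trans; apply; rewrite lee_fin -/sigmin.
have -> : Rintegral p setT (fun mu => (F mu - \sum_i a i * ellP i mu) ^+ 2) = e.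
  by apply: eq_Rintegral => mu _; rewrite -sqrrN opprB.
have -> : Rintegral p setT (fun mu => \sum_i \sum_k a i * D mu i k * a k) =
    pCE p (VD psi phi a) (VD psi phi a).
  by apply: eq_Rintegral => mu _; apply/esym; exact: (Rintegral_sqnorm_VD psi hphi a mu).
(* The risk bound already holds with [2 e], and the bracket multiplying it in the statement is at
   least 1. *)
rewrite !lerD2r ler_peMr //.
  by rewrite mulr_ge0 //; apply: Rintegral_ge0 => mu _; exact: sqr_ge0.
rewrite lerDl divr_ge0 //; first by apply: ltW; apply: c_delta_gt0; rewrite divr_gt0.
apply: mulr_ge0; last exact: sqr_ge0.
by apply: mulr_ge0; [exact: ltW|move: hr; lra].
Qed.
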